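(* Let $J\ge1$, and suppose that $\max_{1\le j\le J}|y_j^\dagger|\le\kappa_y$, $\Sigma\succcurlyeq\sigma I_{d_u}$ and $\Gamma\succcurlyeq\gamma I_{d_y}$ for constants $\kappa_y,\sigma,\gamma>0$. Let $h:\mathbb{R}^{d_u}\to\mathbb{R}^{d_y}$ be linear, and let $\kappa_h,\ell_h>0$ be such that $|h(u)|\le\kappa_h(1+|u|)$ for all $u$ and $h$ is Lipschitz with constant at most $\ell_h$. Let $\Psi_0:\mathbb{R}^{d_u}\to\mathbb{R}^{d_u}$ be affine with $|\Psi_0(u)|\le\kappa_\Psi(1+|u|)$ for all $u$, where $\kappa_\Psi>0$, and let $\ell_\Psi>0$ be a constant. Let $\mu_0$ be a Gaussian probability measure on $\mathbb{R}^{d_u}$ and set $q:=2\cdot\max\{3+d_u,4+d_y,2\cdot4^J\}$. Then there exists a constant $C=C\bigl(\mathcal{M}_q(\mu_0),R_\phi,L_\phi,\kappa_y,\kappa_\Psi,\kappa_h,\ell_h,\ell_\Psi,\Sigma,\Gamma,J\bigr)$, depending only on the listed quantities, such that for all $\varepsilon\in[0,1]$ and all $\Psi:\mathbb{R}^{d_u}\to\mathbb{R}^{d_u}$ with $\|\Psi-\Psi_0\|_{L^\infty}\le\varepsilon$ that are Lipschitz with constant at most $\ell_\Psi$, and for every ensemble size $N$, the following bound holds for any $\phi:\mathbb{R}^{d_u}\to\mathbb{R}$ satisfying, for some $L_\phi>0$, $$|\phi(u)-\phi(v)|\le L_\phi|u-v|(1+|u|+|v|)\qquad\text{for all }u,v\in\mathbb{R}^{d_u},$$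 with $R_\phi>0$ such that $|\phi(u)|\le R_\phi(1+|u|^2)$ for all $u$: $$\Bigl(\mathbb{E}\,\bigl|\mu_J^{\mathrm{EK},N}[\phi]-\mu_J[\phi]\bigr|^2\Bigr)^{1/2}\le C\Bigl(\frac{1}{\sqrt N}+\varepsilon\Bigr).$$ Here $(\mu_j)_{0\le j\le J}$ is the true filter started at $\mu_0$, given by $\mu_{j+1}=\mathsf{B}_j\mathsf{Q}\mathsf{P}\mu_j$, and $(\mu_j^{\mathrm{EK},N})_{0\le j\le J}$ is the empirical measure of the $N$-particle ensemble Kalman filter started at i.i.d. samples from $\mu_0$ (both associated with $(\Psi,h)$ and defined in the context).
   Context: Fix positive integers $d_u,d_y$, symmetric positive definite matrices $\Sigma\in\mathbb{R}^{d_u\times d_u}$, $\Gamma\in\mathbb{R}^{d_y\times d_y}$, and (deterministic) data $y_1^\dagger,\dots,y_J^\dagger\in\mathbb{R}^{d_y}$. $|\cdot|$ is the Euclidean norm, $|x|_S:=|S^{-1/2}x|$ for $S$ symmetric positive definite, $\preccurlyeq$ is the positive semidefinite order, $\|\cdot\|_{L^\infty}$ is the supremum norm. The same symbol is used for a measure and its Lebesgue density. $\mathcal{M}_q(\mu):=\int|x|^q\mu(dx)$ and $\mu[f]:=\int f\,d\mu$. True filter operators associated with $(\Psi,h)$: - $\mathsf{P}\mu(u)=\frac{1}{\sqrt{(2\pi)^{d_u}\det\Sigma}}\int\exp(-\tfrac12|u-\Psi(v)|_\Sigma^2)\,\mu(dv)$. - $\mathsf{Q}\mu(u,y)=\frac{1}{\sqrt{(2\pi)^{d_y}\det\Gamma}}\exp(-\tfrac12|y-h(u)|_\Gamma^2)\,\mu(u)$.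 - $\mathsf{B}_j\pi(u)=\pi(u,y_{j+1}^\dagger)/\int\pi(U,y_{j+1}^\dagger)\,dU$ (conditioning on $y=y_{j+1}^\dagger$). Finite particle ensemble Kalman filter with $N$ particles: $u_0^{(i)}\sim\mu_0$ i.i.d., $i=1,\dots,N$, and for $0\le j\le J-1$, $$\widehat u_{j+1}^{(i)}=\Psi(u_j^{(i)})+\xi_j^{(i)},\qquad \widehat y_{j+1}^{(i)}=h(\widehat u_{j+1}^{(i)})+\eta_{j+1}^{(i)},$$ $$u_{j+1}^{(i)}=\widehat u_{j+1}^{(i)}+\mathcal{C}^{uh}(\widehat\pi_{j+1}^{\mathrm{EK},N})\bigl(\mathcal{C}^{hh}(\widehat\pi_{j+1}^{\mathrm{EK},N})+\Gamma\bigr)^{-1}\bigl(y_{j+1}^\dagger-\widehat y_{j+1}^{(i)}\bigr),$$ where $\widehat\pi_{j+1}^{\mathrm{EK},N}=\frac1N\sum_{i=1}^N\delta_{(\widehat u_{j+1}^{(i)},\widehat y_{j+1}^{(i)})}$; $\xi_j^{(i)}\sim\mathcal{N}(0,\Sigma)$ and $\eta_{j+1}^{(i)}\sim\mathcal{N}(0,\Gamma)$ are i.i.d. in $i$ and $j$, mutually independent, and independent of the initial samples. For $\pi$ a probability measure on $\mathbb{R}^{d_u}\times\mathbb{R}^{d_y}$, $\mathcal{C}^{hh}(\pi)$ is the covariance of $h(u)$, and $\mathcal{C}^{uh}(\pi)$ the cross-covariance of $u$ and $h(u)$, for $u$ distributed according to the first marginal of $\pi$ (for empirical measures, covariances are normalized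 by $1/N$). Finally $\mu_j^{\mathrm{EK},N}=\frac1N\sum_{i=1}^N\delta_{u_j^{(i)}}$ for $0\le j\le J$, and $\mathbb{E}$ is expectation over the initial samples and noises. *)

(* Defs.v *)
From HB Require Import structures.
From mathcomp Require Import all_boot all_order all_algebra.
From mathcomp Require Import all_classical all_reals all_analysis.

Set Implicit Arguments.
Unset Strict Implicit.
Unset Printing Implicit Defensive.

Import Order.TTheory GRing.Theory Num.Theory.
Import numFieldNormedType.Exports.

Local Open Scope classical_set_scope.
Local Open Scope ring_scope.

(* Column vectors carry the sigma-algebra generated by the coordinates, i.e.
   the Borel sigma-algebra of R^n. *)
Definition cV_measurable (R : realType) (n : nat) : set (set 'cV[R]_n) :=
  g_sigma_preimage (fun (i : 'I_n) (x : 'cV[R]_n) => x i 0 : measurableTypeR R).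

Lemma cV_measurable0 (R : realType) (n : nat) : cV_measurable (set0 : set 'cV[R]_n).
Proof. exact: sigma_algebra0. Qed.

Lemma cV_measurableC (R : realType) (n : nat) (A : set 'cV[R]_n) :
  cV_measurable A -> cV_measurable (~` A).
Proof. exact: sigma_algebraC. Qed.

Lemma cV_measurable_bigcup (R : realType) (n : nat) (F : (set 'cV[R]_n)^nat) :
  (forall i, cV_measurable (F i)) -> cV_measurable (\bigcup_i F i).
Proof. exact: sigma_algebra_bigcup. Qed.

HB.instance Definition _ (R : realType) (n : nat) :=
  @isMeasurable.Build default_measure_display 'cV[R]_n (@cV_measurable R n)
    (@cV_measurable0 R n) (@cV_measurableC R n) (@cV_measurable_bigcup R n).

Lemma measurable_coord (R : realType) (n : nat) (i : 'I_n) :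
  measurable_fun [set: 'cV[R]_n] (fun x => x i 0 : measurableTypeR R).
Proof.
move=> _ Y mY; rewrite setTI; apply: sub_sigma_algebra => /=.
rewrite -bigcup_seq/=; exists i => /=; first by rewrite mem_index_enum.
by exists Y => //; rewrite setTI.
Qed.

Lemma measurable_cVP d (T : measurableType d) (R : realType) (n : nat)
    (f : T -> 'cV[R]_n) :
  (forall i, measurable_fun [set: T] (fun t => f t i 0 : measurableTypeR R)) ->
  measurable_fun [set: T] f.
Proof.
move=> mf.
have h : g_sigma_preimage (fun (i : 'I_n) (t : T) => f t i 0 : measurableTypeR R)
    `<=` measurable.
  apply: smallest_sub; first exact: sigma_algebra_measurable.
  case: n f mf => [|n] f mf; first by rewrite big_ord0.
  rewrite -bigcup_mkord_ord; apply: bigcup_sub => i Ii.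
  by move=> A [B mB <-]; exact: mf.
move=> _ A mA; apply: h.
have -> : (fun (i : 'I_n) (t : T) => f t i 0 : measurableTypeR R) =
  (fun i => (fun x : 'cV[R]_n => x i 0 : measurableTypeR R) \o f) by [].
by rewrite g_sigma_preimage_comp; exists A.
Qed.

Definition cV_cons (R : realType) (n : nat)
    (x : measurableTypeR R * 'cV[R]_n) : 'cV[R]_n.+1 :=
  \col_i oapp (fun j => x.2 j 0) x.1 (unlift ord0 i).

Definition cV_uncons (R : realType) (n : nat)
    (v : 'cV[R]_n.+1) : measurableTypeR R * 'cV[R]_n :=
  (v ord0 0, \col_j v (lift ord0 j) 0).

Lemma cV_consK (R : realType) (n : nat) : cancel (@cV_cons R n) (@cV_uncons R n).
Proof.
move=> [x v]; congr pair; first by rewrite mxE unlift_none.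
by apply/colP => j; rewrite !mxE liftK.
Qed.

Lemma cV_unconsK (R : realType) (n : nat) : cancel (@cV_uncons R n) (@cV_cons R n).
Proof.
move=> v; apply/colP => i; rewrite !mxE.
by case: unliftP => [j ->|->] //=; rewrite mxE.
Qed.

Lemma measurable_cV_cons (R : realType) (n : nat) :
  measurable_fun setT (@cV_cons R n).
Proof.
apply: measurable_cVP => i; case: (unliftP ord0 i) => [j ->|->].
  rewrite (_ : (fun _ => _) = (fun x : 'cV[R]_n => x j 0 : measurableTypeR R) \o snd).
    by apply: measurableT_comp => //; exact: measurable_coord.
  by apply/funext => x; rewrite mxE liftK.
rewrite (_ : (fun _ => _) = fst) //.
by apply/funext => x; rewrite mxE unlift_none.
Qed.

Lemma measurable_cV_uncons (R : realType) (n : nat) :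
  measurable_fun setT (@cV_uncons R n).
Proof.
apply: measurable_fun_pair; first exact: measurable_coord.
apply: measurable_cVP => j.
rewrite (_ : (fun _ => _) =
  (fun x : 'cV[R]_n.+1 => x (lift ord0 j) 0 : measurableTypeR R)).
  exact: measurable_coord.
by apply/funext => x; rewrite mxE.
Qed.

Section lebesgue_cons.
Local Open Scope ereal_scope.
Context (R : realType) (n : nat) (m : {sigma_finite_measure set 'cV[R]_n -> \bar R}).

Definition lebesgue_cons : set 'cV[R]_n.+1 -> \bar R :=
  pushforward (@lebesgue_measure R \x m) (@cV_cons R n).

Let lc0 : lebesgue_cons set0 = 0.
Proof. by rewrite /lebesgue_cons /pushforward preimage_set0 measure0. Qed.

Let lc_ge0 A : 0 <= lebesgue_cons A.
Proof. by rewrite /lebesgue_cons /pushforward; exact: measure_ge0. Qed.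

Let lc_measurable_preimage A : measurable A -> measurable (@cV_cons R n @^-1` A).
Proof. by move=> mA; rewrite -[X in measurable X]setTI; exact: measurable_cV_cons. Qed.

Let lc_sigma_additive : semi_sigma_additive lebesgue_cons.
Proof.
move=> F mF tF mUF; rewrite /lebesgue_cons /pushforward preimage_bigcup.
apply: measure_semi_sigma_additive.
- by move=> k; exact: lc_measurable_preimage.
- apply/trivIsetP => i j _ _ ij; rewrite -preimage_setI.
  by move/trivIsetP : tF => /(_ _ _ _ _ ij) ->//; rewrite preimage_set0.
- by rewrite -preimage_bigcup; exact: lc_measurable_preimage.
Qed.

HB.instance Definition _ := isMeasure.Build _ _ _
  lebesgue_cons lc0 lc_ge0 lc_sigma_additive.

Let lc_sigma_finite : sigma_finite setT lebesgue_cons.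
Proof.
have /sigma_finiteP[F [FT Fnd Foo]] := sigma_finiteT (@lebesgue_measure R).
have /sigma_finiteP[G [GT Gnd Goo]] := sigma_finiteT m.
exists (fun k => @cV_uncons R n @^-1` (F k `*` G k)).
  rewrite -preimage_bigcup; apply/esym; rewrite predeqE => v; split=> // _.
  have [a _ Fa] : (\bigcup_i F i) (cV_uncons v).1 by rewrite -FT.
  have [b _ Gb] : (\bigcup_i G i) (cV_uncons v).2 by rewrite -GT.
  exists (maxn a b) => //; split.
  - by move: Fa; exact/subsetPset/Fnd/leq_maxl.
  - by move: Gb; exact/subsetPset/Gnd/leq_maxr.
move=> k; have [mF Fk] := Foo k; have [mG Gk] := Goo k; split.
  rewrite -[X in measurable X]setTI; apply: measurable_cV_uncons => //.
  exact: measurableX.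
rewrite /lebesgue_cons /pushforward.
rewrite (_ : _ @^-1` _ = F k `*` G k); last first.
  by apply/seteqP; split=> x; rewrite /preimage /mkset cV_consK.
by rewrite product_measure1E// lte_mul_pinfty// ge0_fin_numE.
Qed.

HB.instance Definition _ := @Measure_isSigmaFinite.Build _ _ _
  lebesgue_cons lc_sigma_finite.

End lebesgue_cons.

Fixpoint lebesgue_cV (R : realType) (n : nat) :
    {sigma_finite_measure set 'cV[R]_n -> \bar R} :=
  match n with
  | 0 => dirac (0 : 'cV[R]_0)
  | k.+1 => lebesgue_cons (lebesgue_cV R k)
  end.

Definition enorm (R : realType) (n : nat) (x : 'cV[R]_n) : R :=
  Num.sqrt (\sum_i x i 0 ^+ 2).

Definition psd (R : realType) (n : nat) (S : 'M[R]_n) : Prop :=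
  S^T = S /\ forall x : 'cV[R]_n, 0 <= (x^T *m S *m x) 0 0.

Definition spd (R : realType) (n : nat) (S : 'M[R]_n) : Prop :=
  S^T = S /\ forall x : 'cV[R]_n, x != 0 -> 0 < (x^T *m S *m x) 0 0.

Definition psd_le (R : realType) (n : nat) (A B : 'M[R]_n) : Prop := psd (B - A).

(* S^{1/2}: the symmetric positive definite square root of S, which exists and
   is unique when S is symmetric positive definite (0 is a dummy default). *)
Definition spd_sqrt (R : realType) (n : nat) (S : 'M[R]_n) : 'M[R]_n :=
  xget 0 [set B : 'M[R]_n | spd B /\ B *m B = S].

(* |x|_S = |S^{-1/2} x| *)
Definition wnorm (R : realType) (n : nat) (S : 'M[R]_n) (x : 'cV[R]_n) : R :=
  enorm (invmx (spd_sqrt S) *m x).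

Definition lipschitz_with (R : realType) (m n : nat) (l : R)
    (f : 'cV[R]_m -> 'cV[R]_n) : Prop :=
  forall u v, enorm (f u - f v) <= l * enorm (u - v).

Definition linear_growth (R : realType) (m n : nat) (k : R)
    (f : 'cV[R]_m -> 'cV[R]_n) : Prop :=
  forall u, enorm (f u) <= k * (1 + enorm u).

Definition affine (R : realType) (m n : nat) (f : 'cV[R]_m -> 'cV[R]_n) : Prop :=
  exists (L : {linear 'cV[R]_m -> 'cV[R]_n}) (b : 'cV[R]_n),
    forall u, f u = L u + b.

Definition supnorm (R : realType) (m n : nat) (f : 'cV[R]_m -> 'cV[R]_n) : \bar R :=
  ereal_sup (range (fun u => (enorm (f u))%:E)).

(* mu[f]; measures are handled through their underlying set functions. *)
Definition mean (R : realType) d (T : measurableType d) (mu : set T -> \bar R)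
    (f : T -> R) : R :=
  fine (\int[mu]_x (f x)%:E)%E.

Definition moment (R : realType) (n : nat) (q : nat)
    (mu : set 'cV[R]_n -> \bar R) : R :=
  mean mu (fun x => enorm x ^+ q).

Definition of_density (R : realType) (n : nat) (p : 'cV[R]_n -> R) :
    set 'cV[R]_n -> \bar R :=
  fun A => (\int[lebesgue_cV R n]_(x in A) (p x)%:E)%E.

Definition gauss_cst (R : realType) (n : nat) (S : 'M[R]_n) : R :=
  Num.sqrt ((2 * pi) ^+ n * \det S).

Definition gauss_exp (R : realType) (n : nat) (S : 'M[R]_n) (x : 'cV[R]_n) : R :=
  expR (- (2^-1 * wnorm S x ^+ 2)).

(* N(0, S), for S symmetric positive definite *)
Definition normal0 (R : realType) (n : nat) (S : 'M[R]_n) :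
    set 'cV[R]_n -> \bar R :=
  of_density (fun x => (gauss_cst S)^-1 * gauss_exp S x).

(* Gaussian measures, possibly degenerate: the laws of m + A Z with Z standard
   normal. *)
Definition is_gaussian (R : realType) (n : nat)
    (mu : set 'cV[R]_n -> \bar R) : Prop :=
  exists (m : 'cV[R]_n) (A : 'M[R]_n), forall U, measurable U ->
    mu U = pushforward (normal0 1%:M) (fun z => m + A *m z) U.

(* The filter operators: opP maps a measure to a density, opQ a density to a
   joint density, and opB conditions a joint density on y = yobs. *)
Definition opP (R : realType) (du : nat) (Psi : 'cV[R]_du -> 'cV[R]_du)
    (Sigma : 'M[R]_du) (mu : set 'cV[R]_du -> \bar R) : 'cV[R]_du -> R :=
  fun u => (gauss_cst Sigma)^-1 * mean mu (fun v => gauss_exp Sigma (u - Psi v)).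

Definition opQ (R : realType) (du dy : nat) (h : 'cV[R]_du -> 'cV[R]_dy)
    (Gamma : 'M[R]_dy) (p : 'cV[R]_du -> R) : 'cV[R]_du * 'cV[R]_dy -> R :=
  fun z => (gauss_cst Gamma)^-1 * gauss_exp Gamma (z.2 - h z.1) * p z.1.

Definition opB (R : realType) (du dy : nat) (yobs : 'cV[R]_dy)
    (rho : 'cV[R]_du * 'cV[R]_dy -> R) : 'cV[R]_du -> R :=
  fun u => rho (u, yobs) / mean (lebesgue_cV R du) (fun U => rho (U, yobs)).

Fixpoint true_filter (R : realType) (du dy : nat)
    (Psi : 'cV[R]_du -> 'cV[R]_du) (h : 'cV[R]_du -> 'cV[R]_dy)
    (Sigma : 'M[R]_du) (Gamma : 'M[R]_dy) (y : nat -> 'cV[R]_dy)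
    (mu0 : set 'cV[R]_du -> \bar R) (j : nat) : set 'cV[R]_du -> \bar R :=
  match j with
  | 0 => mu0
  | k.+1 => of_density (opB (y k.+1) (opQ h Gamma (opP Psi Sigma
              (true_filter Psi h Sigma Gamma y mu0 k))))
  end.

Definition empirical (R : realType) d (T : measurableType d) (N : nat)
    (x : 'I_N -> T) : set T -> \bar R :=
  fun A => ((N%:R^-1)%:E * \sum_(i < N) dirac (x i) A)%E.

Definition covmx (R : realType) d (T : measurableType d) (m n : nat)
    (mu : set T -> \bar R) (f : T -> 'cV[R]_m) (g : T -> 'cV[R]_n) : 'M[R]_(m, n) :=
  \matrix_(i, j) mean mu (fun x =>
    (f x i 0 - mean mu (fun x' => f x' i 0)) *
    (g x j 0 - mean mu (fun x' => g x' j 0))).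

(* C^{uh} and C^{hh} only depend on the first marginal of rho. *)
Definition cov_uh (R : realType) (du dy : nat) (h : 'cV[R]_du -> 'cV[R]_dy)
    (rho : set ('cV[R]_du * 'cV[R]_dy) -> \bar R) : 'M[R]_(du, dy) :=
  covmx (pushforward rho fst) id h.

Definition cov_hh (R : realType) (du dy : nat) (h : 'cV[R]_du -> 'cV[R]_dy)
    (rho : set ('cV[R]_du * 'cV[R]_dy) -> \bar R) : 'M[R]_dy :=
  covmx (pushforward rho fst) h h.

(* xi is the family xi_j and eta the family eta_{j+1}, indexed by the particle. *)
Definition enkf_step (R : realType) (du dy N : nat)
    (Psi : 'cV[R]_du -> 'cV[R]_du) (h : 'cV[R]_du -> 'cV[R]_dy)
    (Gamma : 'M[R]_dy) (yobs : 'cV[R]_dy) (xi : 'I_N -> 'cV[R]_du)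
    (eta : 'I_N -> 'cV[R]_dy) (u : 'I_N -> 'cV[R]_du) : 'I_N -> 'cV[R]_du :=
  let uhat i := Psi (u i) + xi i in
  let yhat i := h (uhat i) + eta i in
  let rho := empirical R (fun i => (uhat i, yhat i)) in
  fun i => uhat i +
    cov_uh h rho *m invmx (cov_hh h rho + Gamma) *m (yobs - yhat i).

Fixpoint enkf (R : realType) (du dy N : nat)
    (Psi : 'cV[R]_du -> 'cV[R]_du) (h : 'cV[R]_du -> 'cV[R]_dy)
    (Gamma : 'M[R]_dy) (y : nat -> 'cV[R]_dy) (u0 : 'I_N -> 'cV[R]_du)
    (xi : nat -> 'I_N -> 'cV[R]_du) (eta : nat -> 'I_N -> 'cV[R]_dy)
    (j : nat) : 'I_N -> 'cV[R]_du :=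
  match j with
  | 0 => u0
  | k.+1 => enkf_step Psi h Gamma (y k.+1) (xi k) (eta k.+1)
              (enkf Psi h Gamma y u0 xi eta k)
  end.

Definition mutually_independent (R : realType) d (Omega : measurableType d)
    (P : probability Omega R) (I : finType) dE (E : I -> measurableType dE)
    (X : forall i, Omega -> E i) : Prop :=
  forall (K : {set I}) (B : forall i, set (E i)), (forall i, measurable (B i)) ->
    P (\bigcap_(i in [set i | i \in K]) (X i @^-1` B i)) =
    (\prod_(i in K) P (X i @^-1` B i))%E.

(* The sources of randomness: u_0^(i), xi_j^(i) and eta_{j+1}^(i), for i < N and
   j < J. *)
Definition source (N J : nat) : finType := ('I_N + 'I_J * 'I_N + 'I_J * 'I_N)%type.

Definition source_dim (du dy N J : nat) (s : source N J) : nat :=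
  match s with inl _ => du | inr _ => dy end.

Definition source_var (R : realType) (Omega : Type) (du dy N J : nat)
    (u0 : 'I_N -> Omega -> 'cV[R]_du) (xi : nat -> 'I_N -> Omega -> 'cV[R]_du)
    (eta : nat -> 'I_N -> Omega -> 'cV[R]_dy) (s : source N J) :
    Omega -> 'cV[R]_(source_dim du dy s) :=
  match s with
  | inl (inl i) => u0 i
  | inl (inr (j, i)) => xi j i
  | inr (j, i) => eta j.+1 i
  end.

Record enkf_inputs (R : realType) d (Omega : measurableType d)
    (P : probability Omega R) (du dy N J : nat)
    (mu0 : set 'cV[R]_du -> \bar R) (Sigma : 'M[R]_du) (Gamma : 'M[R]_dy)
    (u0 : 'I_N -> {RV P >-> 'cV[R]_du})
    (xi : nat -> 'I_N -> {RV P >-> 'cV[R]_du})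
    (eta : nat -> 'I_N -> {RV P >-> 'cV[R]_dy}) : Prop := EnkfInputs {
  law_u0 : forall i A, measurable A -> distribution P (u0 i) A = mu0 A ;
  law_xi : forall j i A, (j < J)%N -> measurable A ->
    distribution P (xi j i) A = normal0 Sigma A ;
  law_eta : forall j i A, (j < J)%N -> measurable A ->
    distribution P (eta j.+1 i) A = normal0 Gamma A ;
  inputs_indep : mutually_independent P
    (source_var (J := J) (fun i => u0 i : Omega -> _)
      (fun j i => xi j i : Omega -> _) (fun j i => eta j i : Omega -> _)) }.

(* Main.v *)
(** The particles are coupled to mean-field particles that use the same initial
    samples and noises, but the affine model Psi0 and the exact Kalman gain.
    By Gaussian conjugacy the law of a mean-field particle is the true filter
    of Psi0. Divided by 1 / sqrt N + eps, the distance between a particle and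
    its mean-field copy has all its moments bounded: the innovation covariance
    is bounded below by that of the noise, so the gain is a Lipschitz function
    of the empirical covariance, and the covariance of the independent
    mean-field particles fluctuates at the Monte Carlo rate. It remains to
    compare the true filters of Psi and Psi0: shifting the Gaussian kernel by
    at most eps costs O(eps) in a total variation norm weighted by
    1 + |u|^2, and conditioning preserves this, the evidence being bounded
    below by Jensen's inequality. *)

Require Import Defs.
From HB Require Import structures.
From mathcomp Require Import all_boot all_order all_algebra.
From mathcomp Require Import all_classical all_reals all_analysis measurable_realfun.
From mathcomp Require Import ring lra.

Set Implicit Arguments.
Unset Strict Implicit.
Unset Printing Implicit Defensive.

Import Order.TTheory GRing.Theory Num.Theory.
Import numFieldNormedType.Exports.

Local Open Scope classical_set_scope.
Local Open Scope ring_scope.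

(** * Matrix norms and quadratic forms *)

Section nrm1.
Context (R : realType).
Implicit Types m n p : nat.

(** The constant must be uniform in the ensemble size, the probability space, the data, [Psi], [h]
    and [phi]. Rather than tracking explicit constants, the proof bundles all of these in a type
    [setting], and each estimate provides one sequence of moment bounds for the whole family. Being
    tame, or tame after division by [1 / sqrt N + eps], is stable under sums, averages and products
    with tame factors, so the nonlinear gain costs no bookkeeping of exponents. This uses all
    moments at once; a Gaussian initial law has them, its second moment already bounding its mean
    and its covariance factor. No Gaussian integral is evaluated. Normalising constants stay
    abstract and are fixed by total mass one; Gaussian identities come from completing a square and
    translating Lebesgue measure. That the noise densities are probabilities is itself deduced from
    the samples supplied, whence the case distinction before the constant is chosen. The mean-field
    law is Gaussian for [Psi0] only, so the perturbed model is met twice: in the coupling, and when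
    the two true filters are compared. *)

Definition nrm1 m n (A : 'M[R]_(m, n)) : R := \sum_i \sum_j `|A i j|.

Lemma nrm1_ge0 m n (A : 'M[R]_(m, n)) : 0 <= nrm1 A.
Proof. by apply: sumr_ge0 => i _; apply: sumr_ge0. Qed.

Lemma ler_nrm1 m n (A : 'M[R]_(m, n)) i j : `|A i j| <= nrm1 A.
Proof.
rewrite /nrm1 (bigD1 i)//= (bigD1 j)//= -addrA lerDl addr_ge0//.
  exact: sumr_ge0.
by apply: sumr_ge0 => k _; apply: sumr_ge0.
Qed.

Lemma nrm1D m n (A B : 'M[R]_(m, n)) : nrm1 (A + B) <= nrm1 A + nrm1 B.
Proof.
rewrite /nrm1 -big_split/=; apply: ler_sum => i _.
rewrite -big_split/=; apply: ler_sum => j _.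
by rewrite mxE ler_normD.
Qed.

Lemma nrm1N m n (A : 'M[R]_(m, n)) : nrm1 (- A) = nrm1 A.
Proof. by apply: eq_bigr => i _; apply: eq_bigr => j _; rewrite mxE normrN. Qed.

Lemma nrm1B m n (A B : 'M[R]_(m, n)) : nrm1 (A - B) <= nrm1 A + nrm1 B.
Proof. by rewrite -(nrm1N B); exact: nrm1D. Qed.

Lemma nrm1_tr m n (A : 'M[R]_(m, n)) : nrm1 A^T = nrm1 A.
Proof.
rewrite /nrm1 exchange_big; apply: eq_bigr => i _.
by apply: eq_bigr => j _; rewrite mxE.
Qed.

Lemma nrm1_cV n (x : 'cV[R]_n) : nrm1 x = \sum_i `|x i 0|.
Proof. by apply: eq_bigr => i _; rewrite big_ord1. Qed.

(** Submultiplicativity reduces products of random matrices to products of scalar random variables,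
    [ler_nrm1] giving the way back to entries. *)
Lemma nrm1M m n p (A : 'M[R]_(m, n)) (B : 'M[R]_(n, p)) :
  nrm1 (A *m B) <= nrm1 A * nrm1 B.
Proof.
rewrite /nrm1 mulr_suml; apply: ler_sum => i _.
apply: (@le_trans _ _ (\sum_j \sum_k `|A i k| * `|B k j|)).
  apply: ler_sum => j _; rewrite mxE.
  apply: le_trans (ler_norm_sum _ _ _) _.
  by apply: ler_sum => k _; rewrite normrM.
rewrite exchange_big/= mulr_suml; apply: ler_sum => k _.
rewrite -mulr_sumr ler_wpM2l// (bigD1 k)//= lerDl.
by apply: sumr_ge0 => l _; apply: sumr_ge0.
Qed.

Lemma enorm_ge0 n (x : 'cV[R]_n) : 0 <= enorm x.
Proof. exact: sqrtr_ge0. Qed.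

Lemma sqr_enorm n (x : 'cV[R]_n) : enorm x ^+ 2 = \sum_i x i 0 ^+ 2.
Proof. by rewrite sqr_sqrtr// sumr_ge0// => i _; exact: sqr_ge0. Qed.

Lemma ler_enorm n (x : 'cV[R]_n) i : `|x i 0| <= enorm x.
Proof.
rewrite -sqrtr_sqr ler_sqrt; last by apply: sumr_ge0 => k _; exact: sqr_ge0.
by rewrite (bigD1 i)//= lerDl sumr_ge0// => k _; exact: sqr_ge0.
Qed.

Lemma enorm_le_nrm1 n (x : 'cV[R]_n) : enorm x <= nrm1 x.
Proof.
rewrite -(@ler_pXn2r _ 2)// ?nnegrE ?enorm_ge0 ?nrm1_ge0//.
rewrite sqr_enorm [leRHS]expr2 {1}nrm1_cV mulr_suml; apply: ler_sum => i _.
by rewrite -real_normK ?num_real// expr2 ler_wpM2l// ler_nrm1.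
Qed.

Lemma nrm1_le_enorm n (x : 'cV[R]_n) : nrm1 x <= n%:R * enorm x.
Proof.
rewrite nrm1_cV; apply: (@le_trans _ _ (\sum_(i < n) enorm x)).
  by apply: ler_sum => i _; exact: ler_enorm.
by rewrite sumr_const card_ord mulr_natl.
Qed.

End nrm1.

Section quadratic_forms.
Context (R : realType).
Implicit Types m n : nat.

Definition qf n (P : 'M[R]_n) (x : 'cV[R]_n) : R := (x^T *m P *m x) 0 0.

Lemma qfE n (P : 'M[R]_n) x : qf P x = \sum_i \sum_j x i 0 * P i j * x j 0.
Proof.
rewrite /qf mxE exchange_big/=; apply: eq_bigr => j _.
by rewrite mxE mulr_suml; apply: eq_bigr => i _; rewrite mxE.
Qed.

Lemma qf_scalar n (a : R) (x : 'cV[R]_n) : qf a%:M x = a * enorm x ^+ 2.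
Proof.
rewrite sqr_enorm /qf mul_mx_scalar -scalemxAl !mxE; congr (_ * _).
by apply: eq_bigr => i _; rewrite mxE expr2.
Qed.

Lemma qfN n (P : 'M[R]_n) (x : 'cV[R]_n) : qf P (- x) = qf P x.
Proof.
rewrite /qf (_ : (- x)^T = - x^T); last by rewrite linearN.
by rewrite !mulNmx mulmxN opprK.
Qed.

Lemma qfZ n (P : 'M[R]_n) a (x : 'cV[R]_n) : qf P (a *: x) = a ^+ 2 * qf P x.
Proof.
rewrite /qf (_ : (a *: x)^T = a *: x^T); last by rewrite linearZ.
by rewrite -!scalemxAl -scalemxAr !mxE expr2 mulrA.
Qed.

Lemma qfDm n (P Q : 'M[R]_n) (x : 'cV[R]_n) : qf (P + Q) x = qf P x + qf Q x.
Proof. by rewrite /qf mulmxDr mulmxDl mxE. Qed.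

Lemma qf_conj m n (P : 'M[R]_m) (A : 'M[R]_(m, n)) (x : 'cV[R]_n) :
  qf (A^T *m P *m A) x = qf P (A *m x).
Proof. by rewrite /qf trmx_mul !mulmxA. Qed.

Lemma qfD n (P : 'M[R]_n) (x y : 'cV[R]_n) : P^T = P ->
  qf P (x + y) = qf P x + 2 * (x^T *m P *m y) 0 0 + qf P y.
Proof.
move=> sP; rewrite /qf (_ : (x + y)^T = x^T + y^T); last by rewrite linearD.
rewrite !mulmxDr !mulmxDl.
have E : (y^T *m P *m x) 0 0 = (x^T *m P *m y) 0 0.
  transitivity ((y^T *m P *m x)^T 0 0); first by rewrite [RHS]mxE.
  by rewrite !trmx_mul sP trmxK mulmxA.
rewrite [LHS]mxE [X in X + _]mxE [X in _ + X]mxE E; ring.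
Qed.

Lemma spd_unit n (P : 'M[R]_n) : spd P -> P \in unitmx.
Proof.
move=> [sP pP]; rewrite -row_free_unit -kermx_eq0.
apply/eqP/row_matrixP => i; rewrite row0.
have : row i (kermx P) *m P = 0.
  by rewrite -row_mul mulmx_ker row0.
set v := row i _ => vP; have [//|v0] := eqVneq v 0.
have /pP : v^T != 0 by apply: contra v0 => /eqP v0; rewrite -(trmxK v) v0 trmx0.
by rewrite trmxK vP mul0mx mxE ltxx.
Qed.

Lemma spd_psd n (P : 'M[R]_n) : spd P -> psd P.
Proof.
move=> [sP pP]; split => // x; have [->|x0] := eqVneq x 0.
  by rewrite mulmx0 mxE.
by rewrite ltW// pP.
Qed.

Lemma spd1 n : spd (1%:M : 'M[R]_n).
Proof.
split; first exact: trmx1.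
move=> x x0; rewrite -/(qf _ _) qf_scalar mul1r exprn_gt0//.
rewrite lt_neqAle enorm_ge0 andbT eq_sym; apply: contra x0 => /eqP ex0.
apply/eqP/colP => i; rewrite mxE; apply/eqP; rewrite -normr_le0 -ex0.
exact: ler_enorm.
Qed.

Lemma spdD_psd n (P Q : 'M[R]_n) : spd P -> psd Q -> spd (P + Q).
Proof.
move=> [sP pP] [sQ pQ]; split; first by rewrite linearD/= sP sQ.
by move=> x x0; rewrite mulmxDr mulmxDl mxE ltr_pwDl// pP.
Qed.

Lemma psd_conj m n (P : 'M[R]_m) (A : 'M[R]_(m, n)) :
  psd P -> psd (A^T *m P *m A).
Proof.
move=> [sP pP]; split; first by rewrite !trmx_mul trmxK sP mulmxA.
by move=> x; rewrite -/(qf _ _) qf_conj; exact: pP.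
Qed.

Lemma psd_conjT m n (P : 'M[R]_m) (A : 'M[R]_(n, m)) :
  psd P -> psd (A *m P *m A^T).
Proof. by move=> pP; have := psd_conj A^T pP; rewrite trmxK. Qed.

Lemma trmx_invmx n (P : 'M[R]_n) : P^T = P -> (invmx P)^T = invmx P.
Proof. by move=> sP; rewrite trmx_inv sP. Qed.

Lemma spd_inv n (P : 'M[R]_n) : spd P -> spd (invmx P).
Proof.
move=> sP; have uP := spd_unit sP; case: (sP) => tP pP.
split; first by rewrite trmx_inv tP.
move=> x x0; have -> : invmx P = (invmx P)^T *m P *m invmx P.
  by rewrite trmx_inv tP mulVmx// mul1mx.
rewrite -/(qf _ _) qf_conj; apply: pP; apply: contra x0 => /eqP x0.
by rewrite -[x]mul1mx -(mulmxV uP) -mulmxA x0 mulmx0.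
Qed.

(* Completing the square; [K] is the Kalman gain. *)
Lemma complete_square m n (P : 'M[R]_n) (G : 'M[R]_m) (H : 'M[R]_(m, n)) :
  spd P -> spd G ->
  let M := P + H^T *m invmx G *m H in
  let S := G + H *m invmx P *m H^T in
  let K := invmx P *m H^T *m invmx S in
  forall (x : 'cV[R]_n) (z : 'cV[R]_m),
  qf P x + qf (invmx G) (z - H *m x) =
  qf M (x - K *m z) + qf (invmx S) z.
Proof.
move=> sP sG M S K x z.
have uP := spd_unit sP; have uG := spd_unit sG.
have tP := sP.1; have tG := sG.1.
have sS : spd S by apply: spdD_psd => //; apply: psd_conjT; exact/spd_psd/spd_inv.
have uS := spd_unit sS.
have tM : M^T = M.
  by rewrite /M linearD/= !trmx_mul trmxK trmx_inv tG tP mulmxA.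
(* Multiplied by [S] on the right, both sides equal [H^T + H^T G^-1 H P^-1 H^T]; the square is thus
   completed without inverting [M]. *)
have MK : M *m K = H^T *m invmx G.
  rewrite /K !mulmxA -[RHS]mulmx1 -(mulmxV uS) !mulmxA; congr (_ *m _).
  rewrite /M /S !mulmxDl !mulmxDr !mulmxA mulmxV// mul1mx.
  by rewrite -(mulmxA H^T _ G) mulVmx// mulmx1.
have KM : K^T *m M = invmx G *m H.
  by rewrite -[LHS]trmxK trmx_mul trmxK tM MK trmx_mul trmxK trmx_inv tG.
have KMK : K^T *m M *m K = invmx G - invmx S.
  rewrite KM /K !mulmxA.
  have -> : invmx G *m H *m invmx P *m H^T = invmx G *m S - 1%:M.
    by rewrite /S mulmxDr mulVmx// !mulmxA addrC addKr.
  by rewrite mulmxBl mul1mx -mulmxA mulmxV// mulmx1.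
clearbody K S; rewrite /qf.
have bil n1 n2 (A : 'M[R]_(n1, n2)) a b c : (a - b)^T *m A *m c = a^T *m A *m c - b^T *m A *m c.
  by move=> *; rewrite linearB/= !mulmxBl.
rewrite !bil !mulmxBr !trmx_mul !mulmxA.
have -> : x^T *m M *m K *m z = x^T *m H^T *m invmx G *m z.
  by rewrite -(mulmxA _ M) MK !mulmxA.
have -> : z^T *m K^T *m M *m x = z^T *m invmx G *m H *m x.
  by rewrite -(mulmxA _ K^T) KM !mulmxA.
have -> : z^T *m K^T *m M *m K *m z = z^T *m invmx G *m z - z^T *m invmx S *m z.
  by rewrite -(mulmxA _ K^T M) -(mulmxA _ (K^T *m M)) KMK mulmxBr mulmxBl.
rewrite /M mulmxDr mulmxDl !mulmxA !mxE; ring.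
Qed.

(** The column [z = S^-1 e_j] satisfies [g |z|^2 <= z^T S z = z_j <= |z|], so [|z| <= 1 / g]; there
    are [n^2] entries. *)
Lemma inv_entry_bound n (S : 'M[R]_n) (g : R) : 0 < g -> S \in unitmx ->
  (forall x : 'cV[R]_n, g * enorm x ^+ 2 <= qf S x) ->
  nrm1 (invmx S) <= n%:R ^+ 2 / g.
Proof.
move=> g0 uS gS.
have key i j : `|invmx S i j| <= g^-1.
  pose w : 'cV[R]_n := delta_mx j 0; pose z := invmx S *m w.
  have zE k : z k 0 = invmx S k j.
    by rewrite /z /w -colE mxE.
  have : g * enorm z ^+ 2 <= z j 0.
    apply: le_trans (gS z) _; rewrite /qf /z.
    rewrite -[leLHS]/((z^T *m S *m (invmx S *m w)) 0 0).
    rewrite -mulmxA (mulmxA S) mulmxV// mul1mx /w -colE !mxE lexx//.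
  move=> h; have zj : z j 0 <= enorm z by apply: le_trans (ler_norm _) (ler_enorm _ _).
  have e0 := enorm_ge0 z.
  rewrite -zE; apply: le_trans (ler_enorm z i) _.
  have [->|en0] := eqVneq (enorm z) 0; first by rewrite invr_ge0 ltW.
  have ep : 0 < enorm z by rewrite lt_neqAle eq_sym en0.
  rewrite -(ler_pM2l g0) divff ?gt_eqF// -(ler_pM2r ep) mul1r -mulrA -expr2.
  exact: le_trans h zj.
rewrite /nrm1; apply: (@le_trans _ _ (\sum_(i < n) \sum_(j < n) g^-1)).
  by apply: ler_sum => i _; apply: ler_sum => j _.
rewrite !sumr_const !card_ord -mulrnA -[leLHS]mulr_natl natrM expr2.
by rewrite lexx.
Qed.

End quadratic_forms.

(** * Integration over column vectors *)

Section integral_setfun.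
Local Open Scope ereal_scope.
Context d (T : measurableType d) (R : realType).
Implicit Types (mu : set T -> \bar R) (f g : T -> \bar R).

(* Unlike ge0_le_integral, no measurability is required. *)
Lemma le_integral_ge0 mu f g : (forall x, 0 <= f x) -> (forall x, f x <= g x) ->
  \int[mu]_x f x <= \int[mu]_x g x.
Proof.
move=> f0 fg; have g0 x : 0 <= g x by exact: le_trans (fg x).
rewrite /integral /= !patch_setT.
have neg0 (k : T -> \bar R) : (forall x, 0 <= k x) -> k^\- = cst 0.
  by move=> k0; apply/funext => x; rewrite funenegE; apply: max_r; rewrite leeNl oppe0.
rewrite (neg0 f f0) (neg0 g g0); apply: leeB => //; apply: le_ereal_sup => _ /= [h hf <-].
exists h => // x; apply: le_trans (hf x) _.
by rewrite !funeposE (max_l (f0 x)) (max_l (g0 x)).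
Qed.

Import HBNNSimple.

(** An integral is a supremum over simple functions, which see a measure on measurable sets only.
    Raw set functions such as those of [true_filter] and [empirical] can therefore be exchanged for
    genuine measures. *)
Lemma eq_integral_measurable mu1 mu2 f :
  (forall A, measurable A -> mu1 A = mu2 A) ->
  \int[mu1]_x f x = \int[mu2]_x f x.
Proof.
move=> e; have es (h : {nnsfun T >-> R}) : sintegral mu1 h = sintegral mu2 h.
  by rewrite !sintegralET; apply: eq_fsbigr => x _; rewrite e.
have en g : ereal_sup [set sintegral mu1 h | h in
      [set h : {nnsfun T >-> R} | forall x, (h x)%:E <= g x]] =
    ereal_sup [set sintegral mu2 h | h in
      [set h : {nnsfun T >-> R} | forall x, (h x)%:E <= g x]].
  by congr ereal_sup; apply/seteqP; split => _ [h hg <-]; exists h.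
by rewrite /integral /= !en.
Qed.

End integral_setfun.

Section density.
Local Open Scope ereal_scope.
Context d (T : measurableType d) (R : realType).
Variables (mu : {measure set T -> \bar R}) (p : T -> R).

(** The proofs are arguments so that the measure structure can be attached to [dens p0 mp]. *)
Definition dens (p0 : forall x, (0 <= p x)%R) (mp : measurable_fun setT p) :
  set T -> \bar R := fun A => \int[mu]_(x in A) (p x)%:E.

Hypotheses (p0 : forall x, (0 <= p x)%R) (mp : measurable_fun setT p).

Let dens0 : dens p0 mp set0 = 0.
Proof. by rewrite /dens integral_set0. Qed.

Let dens_ge0 A : 0 <= dens p0 mp A.
Proof. by apply: integral_ge0 => x _; rewrite lee_fin. Qed.

Let dens_sigma_additive : semi_sigma_additive (dens p0 mp).
Proof.
apply: semi_sigma_additive_nng_induced; first exact/measurable_EFinP.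
by move=> x; rewrite lee_fin.
Qed.

HB.instance Definition _ := isMeasure.Build _ _ _ (dens p0 mp)
  dens0 dens_ge0 dens_sigma_additive.

Import HBNNSimple.

(** Both sides are monotone limits along [nnsfun_approx]; for a simple function the identity is the
    definition of the density on each level set. *)
Lemma ge0_integral_dens (f : T -> \bar R) : measurable_fun setT f ->
  (forall x, 0 <= f x) ->
  \int[fun A => \int[mu]_(x in A) (p x)%:E]_x f x = \int[mu]_x (f x * (p x)%:E).
Proof.
move=> mf f0; rewrite -[X in integral X]/(dens p0 mp).
pose h := nnsfun_approx measurableT mf.
transitivity (limn (fun n => \int[dens p0 mp]_x (h n x)%:E)).
  rewrite -monotone_convergence//.
  - apply: eq_integral => y _; apply/esym/cvg_lim => //.
    by apply: cvg_nnsfun_approx => // *.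
  - by move=> n; exact/measurable_EFinP/measurable_funP.
  - by move=> n y _; rewrite lee_fin.
  - by move=> y _ m n mn; rewrite lee_fin; exact/lefP/nd_nnsfun_approx.
transitivity (limn (fun n => \int[mu]_x ((h n x)%:E * (p x)%:E))); last first.
  rewrite -monotone_convergence//; last 3 first.
  - by move=> n; apply: emeasurable_funM; exact/measurable_EFinP.
  - by move=> n x _; rewrite mule_ge0// lee_fin.
  - move=> x _ m n mn; rewrite lee_wpmul2r ?lee_fin//.
    exact/lefP/nd_nnsfun_approx.
  apply: eq_integral => x _; apply/cvg_lim => //.
  apply: cvgeZr; first by [].
  exact: cvg_nnsfun_approx.
congr (limn _); apply/funext => n.
transitivity (\int[dens p0 mp]_x
    (\sum_(y \in range (h n)) (y * \1_(h n @^-1` [set y]) x)%:E)).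
  by apply: eq_integral => t tE; rewrite /= fimfunE -fsumEFin.
rewrite ge0_integral_fsum//; last 2 first.
- by move=> y; exact/measurable_EFinP/measurable_funM.
- by move=> y x _; rewrite nnfun_muleindic_ge0.
transitivity (\int[mu]_x (\sum_(y \in range (h n))
   ((y * \1_(h n @^-1` [set y]) x)%:E * (p x)%:E))); last first.
  apply: eq_integral => x _; rewrite -ge0_mule_fsuml => [|y].
    by rewrite fsumEFin// -fimfunE.
  exact: nnfun_muleindic_ge0.
rewrite ge0_integral_fsum//; last 2 first.
- move=> y; apply: emeasurable_funM; last exact/measurable_EFinP.
  exact/measurable_EFinP/measurable_funM.
- by move=> y x _; apply: mule_ge0; [exact: nnfun_muleindic_ge0|rewrite lee_fin].
apply: eq_fsbigr => y /[!inE] -[x _ <-].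
rewrite integralZl_indic_nnsfun//= integral_indic// setIT.
under eq_integral do rewrite EFinM -muleA.
rewrite ge0_integralZl//; last 3 first.
- apply: emeasurable_funM; last exact/measurable_EFinP.
  exact/measurable_EFinP.
- by move=> z _; rewrite mule_ge0 ?lee_fin.
- by rewrite lee_fin.
congr (_ * _); rewrite -[LHS]/(\int[mu]_(z in h n @^-1` [set h n x]) (p z)%:E) integral_mkcond; apply: eq_integral => z _.
rewrite patchE indicE; case: ifPn => zy; rewrite ?mul1e ?mul0e//.
Qed.

End density.

(** * Measurability for the coordinate sigma-algebra *)

Section cV_measurability.
Context (R : realType).
Implicit Types n m : nat.

Lemma measurable_cV_coord d (T : measurableType d) n (f : T -> 'cV[R]_n) i :
  measurable_fun setT f -> measurable_fun setT (fun t => f t i 0).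
Proof.
move=> mf.
exact: (measurableT_comp (@measurable_coord R n i) mf).
Qed.

Lemma measurable_cV_add d (T : measurableType d) n (f g : T -> 'cV[R]_n) :
  measurable_fun setT f -> measurable_fun setT g ->
  measurable_fun setT (fun t => f t + g t).
Proof.
move=> mf mg; apply: measurable_cVP => i.
under eq_fun do rewrite mxE.
by apply: measurable_funD; exact: measurable_cV_coord.
Qed.

Lemma measurable_cV_opp d (T : measurableType d) n (f : T -> 'cV[R]_n) :
  measurable_fun setT f -> measurable_fun setT (fun t => - f t).
Proof.
move=> mf; apply: measurable_cVP => i.
under eq_fun do rewrite mxE.
by apply: measurableT_comp => //; exact: measurable_cV_coord.
Qed.

Lemma measurable_cV_sub d (T : measurableType d) n (f g : T -> 'cV[R]_n) :
  measurable_fun setT f -> measurable_fun setT g ->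
  measurable_fun setT (fun t => f t - g t).
Proof. by move=> mf mg; apply: measurable_cV_add => //; exact: measurable_cV_opp. Qed.

Lemma measurable_cV_mulmx d (T : measurableType d) n m (A : 'M[R]_(m, n))
  (f : T -> 'cV[R]_n) :
  measurable_fun setT f -> measurable_fun setT (fun t => A *m f t).
Proof.
move=> mf; apply: measurable_cVP => i.
under eq_fun do rewrite mxE.
by apply: measurable_sum => j; apply: measurable_funM => //; exact: measurable_cV_coord.
Qed.

Lemma measurable_enorm d (T : measurableType d) n (f : T -> 'cV[R]_n) :
  measurable_fun setT f -> measurable_fun setT (fun t => enorm (f t)).
Proof.
move=> mf; apply: (measurableT_comp (f := @Num.sqrt R)).
  apply: continuous_measurable_fun; exact: sqrt_continuous.
by apply: measurable_sum => j; apply: measurable_funX; exact: measurable_cV_coord.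
Qed.

Lemma measurable_nrm1 d (T : measurableType d) n (f : T -> 'cV[R]_n) :
  measurable_fun setT f -> measurable_fun setT (fun t => nrm1 (f t)).
Proof.
move=> mf; apply: measurable_sum => i; apply: measurable_sum => j.
by apply: measurableT_comp => //; rewrite (ord1 j); exact: measurable_cV_coord.
Qed.

Lemma measurable_qf d (T : measurableType d) n (P : 'M[R]_n) (f : T -> 'cV[R]_n) :
  measurable_fun setT f -> measurable_fun setT (fun t => qf P (f t)).
Proof.
move=> mf; under eq_fun do rewrite qfE.
apply: measurable_sum => i; apply: measurable_sum => j.
apply: measurable_funM; last exact: measurable_cV_coord.
by apply: measurable_funM => //; exact: measurable_cV_coord.
Qed.

Definition grid n (k : nat) (x : 'cV[R]_n) : 'cV[int]_n :=
  \col_i Num.floor (k.+1%:R * x i 0).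

Definition of_grid n (k : nat) (z : 'cV[int]_n) : 'cV[R]_n :=
  \col_i ((z i 0)%:~R / k.+1%:R).

Lemma grid_close n k (x : 'cV[R]_n) :
  nrm1 (of_grid k (grid k x) - x) <= n%:R / k.+1%:R.
Proof.
rewrite nrm1_cV; apply: (@le_trans _ _ (\sum_(i < n) k.+1%:R^-1)); last first.
  by rewrite sumr_const card_ord mulr_natl.
apply: ler_sum => i _; rewrite !mxE.
have k0 : 0 < k.+1%:R :> R by rewrite ltr0n.
have /andP[f1 f2] := floor_itv (k.+1%:R * x i 0).
set z := (Num.floor _)%:~R in f1 *.
have -> : z / k.+1%:R - x i 0 = - ((k.+1%:R * x i 0 - z) / k.+1%:R).
  by rewrite mulrBl opprB [_ * x i 0]mulrC mulfK ?gt_eqF.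
rewrite normrN ger0_norm; last by apply: divr_ge0; rewrite ?ler0n// subr_ge0.
rewrite -[leRHS]mul1r ler_wpM2r ?invr_ge0 ?ltW//.
by rewrite ltrBlDl; move: f2; rewrite intrD.
Qed.

Lemma measurable_grid n k (U : set 'cV[int]_n) :
  measurable [set x : 'cV[R]_n | U (grid k x)].
Proof.
have -> : [set x : 'cV[R]_n | U (grid k x)] =
    \bigcup_(z in U) [set x | grid k x = z].
  by apply/seteqP; split => [x Ux|x [z Uz /= ->]]//; exists (grid k x).
rewrite bigcup_mkcond; apply: countable_bigcupT_measurable => [|z].
  exact: countableP.
case: ifPn => // _.
have -> : [set x : 'cV[R]_n | grid k x = z] =
    \bigcap_(i in [set: 'I_n]) [set x | Num.floor (k.+1%:R * x i 0) = z i 0].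
  apply/seteqP; split => [x <- i _|x h].
    by rewrite /= mxE.
  by apply/colP => i; rewrite mxE; exact: h.
apply: fin_bigcap_measurable => // i _.
rewrite [X in measurable X](_ : _ =
    (fun x : 'cV[R]_n => k.+1%:R * x i 0) @^-1`
      `[(z i 0)%:~R, (z i 0 + 1)%:~R[%classic); last first.
  apply/seteqP; split => x /=; rewrite in_itv/=.
    by move=> <-; exact: floor_itv.
  exact: floor_def.
rewrite -[X in measurable X]setTI.
apply: (_ : measurable_fun setT (fun x : 'cV[R]_n => k.+1%:R * x i 0)) => //.
by apply: measurable_funM => //; exact: measurable_cV_coord.
Qed.

(** Rounding to the grid takes countably many values on measurable cells, so [f] is a pointwise
    limit of measurable functions. Continuity thereby gives measurability with no comparison between
    open sets and the coordinate sigma-algebra. *)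
Lemma measurable_fun_grid n (f : 'cV[R]_n -> R) :
  (forall x, f (of_grid k (grid k x)) @[k --> \oo] --> f x) ->
  measurable_fun setT f.
Proof.
move=> cf; apply: (measurable_fun_cvg (h := fun k x => f (of_grid k (grid k x)))).
  move=> k _ Y mY; rewrite setTI.
  exact: (@measurable_grid n k [set z | Y (f (of_grid k z))]).
by move=> x _; exact: cf.
Qed.

Lemma measurable_local_lipschitz n (f : 'cV[R]_n -> R) (l : R) :
  (forall x y, `|f x - f y| <= l * enorm (x - y) * (1 + enorm x + enorm y)) ->
  measurable_fun setT f.
Proof.
move=> lf; apply: measurable_fun_grid => x; apply/cvgrPdist_le => e e0.
(* On the grid of mesh [1 / (k + 1)] the increment of [f] is at most [(b - 1) / (k + 1)]; the last
   [+ 1] keeps [b] positive when [l] or [n] is zero. *)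
pose b := `|l| * n%:R * (1 + (2 * nrm1 x + n%:R)) + 1.
have b0 : 0 < b.
  by rewrite ltr_wpDl// !mulr_ge0// !addr_ge0// mulr_ge0// nrm1_ge0.
near=> k; have k0 : 0 < k.+1%:R :> R by rewrite ltr0n.
have kb : b / e <= k.+1%:R.
  near: k; exists (Num.bound (b / e)) => // k /= bk.
  apply: le_trans (ltW (archi_boundP _)) _; first by rewrite divr_ge0// ltW.
  by rewrite ler_nat ltnW.
have gc := grid_close k x.
have nk : n%:R / k.+1%:R <= n%:R :> R.
  by rewrite ler_pdivrMr// ler_peMr// ler1n.
rewrite distrC; apply: le_trans (lf _ _) _.
apply: (@le_trans _ _ (`|l| * enorm (of_grid k (grid k x) - x) *
    (1 + enorm (of_grid k (grid k x)) + enorm x))).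
  by rewrite !ler_wpM2r ?addr_ge0 ?enorm_ge0 ?ler_norm.
apply: (@le_trans _ _ (`|l| * (n%:R / k.+1%:R) * (1 + (2 * nrm1 x + n%:R)))).
  apply: ler_pM; rewrite ?addr_ge0 ?enorm_ge0//.
  - by rewrite mulr_ge0// enorm_ge0.
  - by rewrite ler_wpM2l//; exact: le_trans (enorm_le_nrm1 _) gc.
  - rewrite -addrA lerD2l; set g := of_grid k _ in gc *.
    have gx : enorm g <= nrm1 (g - x) + nrm1 x.
      by apply: le_trans (enorm_le_nrm1 _) _; rewrite -{1}(subrK x g) nrm1D.
    move: gx (enorm_le_nrm1 x) (le_trans gc nk).
    move: (enorm g) (enorm x) (nrm1 x) (nrm1 (g - x)) (n%:R : R) => ? ? ? ? ?; lra.
have -> : `|l| * (n%:R / k.+1%:R) * (1 + (2 * nrm1 x + n%:R)) = (b - 1) / k.+1%:R.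
  by rewrite /b addrK; ring.
rewrite ler_pdivrMr//; apply: (@le_trans _ _ b); first by lra.
by rewrite mulrC -ler_pdivrMr.
Unshelve. all: by end_near.
Qed.

Lemma measurable_lipschitz n m (f : 'cV[R]_n -> 'cV[R]_m) (l : R) :
  lipschitz_with l f -> measurable_fun setT f.
Proof.
move=> lf; apply: measurable_cVP => i.
apply: (@measurable_local_lipschitz _ _ `|l|) => x y.
rewrite (_ : f x i 0 - f y i 0 = (f x - f y) i 0); last by rewrite !mxE.
apply: le_trans (ler_enorm _ _) _; apply: le_trans (lf x y) _.
apply: (@le_trans _ _ (`|l| * enorm (x - y))).
  by rewrite ler_wpM2r ?enorm_ge0// ler_norm.
by rewrite ler_peMr ?mulr_ge0 ?enorm_ge0// -addrA lerDl addr_ge0 ?enorm_ge0.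
Qed.
End cV_measurability.

(** * Translation invariance of Lebesgue measure *)

Section translation.
Local Open Scope ereal_scope.
Context (R : realType).

Lemma ge0_integral_shift1 (f : measurableTypeR R -> \bar R) (a : R) :
  measurable_fun setT f -> (forall x, 0 <= f x) ->
  \int[lebesgue_measure]_x f (x + a)%R = \int[lebesgue_measure]_x f x.
Proof.
move=> mf f0.
have ms : measurable_fun setT (fun x : measurableTypeR R => (x + a)%R : measurableTypeR R).
  exact: measurable_funD.
pose s : {mfun measurableTypeR R >-> measurableTypeR R} :=
  HB.pack (fun x : measurableTypeR R => (x + a)%R) (isMeasurableFun.Build _ _ _ _ _ ms).
transitivity (\int[pushforward lebesgue_measure s]_x f x).
  by rewrite ge0_integral_pushforward.
apply: eq_integral_measurable => A mA; apply/esym.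
apply: (@lebesgue_measure_unique R (pushforward lebesgue_measure s)) => //.
move=> _ [[x y] _ <-] /=.
rewrite /pushforward.
rewrite (_ : _ @^-1` _ = `](x - a)%R, (y - a)%R]%classic).
  rewrite !lebesgue_measure_itv/= !lte_fin ltrD2r.
  by case: ifPn => // _; rewrite -!EFinB; congr EFin; ring.
apply/seteqP; split => t /=; rewrite !in_itv/= ltrBlDr lerBrDr//.
Qed.

(** Induction on the dimension by Tonelli. From here on translations are the only changes of
    variable made in Lebesgue integrals, so no Jacobian ever appears. *)
Lemma ge0_integral_shift n (f : 'cV[R]_n -> \bar R) (a : 'cV[R]_n) :
  measurable_fun setT f -> (forall x, 0 <= f x) ->
  \int[lebesgue_cV R n]_x f (x + a)%R = \int[lebesgue_cV R n]_x f x.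
Proof.
elim: n => [|n ih] in f a *; move=> mf f0.
  by apply: eq_integral => x _; rewrite (flatmx0 (x + a)%R) (flatmx0 (x : 'cV[R]_0)).
rewrite /=.
have mfs : measurable_fun setT (fun x : 'cV[R]_n.+1 => f (x + a)%R).
  apply: measurableT_comp => //; exact: measurable_cV_add.
rewrite !ge0_integral_pushforward//; try exact: measurable_cV_cons.
rewrite !preimage_setT.
have mc (g : 'cV[R]_n.+1 -> \bar R) : measurable_fun setT g ->
    measurable_fun setT (g \o @cV_cons R n).
  by move=> mg; apply: measurableT_comp => //; exact: measurable_cV_cons.
apply: etrans (fubini_tonelli1 _ (mc _ mfs) (fun z => f0 _)) _.
apply: etrans (esym (fubini_tonelli1 _ (mc _ mf) (fun z => f0 _))).
pose a' : 'cV[R]_n := (\col_j a (lift ord0 j) 0)%R.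
rewrite -[RHS](@ge0_integral_shift1 _ (a ord0 0)%R); last 2 first.
  exact: (measurable_fun_fubini_tonelli_F _ (mc _ mf) (fun z => f0 _)).
  by move=> x; apply: integral_ge0 => y _; exact: f0.
apply: eq_integral => x _; rewrite /fubini_F/=.
rewrite -[RHS](ih _ a')//; last first.
  apply: (measurableT_comp mf).
  apply: (measurableT_comp (@measurable_cV_cons R n)).
  exact: measurable_fun_pair.
apply: eq_integral => v _; congr f; apply/colP => i; rewrite !mxE.
by case: unliftP => [j ->|->]//=; rewrite !mxE.
Qed.

End translation.

(** * Moments and Gaussian laws *)

Section real_inequalities.
Context (R : realType).
Implicit Types x y a b : R.

(** Termwise from [(i + 3)! >= i!] in the exponential series. The remainder is crude, but [expR |x|]
    is integrable for the laws considered. *)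
Lemma expR_taylor3 x : `|expR x - (1 + x + x ^+ 2 / 2)| <= `|x| ^+ 3 * expR `|x|.
Proof.
have cx := is_cvg_series_exp_coeff x.
have ex : (series (exp_coeff x) n.+3 - (1 + x + x ^+ 2 / 2)) @[n --> \oo] -->
    expR x - (1 + x + x ^+ 2 / 2).
  apply: cvgB; last exact: cvg_cst.
  rewrite (_ : (fun n => _) = (fun n => series (exp_coeff x) (n + 3)%N)).
    by rewrite cvg_shiftn.
  by apply/funext => n; rewrite addn3.
have cn : `|series (exp_coeff x) n.+3 - (1 + x + x ^+ 2 / 2)| @[n --> \oo] -->
    `|expR x - (1 + x + x ^+ 2 / 2)| by exact: cvg_norm.
rewrite -(cvg_lim _ cn)//; apply: limr_le; first by apply/cvg_ex; eexists; exact: cn.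
apply: nearW => n.
have -> : series (exp_coeff x) n.+3 - (1 + x + x ^+ 2 / 2) =
    \sum_(0 <= i < n) exp_coeff x i.+3.
  have f1 : 1`!%:R = 1 :> R by [].
  have f2 : 2`!%:R = 2 :> R by [].
  rewrite /series/= 3?big_nat_recl// /exp_coeff/= fact0 f1 f2 expr0 expr1 !divr1.
  by move: (\sum_(_ <= _ < _) _) => w; ring.
apply: le_trans (ler_norm_sum _ _ _) _.
apply: (@le_trans _ _ (`|x| ^+ 3 * series (exp_coeff `|x|) n)).
  rewrite /series/= mulr_sumr; apply: ler_sum => i _.
  rewrite /exp_coeff/= normrM normrX normfV [`|_%:R|]ger0_norm//.
  rewrite -[X in X / _]/(`|x| ^+ (3 + i)) exprD -mulrA.
  rewrite ler_wpM2l ?exprn_ge0// ler_wpM2l ?exprn_ge0//.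
  rewrite lef_pV2 ?posrE ?ltr0n ?fact_gt0// ler_nat.
  by apply: leq_fact; rewrite -addn3 leq_addr.
rewrite ler_wpM2l ?exprn_ge0//; apply: nondecreasing_cvgn_le.
  apply/nondecreasing_seqP => k; rewrite /series/= big_nat_recr//= lerDl.
  by rewrite divr_ge0// exprn_ge0.
exact: is_cvg_series_exp_coeff.
Qed.

Lemma small_eq0 a c : (forall t, 0 < t <= 1 -> `|a| <= t * c) -> a = 0.
Proof.
move=> h; apply/eqP; apply: contraT => a0; have ap : 0 < `|a| by rewrite normr_gt0.
have h1 : `|a| <= c by have := h 1; rewrite mul1r lexx ltr01; apply.
have c0 : 0 < c by exact: lt_le_trans h1.
have t0 : 0 < `|a| / (2 * c) by rewrite divr_gt0// mulr_gt0.
have t1 : `|a| / (2 * c) <= 1 by rewrite ler_pdivrMr ?mulr_gt0// mul1r; lra.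
have := h (`|a| / (2 * c)); rewrite t0 t1 => /(_ isT).
have -> : `|a| / (2 * c) * c = `|a| / 2 by field; rewrite gt_eqF.
lra.
Qed.

Lemma lerX k x y : 0 <= x -> x <= y -> x ^+ k <= y ^+ k.
Proof. by move=> x0 xy; rewrite lerXn2r// nnegrE (le_trans x0). Qed.

Lemma ler_sqr_sum x y : `|x * y| <= x ^+ 2 + y ^+ 2.
Proof.
rewrite normrM -[x ^+ 2]real_normK ?num_real// -[y ^+ 2]real_normK ?num_real//.
have := sqr_ge0 (`|x| - `|y|); have := normr_ge0 x; have := normr_ge0 y.
by move: `|x| `|y| => a b; nra.
Qed.

Lemma exprD_le x y k : 0 <= x -> 0 <= y ->
  (x + y) ^+ k <= 2 ^+ k * (x ^+ k + y ^+ k).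
Proof.
move=> x0 y0; wlog xy : x y x0 y0 / x <= y => [h|].
  have [/h|/ltW yx] := leP x y; first exact.
  by rewrite addrC [x ^+ k + _]addrC; apply: h.
apply: (@le_trans _ _ ((2 * y) ^+ k)).
  by apply: lerX; [exact: addr_ge0|lra].
by rewrite exprMn ler_wpM2l ?exprn_ge0// lerDr exprn_ge0.
Qed.

End real_inequalities.

Section all_moments.
Context d (T : measurableType d) (R : realType).
Variable mu : probability T R.
Implicit Types f g : T -> R.

(** All moments at once: unlike a single Lebesgue space this class is closed under products, because
    [|f g|^k <= |f|^(2k) + |g|^(2k)]. *)
Definition Lall f := measurable_fun setT f /\
  forall k, (\int[mu]_x (`|f x| ^+ k)%:E < +oo)%E.

Lemma Lall_meas f : Lall f -> measurable_fun setT f.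
Proof. by case. Qed.

Lemma Lall_le f g : measurable_fun setT f -> Lall g ->
  (forall x, `|f x| <= `|g x|) -> Lall f.
Proof.
move=> mf [mg ig] fg; split => // k; apply: le_lt_trans (ig k).
apply: le_integral_ge0 => x; rewrite lee_fin ?exprn_ge0//.
exact: lerX.
Qed.

Lemma Lall_cst c : Lall (cst c).
Proof.
split => // k; rewrite -[X in (X < _)%E]/(\int[mu]_x (cst (`|c| ^+ k)%:E x))%E.
rewrite integral_cst// [X in (_ * X)%E]probability_setT mule1.
exact: ltry.
Qed.

Let mX f k : measurable_fun setT f -> measurable_fun setT (fun x => (`|f x| ^+ k)%:E).
Proof.
by move=> mf; apply/measurable_EFinP/measurable_funX; exact: measurableT_comp.
Qed.

Lemma LallD f g : Lall f -> Lall g -> Lall (fun x => f x + g x).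
Proof.
move=> [mf iF] [mg ig]; split; first exact: measurable_funD.
move=> k; apply: (@le_lt_trans _ _
  (\int[mu]_x ((2 ^+ k)%:E * ((`|f x| ^+ k)%:E + (`|g x| ^+ k)%:E))))%E.
  apply: le_integral_ge0 => x; first by rewrite lee_fin exprn_ge0.
  rewrite -EFinD -EFinM lee_fin; apply: le_trans (exprD_le _ _ _) => //.
  by apply: lerX => //; exact: ler_normD.
rewrite ge0_integralZl//; last 2 first.
- by apply: emeasurable_funD; exact: mX.
- by move=> x _; rewrite -EFinD lee_fin addr_ge0// exprn_ge0.
rewrite lte_mul_pinfty// ?lee_fin ?exprn_ge0//.
rewrite ge0_integralD//; try exact: mX; try by move=> x _; rewrite lee_fin exprn_ge0.
by rewrite lte_add_pinfty.
Qed.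

Lemma LallM f g : Lall f -> Lall g -> Lall (fun x => f x * g x).
Proof.
move=> [mf iF] [mg ig]; split; first exact: measurable_funM.
move=> k; apply: (@le_lt_trans _ _
  (\int[mu]_x ((`|f x| ^+ (k * 2))%:E + (`|g x| ^+ (k * 2))%:E)))%E.
  apply: le_integral_ge0 => x; first by rewrite lee_fin exprn_ge0.
  rewrite -EFinD lee_fin !exprM normrM exprMn; apply: le_trans (ler_sqr_sum _ _).
  exact: ler_norm.
rewrite ge0_integralD//; try exact: mX; try by move=> x _; rewrite lee_fin exprn_ge0.
by rewrite lte_add_pinfty.
Qed.

Lemma LallZ c f : Lall f -> Lall (fun x => c * f x).
Proof. by move=> h; apply: LallM => //; exact: Lall_cst. Qed.

Lemma LallN f : Lall f -> Lall (fun x => - f x).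
Proof. by move=> h; under eq_fun do rewrite -mulN1r; exact: LallZ. Qed.

Lemma LallB f g : Lall f -> Lall g -> Lall (fun x => f x - g x).
Proof. by move=> hf hg; apply: LallD => //; exact: LallN. Qed.

Lemma LallX f k : Lall f -> Lall (fun x => f x ^+ k).
Proof.
move=> h; elim: k => [|k ih].
  by under eq_fun do rewrite expr0; exact: Lall_cst.
by under eq_fun do rewrite exprS; exact: LallM.
Qed.

Lemma Lall_norm f : Lall f -> Lall (fun x => `|f x|).
Proof.
move=> h; apply: Lall_le (h) _; first by apply: measurableT_comp => //; case: h.
by move=> x; rewrite normr_id.
Qed.

Lemma Lall_sum (I : Type) (s : seq I) (f : I -> T -> R) :
  (forall i, Lall (f i)) -> Lall (fun x => \sum_(i <- s) f i x).
Proof.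
move=> h; elim: s => [|i s ih].
  by under eq_fun do rewrite big_nil; exact: Lall_cst.
by under eq_fun do rewrite big_cons; exact: LallD.
Qed.

Lemma Lall_integrable f : Lall f -> mu.-integrable setT (EFin \o f).
Proof.
move=> [mf /(_ 1)]; under eq_integral do rewrite expr1.
by move=> h; apply/integrableP; split => //; exact/measurable_EFinP.
Qed.

Lemma EFin_mean f : mu.-integrable setT (EFin \o f) ->
  (\int[mu]_x (f x)%:E)%E = (mean mu f)%:E.
Proof. by move=> h; rewrite /mean fineK//; exact: integrable_fin_num. Qed.

Lemma meanD f g : mu.-integrable setT (EFin \o f) -> mu.-integrable setT (EFin \o g) ->
  mean mu (fun x => f x + g x) = mean mu f + mean mu g.
Proof. exact: RintegralD. Qed.

Lemma meanB f g : mu.-integrable setT (EFin \o f) -> mu.-integrable setT (EFin \o g) ->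
  mean mu (fun x => f x - g x) = mean mu f - mean mu g.
Proof. exact: RintegralB. Qed.

Lemma meanZ c f : mu.-integrable setT (EFin \o f) ->
  mean mu (fun x => c * f x) = c * mean mu f.
Proof. exact: RintegralZl. Qed.

Lemma mean_cst c : mean mu (cst c) = c.
Proof. by rewrite /mean -[X in fine X]/(\int[mu]_x (cst c%:E x))%E integral_cst// [X in (_ * X)%E]probability_setT mule1. Qed.

Lemma mean_ge0 f : (forall x, 0 <= f x) -> 0 <= mean mu f.
Proof. by move=> f0; apply/fine_ge0/integral_ge0 => x _; rewrite lee_fin. Qed.

Lemma le_mean f g : mu.-integrable setT (EFin \o f) -> mu.-integrable setT (EFin \o g) ->
  (forall x, f x <= g x) -> mean mu f <= mean mu g.
Proof. by move=> hf hg fg; apply: le_Rintegral => // x _; exact: fg. Qed.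

Lemma ler_norm_mean f g : measurable_fun setT f -> mu.-integrable setT (EFin \o g) ->
  (forall x, `|f x| <= g x) -> `|mean mu f| <= mean mu g.
Proof.
move=> mf ig fg.
have iF : mu.-integrable setT (EFin \o f).
  apply: le_integrable ig => //; first exact/measurable_EFinP.
  by move=> x _ /=; rewrite lee_fin (le_trans (fg x))// ler_norm.
apply: le_trans (le_normr_Rintegral _ iF) _ => //.
apply: le_mean => //; exact: integrable_norm.
Qed.

Lemma eq_mean f g : f =1 g -> mean mu f = mean mu g.
Proof. by move=> /funext ->. Qed.

Lemma mean_sum (I : Type) (s : seq I) (f : I -> T -> R) :
  (forall i, mu.-integrable setT (EFin \o f i)) ->
  mean mu (fun x => \sum_(i <- s) f i x) = \sum_(i <- s) mean mu (f i).
Proof.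
move=> h; have hs s' : mu.-integrable setT (EFin \o (fun x => \sum_(i <- s') f i x)).
  rewrite (_ : _ \o _ = (fun x => \sum_(i <- s') (EFin \o f i) x)%E).
    by apply: integrable_sum.
  by apply/funext => x /=; rewrite sumEFin.
elim: s => [|i s ih].
  by rewrite big_nil; under eq_mean do rewrite big_nil; exact: mean_cst.
by rewrite big_cons; under eq_mean do rewrite big_cons; rewrite meanD// ih.
Qed.

End all_moments.

(** * Moments read off the moment generating function *)

Section subgaussian.
Context d (T : measurableType d) (R : realType).
Variable mu : probability T R.

Lemma Lall_mgf (s : T -> R) : measurable_fun setT s ->
  (forall t, (\int[mu]_x (expR (t * s x))%:E < +oo)%E) ->
  Lall mu (fun x => expR `|s x|).
Proof.
move=> ms h; split => [|k].
  by apply: measurableT_comp => //; exact: measurableT_comp.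
have me t : measurable_fun setT (fun x => (expR (t * s x))%:E).
  by apply/measurable_EFinP; apply: measurableT_comp => //; exact: measurable_funM.
apply: (@le_lt_trans _ _
  (\int[mu]_x ((expR (k%:R * s x))%:E + (expR (- k%:R * s x))%:E)))%E.
  apply: le_integral_ge0 => x; first by rewrite lee_fin exprn_ge0.
  rewrite -EFinD lee_fin ger0_norm ?expR_ge0// -expRM_natl.
  have [s0|s0] := leP 0 (s x); first by rewrite ger0_norm// lerDl expR_ge0.
  by rewrite ltr0_norm// mulrN -mulNr lerDr expR_ge0.
rewrite ge0_integralD//; try by move=> x _; rewrite lee_fin expR_ge0.
by rewrite lte_add_pinfty.
Qed.

Lemma Lall_expR_norm (s : T -> R) : measurable_fun setT s ->
  Lall mu (fun x => expR `|s x|) -> Lall mu s.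
Proof.
move=> ms Le; apply: Lall_le Le _ => // x; rewrite [leRHS]ger0_norm ?expR_ge0//.
by have := expR_ge1Dx `|s x|; lra.
Qed.

(* The first two moments are read off the expansion of the moment generating
   function at 0. *)
Lemma mgf_moments (s : T -> R) (v : R) : measurable_fun setT s -> 0 <= v ->
  (forall t, \int[mu]_x (expR (t * s x))%:E = (expR (t ^+ 2 * v / 2))%:E)%E ->
  mean mu s = 0 /\ mean mu (fun x => s x ^+ 2) = v.
Proof.
move=> ms v0 h.
have Le : Lall mu (fun x => expR `|s x|).
  by apply: Lall_mgf => // t; rewrite h ltry.
have Ls := Lall_expR_norm ms Le.
pose B := mean mu (fun x => `|s x| ^+ 3 * expR `|s x|).
have LB : Lall mu (fun x => `|s x| ^+ 3 * expR `|s x|).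
  by apply: LallM => //; apply: LallX; exact: Lall_norm.
pose m1 := mean mu s; pose m2 := mean mu (fun x => s x ^+ 2).
have key t : `|t| <= 1 ->
    `|expR (t ^+ 2 * v / 2) - (1 + t * m1 + t ^+ 2 * m2 / 2)| <= `|t| ^+ 3 * B.
  move=> t1; have Let : Lall mu (fun x => expR (t * s x)).
    apply: Lall_le Le _ => [|x].
      by apply: measurableT_comp => //; exact: measurable_funM.
    rewrite !(ger0_norm (expR_ge0 _)) ler_expR (le_trans (ler_norm _))// normrM.
    by rewrite ler_piMl.
  have -> : expR (t ^+ 2 * v / 2) = mean mu (fun x => expR (t * s x)).
    by rewrite /mean h.
  have L2 : Lall mu (fun x => t ^+ 2 / 2 * s x ^+ 2) by exact/LallZ/LallX.
  have L1 : Lall mu (fun x => 1 + t * s x) by apply: LallD; [exact: Lall_cst|exact: LallZ].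
  have -> : 1 + t * m1 + t ^+ 2 * m2 / 2 =
      mean mu (fun x => (1 + t * s x) + t ^+ 2 / 2 * s x ^+ 2).
    rewrite meanD; try exact: Lall_integrable.
    rewrite meanD; try exact: Lall_integrable; last 2 first.
      exact/Lall_integrable/Lall_cst.
      exact/Lall_integrable/LallZ.
    rewrite mean_cst !meanZ; try exact: Lall_integrable; last exact/Lall_integrable/LallX.
    by rewrite /m1 /m2; ring.
  rewrite -meanB; try exact: Lall_integrable; last exact/Lall_integrable/LallD.
  rewrite /B -meanZ; last exact: Lall_integrable.
  apply: ler_norm_mean; last 1 first.
  - move=> x.
    have -> : 1 + t * s x + t ^+ 2 / 2 * s x ^+ 2 = 1 + (t * s x) + (t * s x) ^+ 2 / 2.
      by field.
    apply: le_trans (expR_taylor3 _) _.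
    rewrite normrM exprMn -mulrA ler_wpM2l ?exprn_ge0// ler_wpM2l ?exprn_ge0//.
    by rewrite ler_expR ler_piMl.
  - exact: (measurable_funB (Lall_meas Let) (Lall_meas (LallD L1 L2))).
  - exact/Lall_integrable/LallZ.
(* With [z = t^2 v / 2] and [t <= 1], the terms [z^2 / 2] and [z^3 expR z] are at most [t^3 v^2] and
   [t^3 v^3 expR v]. *)
pose B' := v ^+ 2 + v ^+ 3 * expR v.
have B0 : 0 <= B by apply: mean_ge0 => x; rewrite mulr_ge0 ?exprn_ge0 ?expR_ge0.
have key' t : 0 <= t <= 1 ->
    `|expR (t ^+ 2 * v / 2) - (1 + t ^+ 2 * v / 2)| <= t ^+ 3 * B'.
  move=> /andP[t0 t1]; set z := t ^+ 2 * v / 2.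
  have z0 : 0 <= z by rewrite divr_ge0// mulr_ge0// exprn_ge0.
  have t2 : t ^+ 2 <= 1 by rewrite exprn_ile1.
  have zv : z <= v by rewrite /z; nra.
  have h1 := expR_taylor3 z; rewrite (ger0_norm z0) in h1.
  have t43 : t ^+ 4 <= t ^+ 3 by rewrite exprS ler_piMl ?exprn_ge0.
  have t63 : t ^+ 6 <= t ^+ 3.
    by rewrite (exprD _ 3 3) ler_piMl ?exprn_ge0// exprn_ile1.
  have h2 : z ^+ 2 <= t ^+ 3 * v ^+ 2.
    have -> : z ^+ 2 = t ^+ 4 * (v ^+ 2 / 4) by rewrite /z; field.
    by apply: ler_pM; rewrite ?exprn_ge0//; have := sqr_ge0 v; lra.
  have h3 : z ^+ 3 * expR z <= t ^+ 3 * (v ^+ 3 * expR v).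
    rewrite mulrA; apply: ler_pM; rewrite ?exprn_ge0 ?expR_ge0 ?ler_expR//.
    have -> : z ^+ 3 = t ^+ 6 * (v ^+ 3 / 8) by rewrite /z; field.
    have v3 : 0 <= v ^+ 3 by exact: exprn_ge0.
    by apply: ler_pM; rewrite ?exprn_ge0//; lra.
  have z2 := sqr_ge0 z; rewrite /B' mulrDr.
  have -> : expR z - (1 + z) = (expR z - (1 + z + z ^+ 2 / 2)) + z ^+ 2 / 2 by ring.
  apply: le_trans (ler_normD _ _) _; rewrite addrC; apply: lerD; last exact: le_trans h1 h3.
  rewrite ger0_norm; lra.
have BB : 0 <= B + B'.
  by rewrite !addr_ge0// ?mulr_ge0 ?exprn_ge0 ?expR_ge0.
(* The expansions at [t] and [- t] are subtracted to isolate the first moment and added to isolate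
   the second; both remainders are of order [t^3]. *)
have step t : 0 < t <= 1 -> `|m1| <= t * (2 * (B + B')) /\ `|m2 - v| <= t * (2 * (B + B')).
  move=> /andP[t0 t1].
  have kp : `|t| <= 1 by rewrite gtr0_norm.
  have kn : `|- t| <= 1 by rewrite normrN gtr0_norm.
  have := key _ kp; have := key _ kn; rewrite normrN sqrrN (gtr0_norm t0).
  have : 0 <= t <= 1 by rewrite (ltW t0) t1.
  move=> /key'; set e := expR _ => k1 k2 k3.
  have t3 : t ^+ 3 = t * t * t by rewrite !exprS expr0 mulr1 mulrA.
  have n1 : `|t * m1 + t ^+ 2 * (m2 - v) / 2| <= t ^+ 3 * (B + B').
    have -> : t * m1 + t ^+ 2 * (m2 - v) / 2 =
      (e - (1 + t ^+ 2 * v / 2)) - (e - (1 + t * m1 + t ^+ 2 * m2 / 2)) by field.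
    by apply: le_trans (ler_normB _ _) _; rewrite mulrDr addrC; exact: lerD.
  have n2 : `|- t * m1 + t ^+ 2 * (m2 - v) / 2| <= t ^+ 3 * (B + B').
    have -> : - t * m1 + t ^+ 2 * (m2 - v) / 2 =
      (e - (1 + t ^+ 2 * v / 2)) - (e - (1 + - t * m1 + t ^+ 2 * m2 / 2)) by field.
    by apply: le_trans (ler_normB _ _) _; rewrite mulrDr addrC; exact: lerD.
  split.
    apply: (@le_trans _ _ (t * (B + B'))); last by rewrite ler_wpM2l ?(ltW t0)//; lra.
    rewrite -(ler_pM2l t0) -{1}(gtr0_norm t0) -normrM.
    have -> : t * m1 = ((t * m1 + t ^+ 2 * (m2 - v) / 2) -
       (- t * m1 + t ^+ 2 * (m2 - v) / 2)) / 2 by field.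
    rewrite normrM [`|2^-1|]ger0_norm// ler_pdivrMr//.
    apply: le_trans (ler_normB _ _) _.
    have : t ^+ 3 * (B + B') <= t * (t * (B + B')).
      rewrite t3 -!mulrA ler_pM2l// ler_wpM2l ?(ltW t0)//.
      rewrite ler_piMl// addr_ge0// addr_ge0// ?mulr_ge0 ?exprn_ge0 ?expR_ge0//.
    lra.
  have t20 : 0 < t ^+ 2 by exact: exprn_gt0.
  rewrite -(ler_pM2l t20) -{1}(gtr0_norm t20) -normrM.
  have -> : t ^+ 2 * (m2 - v) = ((t * m1 + t ^+ 2 * (m2 - v) / 2) +
       (- t * m1 + t ^+ 2 * (m2 - v) / 2)) by field.
  apply: le_trans (ler_normD _ _) _.
  have -> : t ^+ 2 * (t * (2 * (B + B'))) = t ^+ 3 * (B + B') + t ^+ 3 * (B + B') by ring.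
  exact: lerD.
by split; [|apply/eqP; rewrite -subr_eq0; apply/eqP];
  apply: (small_eq0 (c := 2 * (B + B'))) => t /step[].
Qed.
End subgaussian.

Section gaussian.
Context (R : realType) (n : nat).
Implicit Types (P : 'M[R]_n) (m a b x : 'cV[R]_n) (c : R).

(** The parameter is the precision matrix, the inverse of the covariance: precisions add under
    conditioning. *)
Definition gker P x : R := expR (- (2^-1 * qf P x)).

Lemma gker_gt0 P x : 0 < gker P x.
Proof. exact: expR_gt0. Qed.

Lemma gker_ge0 P x : 0 <= gker P x.
Proof. exact: expR_ge0. Qed.

Lemma measurable_gker d (T : measurableType d) P (f : T -> 'cV[R]_n) :
  measurable_fun setT f -> measurable_fun setT (fun t => gker P (f t)).
Proof.
move=> mf; apply: (measurableT_comp (@measurable_expR R)).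
under eq_fun do rewrite -mulNr.
by apply: measurable_funM => //; exact: measurable_qf.
Qed.

Lemma gker_tilt P x a : P^T = P -> P \in unitmx ->
  gker P x * expR ((a^T *m x) 0 0) =
  expR (2^-1 * qf (invmx P) a) * gker P (x - invmx P *m a).
Proof.
move=> tP uP; rewrite -!expRD; congr expR.
rewrite -[x - _]/(x + - _) qfD// qfN.
have -> : qf P (invmx P *m a) = qf (invmx P) a.
  by rewrite -qf_conj trmx_inv tP mulVmx// mul1mx.
have -> : (x^T *m P *m - (invmx P *m a)) 0 0 = - (a^T *m x) 0 0.
  rewrite mulmxN mulmxA mulmxK// mxE; congr (- _).
  by rewrite !mxE; apply: eq_bigr => i _; rewrite !mxE mulrC.
by field.
Qed.

Lemma delta_dot i x : ((delta_mx i 0 : 'cV[R]_n)^T *m x) 0 0 = x i 0.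
Proof.
rewrite mxE (bigD1 i)//= !mxE !eqxx mul1r big1 ?addr0// => j ji.
by rewrite !mxE (negbTE ji) mul0r.
Qed.

Lemma scale_dot t a x : ((t *: a)^T *m x) 0 0 = t * (a^T *m x) 0 0.
Proof.
by rewrite !mxE mulr_sumr; apply: eq_bigr => i _; rewrite !mxE mulrA.
Qed.

Lemma add_dot a b x : ((a + b)^T *m x) 0 0 = (a^T *m x) 0 0 + (b^T *m x) 0 0.
Proof.
by rewrite !mxE -big_split/=; apply: eq_bigr => i _; rewrite !mxE mulrDl.
Qed.

(** The factor [c] is left free: for a probability it is determined by the total mass, and no
    determinant has to be evaluated. *)
Definition gaussian_law (mu : set 'cV[R]_n -> \bar R) c m P := 0 <= c /\
  forall A, measurable A -> mu A = of_density (fun x => c * gker P (x - m)) A.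

Context (mu : probability 'cV[R]_n R) (c : R) (m : 'cV[R]_n) (P : 'M[R]_n).
Hypotheses (gmu : gaussian_law mu c m P) (sP : spd P).

Lemma gaussian_integral (f : 'cV[R]_n -> \bar R) : measurable_fun setT f ->
  (forall x, 0 <= f x)%E ->
  (\int[mu]_x f x = \int[lebesgue_cV R n]_x (f x * (c * gker P (x - m))%:E))%E.
Proof.
move=> mf f0; rewrite (eq_integral_measurable _ gmu.2).
rewrite ge0_integral_dens// => [x|].
  by rewrite mulr_ge0 ?gker_ge0//; exact: gmu.1.
by apply: measurable_funM => //; apply: measurable_gker; exact: measurable_cV_sub.
Qed.

Lemma gaussian_mass :
  (\int[lebesgue_cV R n]_x (c * gker P (x - m))%:E = 1)%E.
Proof. by have := @probability_setT _ _ _ mu; rewrite (gmu.2 _ measurableT). Qed.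

(** Tilting by [expR (a^T x)] turns the density into a multiple of its translate by [invmx P *m a],
    whose mass is again 1 by translation invariance. *)
Lemma gaussian_mgf a :
  (\int[mu]_x (expR ((a^T *m (x - m)) 0 0))%:E = (expR (2^-1 * qf (invmx P) a))%:E)%E.
Proof.
have mm y : measurable_fun setT (fun x : 'cV[R]_n => x - y).
  exact: measurable_cV_sub.
rewrite gaussian_integral//; last first.
  apply/measurable_EFinP; apply: measurableT_comp => //.
  have ma := measurable_cV_mulmx a^T (mm m).
  exact: (measurable_cV_coord 0 ma).
transitivity (\int[lebesgue_cV R n]_x ((expR (2^-1 * qf (invmx P) a))%:E *
   (c * gker P (x - m - invmx P *m a))%:E))%E.
  apply: eq_integral => x _; rewrite -!EFinM; congr EFin.
  rewrite mulrCA [expR _ * _]mulrC gker_tilt; [ring|exact: sP.1|exact: spd_unit].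
rewrite ge0_integralZl//; last 2 first.
- apply/measurable_EFinP; apply: measurable_funM => //; apply: measurable_gker.
  exact: measurable_cV_sub.
- by move=> x _; rewrite lee_fin mulr_ge0 ?gker_ge0//; exact: gmu.1.
rewrite -[RHS]mule1; congr (_ * _)%E; rewrite -[RHS]gaussian_mass.
rewrite -[RHS](ge0_integral_shift (- (invmx P *m a))).
- by apply: eq_integral => x _; rewrite addrAC.
- apply/measurable_EFinP; apply: measurable_funM => //; apply: measurable_gker.
  exact: measurable_cV_sub.
- by move=> x; rewrite lee_fin mulr_ge0 ?gker_ge0//; exact: gmu.1.
Qed.

Let maff a : measurable_fun setT (fun x : 'cV[R]_n => (a^T *m (x - m)) 0 0).
Proof.
have mx : measurable_fun setT (fun x : 'cV[R]_n => x - m) by exact: measurable_cV_sub.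
exact: (measurable_cV_coord 0 (measurable_cV_mulmx a^T mx)).
Qed.

Lemma gaussian_lin a : mean mu (fun x => (a^T *m (x - m)) 0 0) = 0 /\
  mean mu (fun x => ((a^T *m (x - m)) 0 0) ^+ 2) = qf (invmx P) a.
Proof.
apply: mgf_moments => //; first exact: (spd_psd (spd_inv sP)).2.
move=> t; have := gaussian_mgf (t *: a); rewrite qfZ [X in _ = (expR X)%:E]mulrC => <-.
by apply: eq_integral => x _; rewrite scale_dot.
Qed.

Lemma gaussian_mgf_coord i t :
  (\int[mu]_x (expR (t * (x i 0 - m i 0)))%:E =
   (expR (t ^+ 2 * invmx P i i / 2))%:E)%E.
Proof.
have := gaussian_mgf (t *: delta_mx i 0); rewrite qfZ.
have -> : qf (invmx P) (delta_mx i 0) = invmx P i i.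
  by rewrite /qf -mulmxA delta_dot -colE mxE.
rewrite [X in _ = (expR X)%:E]mulrC => <-.
by apply: eq_integral => x _; rewrite scale_dot delta_dot !mxE.
Qed.

Lemma gaussian_Lall_coord i : Lall mu (fun x => expR `|x i 0 - m i 0|).
Proof.
apply: Lall_mgf => [|t].
  by apply: measurable_funB => //; exact: measurable_coord.
by rewrite gaussian_mgf_coord ltry.
Qed.

Lemma gaussian_mean i : mean mu (fun x => x i 0 - m i 0) = 0.
Proof.
have [h _] := gaussian_lin (delta_mx i 0); rewrite -[RHS]h; apply: eq_mean => x.
by rewrite delta_dot !mxE.
Qed.

(** Polarisation of the variances in the directions [e_i], [e_j] and [e_i + e_j]. *)
Lemma gaussian_cov i j :
  mean mu (fun x => (x i 0 - m i 0) * (x j 0 - m j 0)) = invmx P i j.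
Proof.
have L k : Lall mu (fun x => x k 0 - m k 0).
  apply: Lall_expR_norm (gaussian_Lall_coord k).
  by apply: measurable_funB => //; exact: measurable_coord.
have Q k l : ((delta_mx k 0 : 'cV[R]_n)^T *m invmx P *m (delta_mx l 0 : 'cV[R]_n)) 0 0 = invmx P k l.
  by rewrite -mulmxA delta_dot -colE mxE.
have V k : mean mu (fun x => (x k 0 - m k 0) ^+ 2) = invmx P k k.
  have [_ h] := gaussian_lin (delta_mx k 0); rewrite -Q -[RHS]h.
  by apply: eq_mean => x; rewrite delta_dot !mxE.
have [_ h] := gaussian_lin (delta_mx i 0 + delta_mx j 0).
have tPi : (invmx P)^T = invmx P by exact: trmx_invmx sP.1.
move: h; rewrite qfD// /qf !Q => h.
have -> : mean mu (fun x => (x i 0 - m i 0) * (x j 0 - m j 0)) =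
   2^-1 * (mean mu (fun x => (((delta_mx i 0 + delta_mx j 0 : 'cV[R]_n)^T *m (x - m)) 0 0) ^+ 2) -
   mean mu (fun x => (x i 0 - m i 0) ^+ 2) - mean mu (fun x => (x j 0 - m j 0) ^+ 2)).
  have Lij : Lall mu (fun x => (((delta_mx i 0 + delta_mx j 0 : 'cV[R]_n)^T *m (x - m)) 0 0) ^+ 2).
    apply: LallX; rewrite (_ : (fun x => _) =
      fun x : 'cV[R]_n => (x i 0 - m i 0) + (x j 0 - m j 0)); first exact: LallD.
    by apply/funext => x; rewrite add_dot !delta_dot !mxE.
  rewrite -!meanB; try exact/Lall_integrable/LallX; try exact: Lall_integrable; last first.
    by apply: Lall_integrable; apply: LallB => //; exact: LallX.
  rewrite -meanZ; last first.
    by apply: Lall_integrable; apply: LallB => //; [apply: LallB => //|]; exact: LallX.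
  by apply: eq_mean => x; rewrite add_dot !delta_dot !mxE; field.
by rewrite h !V; field.
Qed.

End gaussian.

(** * Independence *)

Section independence.
Context (R : realType) d (Omega : measurableType d) (P : probability Omega R).
Context (I : finType) dE (E : I -> measurableType dE) (X : forall i, Omega -> E i).
Hypothesis mX : forall i, measurable_fun setT (X i).
Hypothesis indX : mutually_independent P X.
Implicit Types K L : {set I}.

Definition cylinders K : set (set Omega) :=
  [set A | exists B : forall i, set (E i), (forall i, measurable (B i)) /\
    A = \bigcap_(i in [set i | i \in K]) (X i @^-1` B i)].

(** Dependence on the sources in [K], encoded as measurability on the same carrier with a smaller
    sigma-algebra; the lemmas on measurable sums and compositions then apply unchanged. *)
Definition depends_on K d' (T : measurableType d') (f : Omega -> T) :=
  @measurable_fun _ _ (g_sigma_algebraType (cylinders K)) T setT f.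

Let cylT K : cylinders K setT.
Proof.
exists (fun=> setT); split => //; apply/seteqP; by split.
Qed.

Let cylI K : setI_closed (cylinders K).
Proof.
move=> _ _ [B [mB ->]] [C [mC ->]]; exists (fun i => B i `&` C i).
split; first by move=> i; exact: measurableI.
by rewrite -bigcapI; apply: eq_bigcapr => i _; rewrite preimage_setI.
Qed.

Let cyl_measurable K : cylinders K `<=` measurable.
Proof.
move=> _ [B [mB ->]]; apply: fin_bigcap_measurable => // i _.
by rewrite -[X in measurable X]setTI; exact: (mX measurableT (mB i)).
Qed.

Let sigma_measurable K A : <<s cylinders K >> A -> measurable A.
Proof.
have h : <<s cylinders K >> `<=` measurable.
  by apply: smallest_sub; [exact: sigma_algebra_measurable|exact: cyl_measurable].
exact: h.
Qed.

Lemma depends_on_measurable K d' (T : measurableType d') (f : Omega -> T) :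
  depends_on K f -> measurable_fun setT f.
Proof.
move=> mf _ A mA; apply: (@sigma_measurable K).
exact: (mf (@measurableT _ (g_sigma_algebraType (cylinders K))) _ mA).
Qed.

Lemma depends_on_source K i : i \in K -> depends_on K (X i).
Proof.
move=> iK _ A mA; rewrite setTI; apply: sub_sigma_algebra.
(* The spaces [E j] vary with [j], so [A] is transported along [i = j]; for [j] other than [i] the
   condition is vacuous and [B j] is the whole space. *)
pose B j : set (E j) := [set x | forall e : i = j, A (ecast k (E k) (esym e) x)].
exists B; split => [j|].
  have [ij|ij] := eqVneq i j.
    case: j / ij @B => B; rewrite /B (_ : [set x | _] = A)//.
    apply/seteqP; split => x /= h; first exact: (h erefl).
    by move=> e; rewrite (eq_axiomK e).
  rewrite (_ : B j = setT)//; apply/seteqP; split => // x _ e.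
  by rewrite e eqxx in ij.
apply/seteqP; split => w /=.
  by move=> Aw j jK e; case: j / e jK.
by move=> /(_ i iK erefl).
Qed.

Lemma depends_on_sub K L d' (T : measurableType d') (f : Omega -> T) :
  K \subset L -> depends_on K f -> depends_on L f.
Proof.
move=> KL mf _ A mA.
have : <<s cylinders K >> ((setT : set Omega) `&` f @^-1` A).
  exact: (mf (@measurableT _ (g_sigma_algebraType (cylinders K))) _ mA).
suff h : <<s cylinders K >> `<=` <<s cylinders L >> by exact: h.
apply: smallest_sub; first exact: smallest_sigma_algebra.
move=> _ [B [mB ->]]; apply: sub_sigma_algebra.
exists (fun i => if i \in K then B i else setT); split => [i|].
  by case: ifP.
apply/seteqP; split => w /= h i /= iK.
  by case: ifPn => // /h.
by have := h i (fintype.subsetP KL _ iK); rewrite /= iK.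
Qed.

Lemma independent_cylinders K L A B : [disjoint K & L]%B ->
  cylinders K A -> cylinders L B -> P (A `&` B) = (P A * P B)%E.
Proof.
move=> KL [F [mF ->]] [G [mG ->]].
pose H i := if i \in K then F i else G i.
have mH i : measurable (H i) by rewrite /H; case: ifP.
have HK i : i \in K -> H i = F i by rewrite /H => ->.
have HL i : i \in L -> H i = G i.
  by rewrite /H; case: ifPn => // iK iL; have := disjointFr KL iK; rewrite iL.
have -> : \bigcap_(i in [set i | i \in K]) (X i @^-1` F i) `&`
    \bigcap_(i in [set i | i \in L]) (X i @^-1` G i) =
    \bigcap_(i in [set i | i \in K :|: L]) (X i @^-1` H i).
  apply/seteqP; split => [w [/= h1 h2] i /=|w h].
    by rewrite inE => /orP[iK|iL]; [rewrite HK//; exact: h1|rewrite HL//; exact: h2].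
  split => i /= iKL; first by rewrite -(HK i iKL); apply: h; rewrite /= inE iKL.
  by rewrite -(HL i iKL); apply: h; rewrite /= inE iKL orbT.
rewrite (indX _ mH) (indX _ mF) (indX _ mG).
rewrite (eq_bigl [predU K & L]); last by move=> i; rewrite !inE.
rewrite bigU//=; congr (_ * _)%E.
  by apply: eq_bigr => i iK; rewrite HK.
by apply: eq_bigr => i iL; rewrite HL.
Qed.

(** Two applications of uniqueness of measures on a pi-system: for fixed [C] the measures
    [P (D & C)] and [P C * P D] of [D] agree on cylinders, hence on the generated sigma-algebra. The
    two factors are upgraded one after the other. *)
Lemma independent_sigma K L A B : [disjoint K & L]%B ->
  <<s cylinders K >> A -> <<s cylinders L >> B -> P (A `&` B) = (P A * P B)%E.
Proof.
move=> KL.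
have key (C : set Omega) (mC : measurable C) (G : set (set Omega)) : G `<=` measurable ->
    setI_closed G -> G setT -> (forall D, G D -> P (D `&` C) = (P D * P C)%E) ->
    forall D, <<s G >> D -> P (D `&` C) = (P D * P C)%E.
  move=> Gm GI GT GC D GD.
  have pC : 0 <= fine (P C) by exact: fine_ge0.
  have fC : (fine (P C))%:E = P C by rewrite fineK// fin_num_measure.
  transitivity (mrestr P mC D) => //.
  transitivity (mscale (NngNum pC) P D); last by rewrite /mscale/= fC muleC.
  apply: (g_sigma_algebra_measure_unique G Gm (fun=> setT)) => //.
  - by rewrite bigcup_const.
  - move=> A' GA'; transitivity ((fine (P C))%:E * P A')%E; last by [].
    by rewrite fC muleC; exact: GC.
  - move=> k; rewrite /= /mrestr; apply: le_lt_trans (ltry 1).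
    by rewrite -(@probability_setT _ _ _ P); apply: le_measure; rewrite ?inE//; exact: measurableI.
move=> KA LB; apply: (key B (sigma_measurable LB) (cylinders K)) => //.
move=> D KD; have mD := cyl_measurable KD.
rewrite setIC muleC; apply: (key D mD (cylinders L)) => // F LF.
by rewrite setIC muleC; exact: (independent_cylinders KL).
Qed.

(** The joint law agrees with the product of the marginals on rectangles, hence everywhere; Tonelli
    then separates the integrations. *)
Lemma independent_joint K L d1 d2 (T1 : measurableType d1) (T2 : measurableType d2)
  (f : Omega -> T1) (g : Omega -> T2) (h : T1 * T2 -> \bar R) :
  [disjoint K & L]%B -> depends_on K f -> depends_on L g ->
  measurable_fun setT h -> (forall z, 0 <= h z)%E ->
  (\int[P]_w h (f w, g w) = \int[P]_w \int[P]_w' h (f w, g w'))%E.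
Proof.
move=> KL df dg mh h0.
have mf := depends_on_measurable df; have mg := depends_on_measurable dg.
pose f' : {mfun Omega >-> T1} := HB.pack f (isMeasurableFun.Build _ _ _ _ _ mf).
pose g' : {mfun Omega >-> T2} := HB.pack g (isMeasurableFun.Build _ _ _ _ _ mg).
have mfg : measurable_fun setT (fun w => (f w, g w)) by exact: measurable_fun_pair.
pose fg' : {mfun Omega >-> (T1 * T2)%type} :=
  HB.pack (fun w => (f w, g w)) (isMeasurableFun.Build _ _ _ _ _ mfg).
transitivity (\int[distribution P fg']_z h z)%E.
  by rewrite ge0_integral_distribution.
transitivity (\int[distribution P f' \x distribution P g']_z h z)%E.
  apply/esym; apply: eq_integral_measurable; apply: product_measure_unique => A B mA mB.
  rewrite /distribution /= /pushforward/=.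
  apply: (@independent_sigma K L) => //.
    have := df (@measurableT _ (g_sigma_algebraType (cylinders K))) A mA.
    by rewrite setTI.
  have := dg (@measurableT _ (g_sigma_algebraType (cylinders L))) B mB.
  by rewrite setTI.
rewrite fubini_tonelli1// ge0_integral_distribution//; last 2 first.
- exact: measurable_fun_fubini_tonelli_F.
- by move=> x; apply: integral_ge0.
apply: eq_integral => w _; rewrite /fubini_F /= ge0_integral_distribution//.
by apply: measurableT_comp => //; exact: measurable_fun_pair.
Qed.

Lemma independent_meanM K L (f g : Omega -> R) :
  [disjoint K & L]%B -> depends_on K f -> depends_on L g ->
  Lall P f -> Lall P g ->
  mean P (fun w => f w * g w) = mean P f * mean P g.
Proof.
move=> KL.
(* Tonelli handles nonnegative factors; the general case follows by bilinearity from positive and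
   negative parts, which depend on the same sources. *)
have pos (u v : Omega -> R) : depends_on K u -> depends_on L v ->
    Lall P u -> Lall P v -> (forall w, 0 <= u w) -> (forall w, 0 <= v w) ->
    mean P (fun w => u w * v w) = mean P u * mean P v.
  move=> du dv Lu Lv u0 v0.
  pose h (z : R * R) : \bar R := (`|z.1| * `|z.2|)%:E.
  rewrite /mean.
  transitivity (fine (\int[P]_w h (u w, v w)))%E.
    by congr fine; apply: eq_integral => w _; rewrite /h/= !ger0_norm.
  rewrite (independent_joint KL du dv); last 2 first.
  - apply/measurable_EFinP; apply: measurable_funM; exact: measurableT_comp.
  - by move=> z; rewrite lee_fin mulr_ge0.
  have -> : (\int[P]_w \int[P]_w' h (u w, v w'))%E =
      (\int[P]_w ((u w)%:E * (mean P v)%:E))%E.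
    apply: eq_integral => w _; rewrite -EFin_mean; last exact: Lall_integrable.
    rewrite -ge0_integralZl//.
    - by apply: eq_integral => w' _; rewrite /h/= !ger0_norm.
    - by apply/measurable_EFinP; exact: Lall_meas Lv.
    - by move=> w' _; rewrite lee_fin.
    - by rewrite lee_fin.
  rewrite ge0_integralZr//.
  - by rewrite EFin_mean//; exact: Lall_integrable.
  - by apply/measurable_EFinP; exact: Lall_meas Lu.
  - by move=> w' _; rewrite lee_fin.
  - by rewrite lee_fin mean_ge0.
move=> df dg Lf Lg.
pose p (u : Omega -> R) w := Num.max (u w) 0.
have p0 u w : 0 <= p u w by rewrite le_max lexx orbT.
have pE u w : u w = p u w - p (fun w => - u w) w.
  rewrite /p; have [u0|u0] := leP (u w) 0.
    by rewrite max_l ?oppr_ge0// opprK add0r.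
  by rewrite max_r ?subr0// oppr_le0 ltW.
have dp M (u : Omega -> R) : depends_on M u -> depends_on M (p u).
  by move=> du; apply: measurable_maxr.
have dN M (u : Omega -> R) : depends_on M u -> depends_on M (fun w => - u w).
  by move=> du; apply: measurableT_comp du.
have Lp u : Lall P u -> Lall P (p u).
  move=> Lu; apply: Lall_le (Lu) _.
    by apply: measurable_maxr => //; exact: (Lall_meas Lu).
  move=> w; rewrite (ger0_norm (p0 u w)) /p ge_max normr_ge0 andbT.
  exact: ler_norm.
have [Lf1 Lf2] := (Lp _ Lf, Lp _ (LallN Lf)).
have [Lg1 Lg2] := (Lp _ Lg, Lp _ (LallN Lg)).
have mE u : Lall P u -> mean P u = mean P (p u) - mean P (p (fun w => - u w)).
  move=> Lu; rewrite -meanB; try exact/Lall_integrable/Lp; last exact/Lall_integrable/Lp/LallN.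
  by apply: eq_mean => w; exact: pE.
rewrite (mE _ Lf) (mE _ Lg) mulrBl !mulrBr.
have [df1 df2] := (dp _ _ df, dp _ _ (dN _ _ df)).
have [dg1 dg2] := (dp _ _ dg, dp _ _ (dN _ _ dg)).
rewrite -!pos//.
rewrite -meanB; try exact/Lall_integrable/LallM.
rewrite -meanB; try exact/Lall_integrable/LallM.
rewrite -meanB; try by apply: Lall_integrable; apply: LallB; exact: LallM.
apply: eq_mean => w; rewrite {1}(pE f) {1}(pE g); ring.
Qed.

End independence.

(** * Moments of sums of centred independent variables *)

Section moment_bound.
Context (R : realType).

(** In the binomial expansion of [(S_n + X_n)^m] the term linear in [X_n] vanishes by centring.
    Every remaining correction carries a power of [S_n] at most [m - 2], so one increment costs a
    multiple of [n^(m/2 - 1)], and these add up to [n^(m/2)]. The constant precedes the probability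
    space, and only the factorisation between a partial sum and the next variable is asked for. *)
Lemma monte_carlo_moments (c : nat -> R) (m : nat) : exists2 C : R, 0 <= C &
  forall d (Omega : measurableType d) (P : probability Omega R) (N : nat)
    (X : nat -> Omega -> R),
  let S n w := \sum_(i < n) X i w in
  (forall i, Lall P (X i)) -> (forall i, (i < N)%N -> mean P (X i) = 0) ->
  (forall i k, (i < N)%N -> `|mean P (fun w => X i w ^+ k)| <= c k) ->
  (forall n a b, (n < N)%N -> mean P (fun w => S n w ^+ a * X n w ^+ b) =
     mean P (fun w => S n w ^+ a) * mean P (fun w => X n w ^+ b)) ->
  forall n, (n <= N)%N -> `|mean P (fun w => S n w ^+ m)| <= C * n%:R ^+ m./2.
Proof.
elim/ltn_ind: m => m ih.
have [C hC] : exists C : nat -> R, forall k, (k < m)%N -> 0 <= C k /\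
  forall d (Omega : measurableType d) (P : probability Omega R) (N : nat)
    (X : nat -> Omega -> R),
  let S n w := \sum_(i < n) X i w in
  (forall i, Lall P (X i)) -> (forall i, (i < N)%N -> mean P (X i) = 0) ->
  (forall i k, (i < N)%N -> `|mean P (fun w => X i w ^+ k)| <= c k) ->
  (forall n a b, (n < N)%N -> mean P (fun w => S n w ^+ a * X n w ^+ b) =
     mean P (fun w => S n w ^+ a) * mean P (fun w => X n w ^+ b)) ->
  forall n, (n <= N)%N -> `|mean P (fun w => S n w ^+ k)| <= C k * n%:R ^+ k./2.
  have /choice[C hC] : forall k, exists C : R, (k < m)%N -> 0 <= C /\
    forall d (Omega : measurableType d) (P : probability Omega R) (N : nat)
      (X : nat -> Omega -> R),
    let S n w := \sum_(i < n) X i w in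
    (forall i, Lall P (X i)) -> (forall i, (i < N)%N -> mean P (X i) = 0) ->
    (forall i k, (i < N)%N -> `|mean P (fun w => X i w ^+ k)| <= c k) ->
    (forall n a b, (n < N)%N -> mean P (fun w => S n w ^+ a * X n w ^+ b) =
       mean P (fun w => S n w ^+ a) * mean P (fun w => X n w ^+ b)) ->
    forall n, (n <= N)%N -> `|mean P (fun w => S n w ^+ k)| <= C * n%:R ^+ k./2.
    move=> k; have [/ih[C C0 hC]|km] := ltnP k m; first by exists C.
    by exists 0.
  by exists C.
case: m ih hC => [_ _|[_ _|m ih hC]].
- exists 1 => // d Omega P N X S _ _ _ _ n _.
  by rewrite expr0 mulr1; under eq_mean do rewrite expr0; rewrite mean_cst normr1.
- exists 0 => // d Omega P N X S LX X0 _ _ n nN; rewrite mul0r.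
  under eq_mean do rewrite expr1; rewrite mean_sum; last by move=> i; exact: Lall_integrable.
  by rewrite big1 ?normr0// => i _; apply: X0; exact: leq_trans nN.
(* The exponent is now [m + 2]. Terms with at least two factors [X n] leave a power of [S n] at most
   [m], to which the outer induction applies; [D] collects their coefficients. *)
pose D := \sum_(i < m.+1) `|C (m - i)%N| * `|c i.+2| *+ 'C(m.+2, i.+2).
have D0 : 0 <= D.
  by apply: sumr_ge0 => i _; rewrite mulrn_wge0// mulr_ge0.
exists D => // d Omega P N X S LX X0 cX SX; elim => [_|n ihn nN].
  rewrite /S; under eq_mean do rewrite big_ord0 expr0n/=.
  by rewrite mean_cst normr0 mulr_ge0// exprn_ge0.
have LS k : Lall P (S k) by apply: Lall_sum.
have -> : mean P (fun w => S n.+1 w ^+ m.+2) =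
    \sum_(i < m.+3) (mean P (fun w => S n w ^+ (m.+2 - i)) * mean P (fun w => X n w ^+ i))
       *+ 'C(m.+2, i).
  transitivity (mean P (fun w => \sum_(i < m.+3)
      ('C(m.+2, i))%:R * (S n w ^+ (m.+2 - i) * X n w ^+ i))).
    apply: eq_mean => w; rewrite /S big_ord_recr/= exprDn; apply: eq_bigr => i _.
    by rewrite mulr_natl.
  have LM i : Lall P (fun w => S n w ^+ (m.+2 - i) * X n w ^+ i).
    by apply: LallM; exact: LallX.
  rewrite mean_sum => [|i]; last exact/Lall_integrable/LallZ.
  apply: eq_bigr => i _; rewrite meanZ; last exact: Lall_integrable.
  by rewrite mulr_natl SX.
rewrite big_ord_recl big_ord_recl/= /bump/= !add1n subn0 bin0 mulr1n.
rewrite (_ : mean P (fun w => X n w ^+ 1) = 0) ?mulr0 ?mul0rn ?add0r; last first.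
  by under eq_mean do rewrite expr1; exact: X0.
rewrite (_ : mean P (fun w => X n w ^+ 0) = 1) ?mulr1; last first.
  by under eq_mean do rewrite expr0; exact: mean_cst.
have n0 : 0 <= n%:R :> R by [].
apply: le_trans (ler_normD _ _) _.
apply: (@le_trans _ _ (D * n%:R ^+ m./2.+1 + D * n.+1%:R ^+ m./2)).
  apply: lerD; first exact: ihn (ltnW nN).
  apply: le_trans (ler_norm_sum _ _ _) _.
  rewrite /D mulr_suml; apply: ler_sum => i _; rewrite /bump/= !add1n.
  rewrite normrMn mulrnAl lerMn2r; apply/orP; right.
  rewrite normrM !subSS.
  rewrite -mulrA [`|c _| * _]mulrC mulrA; apply: ler_pM => //; last first.
    by apply: le_trans (cX _ _ nN) _; exact: ler_norm.
  have [Ck0 /(_ _ _ P N X LX X0 cX SX n (ltnW nN)) h] := hC (m - i)%N (leq_ltn_trans (leq_subr _ _) (ltnW (ltnSn m.+1))).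
  apply: le_trans h _; rewrite ger0_norm// ler_wpM2l//.
  apply: (@le_trans _ _ (n.+1%:R ^+ (m - i)./2)); first by rewrite lerX// ler_nat.
  by rewrite ler_weXn2l ?half_leq ?leq_subr// ler1n.
(* With [h = m./2], the step closes by [n^(h+1) + (n+1)^h <= (n+1)^(h+1)]. *)
rewrite -mulrDr ler_wpM2l//= [leRHS]exprS -natr1 mulrDl mul1r lerD2r exprS.
by rewrite ler_wpM2l// lerX// natr1 ler_nat.
Qed.

End moment_bound.

(** * Uniform moment bounds *)

Section tame.
Context (R : realType).

(* Domination by a measurable function makes the notion insensitive to the
   measurability of [X] itself. *)
Definition tame d (T : measurableType d) (P : probability T R) (C : nat -> R)
    (X : T -> R) := exists Y, [/\ measurable_fun setT Y,
  forall w, `|X w| <= Y w & forall k, (\int[P]_w (Y w ^+ k)%:E <= (C k)%:E)%E].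

Definition tameD_cst (C C' : nat -> R) k := 2 ^+ k * (C k + C' k).
Definition tameM_cst (C C' : nat -> R) k := C (k * 2)%N + C' (k * 2)%N.
Context d (T : measurableType d) (P : probability T R).
Implicit Types (X Y : T -> R) (C : nat -> R).

Let mX Y k : measurable_fun setT Y -> measurable_fun setT (fun w => (Y w ^+ k)%:E).
Proof. by move=> mY; apply/measurable_EFinP; exact: measurable_funX. Qed.

Lemma tame_le C X X' : tame P C X' -> (forall w, `|X w| <= `|X' w|) -> tame P C X.
Proof.
by move=> [Y [mY XY h]] XX'; exists Y; split => // w; exact: le_trans (XX' w) _.
Qed.

Lemma tame_norm C X : tame P C X -> tame P C (fun w => `|X w|).
Proof. by move=> h; apply: tame_le h _ => w; rewrite normr_id. Qed.

Lemma tame_cst (a b : R) : `|a| <= b -> tame P (fun k => b ^+ k) (cst a).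
Proof.
move=> ab; exists (cst b); split => // k; rewrite -[leLHS]/(\int[P]_x (cst (b ^+ k)%:E x))%E.
by rewrite integral_cst// [X in (_ * X)%E]probability_setT mule1.
Qed.

Lemma tameD C C' X X' : tame P C X -> tame P C' X' ->
  tame P (tameD_cst C C') (fun w => X w + X' w).
Proof.
move=> [Y [mY XY h]] [Y' [mY' XY' h']].
have Y0 w : 0 <= Y w by exact: le_trans (XY w).
have Y'0 w : 0 <= Y' w by exact: le_trans (XY' w).
exists (fun w => Y w + Y' w); split; first exact: measurable_funD.
  by move=> w; apply: le_trans (ler_normD _ _) _; exact: lerD.
move=> k; apply: (@le_trans _ _
  (\int[P]_w ((2 ^+ k)%:E * ((Y w ^+ k)%:E + (Y' w ^+ k)%:E))))%E.
  apply: le_integral_ge0 => w; first by rewrite lee_fin exprn_ge0// addr_ge0.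
  by rewrite -EFinD -EFinM lee_fin exprD_le.
rewrite ge0_integralZl//; last 2 first.
- by apply: emeasurable_funD; exact: mX.
- by move=> w _; rewrite -EFinD lee_fin addr_ge0// exprn_ge0.
rewrite /tameD_cst EFinM; apply: lee_wpmul2l; first by rewrite lee_fin exprn_ge0.
rewrite ge0_integralD//; try exact: mX; try by move=> w _; rewrite lee_fin exprn_ge0.
by rewrite EFinD; exact: leeD.
Qed.

Lemma tameM C C' X X' : tame P C X -> tame P C' X' ->
  tame P (tameM_cst C C') (fun w => X w * X' w).
Proof.
move=> [Y [mY XY h]] [Y' [mY' XY' h']].
have Y0 w : 0 <= Y w by exact: le_trans (XY w).
have Y'0 w : 0 <= Y' w by exact: le_trans (XY' w).
exists (fun w => Y w * Y' w); split; first exact: measurable_funM.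
  by move=> w; rewrite normrM ler_pM.
move=> k; apply: (@le_trans _ _
  (\int[P]_w ((Y w ^+ (k * 2))%:E + (Y' w ^+ (k * 2))%:E)))%E.
  apply: le_integral_ge0 => w; first by rewrite lee_fin exprn_ge0// mulr_ge0.
  rewrite -EFinD lee_fin !exprM exprMn; apply: le_trans (ler_sqr_sum _ _).
  exact: ler_norm.
rewrite ge0_integralD//; try exact: mX; try by move=> w _; rewrite lee_fin exprn_ge0.
by rewrite EFinD; exact: leeD.
Qed.

(** Jensen's inequality for powers: the tangent inequality at the mean is summed, and its linear
    terms cancel. *)
Lemma exprn_mean_le (n k : nat) (x : 'I_n -> R) : (0 < n)%N -> (forall i, 0 <= x i) ->
  (n%:R^-1 * \sum_i x i) ^+ k <= n%:R^-1 * \sum_i x i ^+ k.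
Proof.
move=> n0 x0; set a := _ * _; have n1 : 0 < n%:R :> R by rewrite ltr0n.
have a0 : 0 <= a by rewrite mulr_ge0 ?invr_ge0 ?sumr_ge0// ltW.
case: k => [|k].
  rewrite expr0; under eq_bigr do rewrite expr0.
  by rewrite sumr_const card_ord -[_ *+ n]mulr_natl mulr1 mulVf// gt_eqF.
have tangent (b c : R) : 0 <= b -> 0 <= c ->
    c ^+ k.+1 + k.+1%:R * c ^+ k * (b - c) <= b ^+ k.+1.
  move=> b0 c0; elim: k => [|k ih]; first by rewrite expr0 !expr1; lra.
  apply: (@le_trans _ _ (b * (c ^+ k.+1 + k.+1%:R * c ^+ k * (b - c)))); last first.
    by rewrite [leRHS]exprS ler_wpM2l.
  rewrite -subr_ge0.
  have -> : b * (c ^+ k.+1 + k.+1%:R * c ^+ k * (b - c)) -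
      (c ^+ k.+2 + k.+2%:R * c ^+ k.+1 * (b - c)) = k.+1%:R * c ^+ k * (b - c) ^+ 2.
    by rewrite !exprS expr0 -[k.+2%:R]natr1; ring.
  by rewrite mulr_ge0 ?sqr_ge0// mulr_ge0 ?exprn_ge0.
have : \sum_(i < n) (a ^+ k.+1 + k.+1%:R * a ^+ k * (x i - a)) <= \sum_i x i ^+ k.+1.
  by apply: ler_sum => i _; exact: tangent.
rewrite big_split/= sumr_const card_ord -mulr_sumr sumrB sumr_const card_ord.
have -> : \sum_i x i = a *+ n by rewrite /a -mulr_natl mulVKf// gt_eqF.
rewrite subrr mulr0 addr0 => h.
by rewrite mulrC ler_pdivlMr// mulr_natr.
Qed.

(** By Jensen the very same bounds [C] survive averaging; iterating [tameD] would lose a factor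
    growing with [N]. *)
Lemma tame_avg C N (X : 'I_N -> T -> R) : (0 < N)%N -> (forall i, tame P C (X i)) ->
  tame P C (fun w => N%:R^-1 * \sum_i X i w).
Proof.
move=> N0 /choice[Y hY].
have mY i : measurable_fun setT (Y i) by have [] := hY i.
have XY i w : `|X i w| <= Y i w by have [_ h _] := hY i; exact: h.
have hC i k : (\int[P]_w (Y i w ^+ k)%:E <= (C k)%:E)%E by have [_ _ h] := hY i; exact: h.
have Y0 i w : 0 <= Y i w by exact: le_trans (XY i w).
have n1 : 0 < N%:R :> R by rewrite ltr0n.
exists (fun w => N%:R^-1 * \sum_i Y i w); split.
- by apply: measurable_funM => //; exact: measurable_sum.
- move=> w; rewrite normrM ger0_norm ?invr_ge0 ?(ltW n1)// ler_wpM2l ?invr_ge0 ?(ltW n1)//.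
  by apply: le_trans (ler_norm_sum _ _ _) _; exact: ler_sum.
move=> k; apply: (@le_trans _ _ (\int[P]_w (N%:R^-1%:E * \sum_i (Y i w ^+ k)%:E)))%E.
  apply: le_integral_ge0 => w.
    by rewrite lee_fin exprn_ge0// mulr_ge0 ?invr_ge0 ?(ltW n1)// sumr_ge0.
  by rewrite sumEFin -EFinM lee_fin; exact: exprn_mean_le.
rewrite ge0_integralZl//; last 2 first.
- by apply: emeasurable_sum => i; exact: mX.
- by move=> w _; apply: sume_ge0 => i _; rewrite lee_fin exprn_ge0.
rewrite ge0_integral_sum//; last 2 first.
- by move=> i; exact: mX.
- by move=> i w _; rewrite lee_fin exprn_ge0.
apply: (@le_trans _ _ (N%:R^-1%:E * \sum_(i < N) (C k)%:E)%E).
  by apply: lee_wpmul2l; [rewrite lee_fin invr_ge0 ltW|apply: lee_sum].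
by rewrite sumEFin -EFinM lee_fin sumr_const card_ord -[C k *+ N]mulr_natl mulKf// gt_eqF.
Qed.

Lemma tame_Lall C X : measurable_fun setT X -> tame P C X -> Lall P X.
Proof.
move=> mX' [Y [mY XY h]]; split => // k; apply: le_lt_trans (ltry (C k)).
apply: le_trans (h k); apply: le_integral_ge0 => w.
  by rewrite lee_fin exprn_ge0.
by rewrite lee_fin; exact: lerX.
Qed.

Lemma tame_mean_le C X k : measurable_fun setT X -> tame P C X ->
  `|mean P (fun w => X w ^+ k)| <= C k.
Proof.
move=> mX' [Y [mY XY h]].
have Y0 w : 0 <= Y w by exact: le_trans (XY w).
have iY : P.-integrable setT (EFin \o (fun w => Y w ^+ k)).
  apply/integrableP; split; first exact: mX.
  under eq_integral do rewrite /= ger0_norm ?exprn_ge0//.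
  by apply: le_lt_trans (h k) _; exact: ltry.
apply: (@le_trans _ _ (mean P (fun w => Y w ^+ k))).
  apply: ler_norm_mean => //; first exact: measurable_funX.
  by move=> w; rewrite normrX lerX.
by rewrite -lee_fin -EFin_mean.
Qed.

End tame.

Section tame_monte_carlo.
Context (R : realType).

Lemma tame_monte_carlo (C : nat -> R) : exists C' : nat -> R,
  forall d (T : measurableType d) (P : probability T R) (N : nat)
    (X : nat -> T -> R),
  (0 < N)%N ->
  (forall i, measurable_fun setT (X i)) -> (forall i, tame P C (X i)) ->
  (forall i, (i < N)%N -> mean P (X i) = 0) ->
  (forall n a b, (n < N)%N ->
     mean P (fun w => (\sum_(i < n) X i w) ^+ a * X n w ^+ b) =
     mean P (fun w => (\sum_(i < n) X i w) ^+ a) * mean P (fun w => X n w ^+ b)) ->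
  tame P C' (fun w => Num.sqrt N%:R * (N%:R^-1 * \sum_(i < N) X i w)).
Proof.
pose D m := s2val (cid2 (monte_carlo_moments C m)).
(* Moments of order [k], odd or even, are controlled by [|Z|^k <= 1 + Z^(2k)]. The even moment of
   the sum is at most [D (2k) N^k], which cancels the normalisation [(sqrt N / N)^(2k) = N^-k]. *)
exists (fun k => 1 + D (k * 2)%N) => d T P N X N0 mX tX X0 SX.
have LX i : Lall P (X i) by exact: tame_Lall.
have := s2valP' (cid2 (monte_carlo_moments C _)).
move=> /(_ _ _ _ P N X LX X0 (fun i k _ => tame_mean_le k (mX i) (tX i)) SX N (leqnn N)) hD.
have n1 : 0 < N%:R :> R by rewrite ltr0n.
pose Z w := Num.sqrt N%:R * (N%:R^-1 * \sum_(i < N) X i w).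
have LZ : Lall P Z by apply: LallZ; apply: LallZ; apply: Lall_sum.
exists (fun w => `|Z w|); split => //; first exact: Lall_meas (Lall_norm LZ).
move=> k; apply: (@le_trans _ _ (\int[P]_w (1 + Z w ^+ (k * 2))%:E)%E).
  apply: le_integral_ge0 => w; first by rewrite lee_fin exprn_ge0.
  rewrite lee_fin exprM -[Z w ^+ k ^+ 2]real_normK ?num_real// normrX.
  by move: (`|Z w| ^+ k) => z; nra.
have L1 : Lall P (fun=> 1) by exact: Lall_cst.
rewrite EFin_mean; last by apply: Lall_integrable; apply: LallD => //; exact: LallX.
rewrite lee_fin meanD; try exact: Lall_integrable; last exact/Lall_integrable/LallX.
rewrite mean_cst lerD2l.
have -> : mean P (fun w => Z w ^+ (k * 2)) =
    (N%:R ^+ k)^-1 * mean P (fun w => (\sum_(i < N) X i w) ^+ (k * 2)).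
  rewrite -meanZ; last by apply: Lall_integrable; apply: LallX; exact: Lall_sum.
  apply: eq_mean => w; rewrite /Z mulnC !exprM; set S := \sum_(_ < _) _.
  rewrite -exprVn -exprMn; congr (_ ^+ _).
  rewrite exprMn sqr_sqrtr ?(ltW n1)//.
  by field; rewrite gt_eqF.
rewrite mulrC ler_pdivrMr ?exprn_gt0//.
apply: le_trans (ler_norm _) _.
have -> : N%:R ^+ k = N%:R ^+ (k * 2)./2 :> R by rewrite muln2 doubleK.
exact: hD.
Qed.

End tame_monte_carlo.

(** * Prediction and conditioning of Gaussian laws *)

Section sections_measurable.
Context d1 d2 d3 (T1 : measurableType d1) (T2 : measurableType d2)
  (T3 : measurableType d3) (f : T1 * T2 -> T3).
Hypothesis mf : measurable_fun setT f.

Lemma measurable_fun_xsection x : measurable_fun setT (fun y => f (x, y)).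
Proof. by apply: (measurableT_comp mf); exact: measurable_fun_pair. Qed.

Lemma measurable_fun_ysection y : measurable_fun setT (fun x => f (x, y)).
Proof. by apply: (measurableT_comp mf); exact: measurable_fun_pair. Qed.

End sections_measurable.

Section noise.
Context (R : realType).

Lemma lebesgue_cV_setT n : lebesgue_cV R n.+1 setT = +oo%E.
Proof.
have leb : @lebesgue_measure R setT = +oo%E.
  by rewrite -set_itvE lebesgue_measure_itv.
have E k : lebesgue_cV R k.+1 setT = (lebesgue_measure (setT : set R) * lebesgue_cV R k setT)%E.
  rewrite -[LHS]/((@lebesgue_measure R \x lebesgue_cV R k) (@cV_cons R k @^-1` setT))%E.
  by rewrite preimage_setT -setXTT product_measure1E.
elim: n => [|n ih]; rewrite E leb; last by rewrite ih mulyy.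
by rewrite /= diracT mule1.
Qed.

Lemma integral_const_cV n c : (\int[lebesgue_cV R n.+1]_x (cst c%:E x))%E = 1%E -> False.
Proof.
move=> e; have {e} : (c%:E * lebesgue_cV R n.+1 setT = 1)%E.
  by rewrite -e; apply/esym; exact: integral_cst.
rewrite lebesgue_cV_setT mulry; case: sgrP => _.
- by rewrite mul0e => /eqP; rewrite eq_sym onee_eq0.
- by rewrite mul1e.
- by rewrite EFinN mulN1e.
Qed.

(* A degenerate covariance matrix for which the square root would not exist
   makes [normal0] infinite or zero, so it cannot be a probability. *)
Lemma normal0_gaussian n (S : 'M[R]_n.+1) (mu : probability 'cV[R]_n.+1 R) :
  spd S -> (forall A, measurable A -> mu A = normal0 S A) ->
  [/\ gaussian_law mu (gauss_cst S)^-1 0 (invmx S), 0 < (gauss_cst S)^-1 &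
      forall x, gauss_exp S x = gker (invmx S) x].
Proof.
move=> sS muS.
have mass : (\int[lebesgue_cV R n.+1]_x ((gauss_cst S)^-1 * gauss_exp S x)%:E = 1)%E.
  by have := @probability_setT _ _ _ mu; rewrite (muS _ measurableT).
have [B [sB BB]] : exists B : 'M[R]_n.+1, spd B /\ B *m B = S.
  apply: contrapT => nB.
  have s0 : spd_sqrt S = 0.
    by apply: xgetPN => B [sB BB]; apply: nB; exists B.
  (* With the default root [0], whose [invmx] is again [0] in positive dimension, the density would
     be constant and its mass zero or infinite. *)
  apply: (@integral_const_cV n (gauss_cst S)^-1); rewrite -[RHS]mass.
  apply: eq_integral => x _; rewrite /gauss_exp /wnorm s0.
  have -> : invmx (0 : 'M[R]_n.+1) = 0.
    by apply: invmx_out; rewrite inE -[_ \in _]/(_ \is a GRing.unit) unitr0.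
  by rewrite mul0mx /enorm big1 ?sqrtr0 ?expr0n/= ?mulr0 ?oppr0 ?expR0 ?mulr1// => i _; rewrite mxE expr0n.
have [sR RR] : [set B | spd B /\ B *m B = S] (spd_sqrt S).
  by apply: (@xgetPex _ 0 [set B | spd B /\ B *m B = S]); exists B.
have gE x : gauss_exp S x = gker (invmx S) x.
  rewrite /gauss_exp /gker; congr (expR (- (_ * _))).
  have uS := spd_unit sS; have uR := spd_unit sR.
  rewrite /wnorm -[LHS]mul1r -qf_scalar -qf_conj mulmx1 trmx_inv sR.1.
  congr (qf _ x); rewrite -[LHS]mul1mx -(mulVmx uS) -{2}RR -!mulmxA.
  by rewrite mulKVmx// mulmxV// mulmx1.
have c0 : 0 < (gauss_cst S)^-1.
  have cge : 0 <= (gauss_cst S)^-1 by rewrite invr_ge0 sqrtr_ge0.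
  rewrite lt_neqAle cge andbT; apply/eqP => c0; move: mass; rewrite -c0.
  under eq_integral do rewrite mul0r.
  by rewrite integral0 => /eqP; rewrite eq_sym onee_eq0.
split => //; split; first exact: ltW.
move=> A mA; apply: etrans (muS A mA) _.
by apply: eq_integral => x _; rewrite gE subr0.
Qed.

End noise.

Section one_step.
Context (R : realType) (n m : nat).
Implicit Types (P : 'M[R]_n) (G : 'M[R]_m) (H : 'M[R]_(m, n)).

(** Infinite [x] is allowed: [a * x] is then infinite or zero, and [fine] sends both to zero. *)
Lemma fineZ (a : R) (x : \bar R) : fine (a%:E * x) = a * fine x.
Proof.
case: x => [r//| |] /=; rewrite mulr0.
  by rewrite mulry; case: (ltrgt0P a) => [/gtr0_sg|/ltr0_sg|->] => [->|->|];
    rewrite ?sgr0 ?mul0e ?mul1e ?EFinN ?mulN1e.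
by rewrite mulrNy; case: (ltrgt0P a) => [/gtr0_sg|/ltr0_sg|->] => [->|->|];
  rewrite ?sgr0 ?mul0e ?mul1e ?EFinN ?mulN1e.
Qed.

Lemma integral_shifted_noise d (T : measurableType d) (mu : probability T R)
    (N : set 'cV[R]_n -> \bar R) (g : 'cV[R]_n -> R) (Psi : T -> 'cV[R]_n)
    (f : 'cV[R]_n -> \bar R) :
  (forall x, 0 <= g x) -> measurable_fun setT g ->
  (forall A, measurable A -> N A = of_density g A) ->
  measurable_fun setT Psi -> measurable_fun setT f -> (forall x, 0 <= f x)%E ->
  (\int[mu]_v \int[N]_x f (Psi v + x)%R =
   \int[lebesgue_cV R n]_u (f u * \int[mu]_v (g (u - Psi v))%:E))%E.
Proof.
move=> g0 mg NE mPsi mf f0.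
have mh : measurable_fun setT (fun z : T * 'cV[R]_n => f z.2 * (g (z.2 - Psi z.1))%:E)%E.
  apply: emeasurable_funM; first exact: measurableT_comp.
  apply/measurable_EFinP; apply: measurableT_comp => //.
  by apply: measurable_cV_sub => //; exact: measurableT_comp.
transitivity (\int[mu]_v \int[lebesgue_cV R n]_u (f u * (g (u - Psi v)%R)%:E))%E.
  apply: eq_integral => v _; rewrite (eq_integral_measurable _ NE).
  have mfv : measurable_fun setT (fun x => f (Psi v + x)).
    by apply: measurableT_comp => //; exact: measurable_cV_add.
  rewrite ge0_integral_dens//.
  rewrite -[RHS](ge0_integral_shift (Psi v)).
  - by apply: eq_integral => x _; rewrite addrK addrC.
  - apply: emeasurable_funM => //; apply/measurable_EFinP; apply: measurableT_comp => //.
    exact: measurable_cV_sub.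
  - by move=> x; rewrite mule_ge0// lee_fin.
rewrite (fubini_tonelli (fun z => f z.2 * (g (z.2 - Psi z.1))%:E)%E)//; last first.
  by move=> z; rewrite mule_ge0// lee_fin.
apply: eq_integral => u _ /=; rewrite ge0_integralZl//.
- apply/measurable_EFinP; apply: measurableT_comp => //.
  by apply: measurable_cV_sub.
- by move=> v _; rewrite lee_fin.
Qed.

(* Completing the square inside the convolution: the mixing variable only
   occurs through a translate, which Lebesgue measure does not see. *)
Lemma gaussian_convolution (P : 'M[R]_m) (N : probability 'cV[R]_m R) (c : R)
    (S : 'M[R]_n) (A : 'M[R]_(n, m)) :
  spd P -> spd S -> gaussian_law N c 0 P ->
  forall u, mean N (fun x => gker (invmx S) (u - A *m x)) =
    c * fine (\int[lebesgue_cV R m]_x (gker (P + A^T *m invmx S *m A) x)%:E) *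
    gker (invmx (S + A *m invmx P *m A^T)) u.
Proof.
move=> sP sS gN u; set S' := S + _; set M := P + _.
pose K := invmx P *m A^T *m invmx S'.
rewrite /mean (gaussian_integral gN); last 2 first.
- apply/measurable_EFinP; apply: measurable_gker.
  by apply: measurable_cV_sub => //; exact: measurable_cV_mulmx.
- by move=> x; rewrite lee_fin gker_ge0.
rewrite mulrAC -fineZ; congr fine.
rewrite -[X in _ = (_ * X)%E](ge0_integral_shift (- (K *m u))); last 2 first.
- by apply/measurable_EFinP; exact: measurable_gker.
- by move=> x; rewrite lee_fin gker_ge0.
rewrite -ge0_integralZl//; last 3 first.
- apply/measurable_EFinP; apply: measurable_gker; exact: measurable_cV_add.
- by move=> x _; rewrite lee_fin gker_ge0.
- by rewrite lee_fin mulr_ge0 ?gker_ge0//; exact: gN.1.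
apply: eq_integral => x _; rewrite -!EFinM; congr EFin.
rewrite subr0 mulrCA -mulrA; congr (_ * _).
rewrite /gker -!expRD; congr expR.
have := complete_square A sP sS x u; rewrite -/S' -/M -/K => e.
rewrite -!opprD -!mulrDr [X in - (_ * X)]addrC e; congr (- (_ * _)).
by rewrite addrC.
Qed.

End one_step.

Section update.
Context (R : realType) (n m : nat).
Variables (P : 'M[R]_n) (G : 'M[R]_m) (H : 'M[R]_(m, n)) (a : 'cV[R]_n) (y : 'cV[R]_m).
Hypotheses (sP : spd P) (sG : spd G).
Let M := P + H^T *m invmx G *m H.
Let S := G + H *m invmx P *m H^T.
Let K := invmx P *m H^T *m invmx S.

(** At [y' = y] this is Bayes' factorisation. For general [y'] it says that the update
    [u + K (y - y')] carries the joint density of state and synthetic observation to the evidence of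
    [y'] times the posterior given the true datum [y], a factor free of [y']. This is why perturbed
    observations give an exact update. *)
Lemma bayes_factor (w : 'cV[R]_n) (y' : 'cV[R]_m) :
  gker P (w - K *m (y - y') - a) * gker (invmx G) (y' - H *m (w - K *m (y - y'))) =
  gker M (w - (a + K *m (y - H *m a))) * gker (invmx S) (y' - H *m a).
Proof.
rewrite /gker -!expRD; congr expR; rewrite -!opprD -!mulrDr; congr (- (_ * _)).
have := complete_square H sP sG (w - K *m (y - y') - a) (y' - H *m a).
rewrite -/M -/S -/K => e.
have e1 : y' - H *m a - H *m (w - K *m (y - y') - a) = y' - H *m (w - K *m (y - y')).
  by rewrite mulmxBr opprB addrA subrK.
have e2 : w - K *m (y - y') - a - K *m (y' - H *m a) = w - (a + K *m (y - H *m a)).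
  have -> : K *m (y - H *m a) = K *m (y - y') + K *m (y' - H *m a).
    by rewrite -mulmxDr addrA subrK.
  by rewrite !opprD !addrA [w - _ - a]addrAC.
by rewrite -e1 e e2.
Qed.

(** For fixed [y'] the state is translated by [- K (y - y')]; after that [bayes_factor] splits the
    double integral into a product. *)
Lemma kalman_update (mu : probability 'cV[R]_n R) (N : probability 'cV[R]_m R) (c c' : R)
   (f : 'cV[R]_n -> \bar R) :
  gaussian_law mu c a P -> gaussian_law N c' 0 (invmx G) ->
  measurable_fun setT f -> (forall x, 0 <= f x)%E ->
  (\int[mu]_u \int[N]_e f (u + K *m (y - (H *m u + e)))%R =
   \int[lebesgue_cV R m]_y' (c' * gker (invmx S) (y' - H *m a))%:E *
   \int[lebesgue_cV R n]_w (f w * (c * gker M (w - (a + K *m (y - H *m a))))%:E))%E.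
Proof.
move=> gmu gN mf f0.
have c0 := gmu.1; have c'0 := gN.1.
pose h (z : 'cV[R]_n * 'cV[R]_m) : \bar R :=
  (f (z.1 + K *m (y - z.2))%R * (c' * gker (invmx G) (z.2 - H *m z.1))%:E *
   (c * gker P (z.1 - a))%:E)%E.
have mlin : measurable_fun setT (fun z : 'cV[R]_n * 'cV[R]_m => z.2 - H *m z.1).
  by apply: measurable_cV_sub => //; exact: measurable_cV_mulmx.
have mK : measurable_fun setT (fun z : 'cV[R]_n * 'cV[R]_m => K *m (y - z.2)).
  by apply: measurable_cV_mulmx; exact: measurable_cV_sub.
have mh1 : measurable_fun setT (fun z : 'cV[R]_n * 'cV[R]_m =>
    (f (z.1 + K *m (y - z.2))%R * (c' * gker (invmx G) (z.2 - H *m z.1))%:E)%E).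
  apply: emeasurable_funM.
    by apply: measurableT_comp => //; exact: measurable_cV_add.
  by apply/measurable_EFinP; apply: measurable_funM => //; exact: measurable_gker.
have mh : measurable_fun setT h.
  apply: emeasurable_funM => //; apply/measurable_EFinP; apply: measurable_funM => //.
  by apply: measurable_gker; exact: measurable_cV_sub.
have h10 z : (0 <= f (z.1 + K *m (y - z.2))%R * (c' * gker (invmx G) (z.2 - H *m z.1))%:E)%E.
  by rewrite mule_ge0// lee_fin mulr_ge0 ?gker_ge0.
have h0 z : (0 <= h z)%E by rewrite mule_ge0// lee_fin mulr_ge0 ?gker_ge0.
have fibre u : (\int[N]_e f (u + K *m (y - (H *m u + e)))%R =
    \int[lebesgue_cV R m]_y'
      (f (u + K *m (y - y'))%R * (c' * gker (invmx G) (y' - H *m u))%:E))%E.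
  rewrite (gaussian_integral gN) => [||e]; last exact: f0.
    rewrite -[RHS](ge0_integral_shift (H *m u)).
    - by apply: eq_integral => e _; rewrite subr0 [e + _]addrC addrAC subrr add0r.
    - exact: (measurable_fun_xsection mh1 u).
    - by move=> e; exact: (h10 (u, e)).
  apply: measurableT_comp => //; apply: measurable_cV_add => //.
  apply: measurable_cV_mulmx; apply: measurable_cV_sub => //; exact: measurable_cV_add.
under eq_integral do rewrite fibre.
rewrite (gaussian_integral gmu); last 2 first.
- exact: (measurable_fun_fubini_tonelli_F _ mh1 h10).
- by move=> u; apply: integral_ge0 => y' _; exact: (h10 (u, y')).
transitivity (\int[lebesgue_cV R n]_u \int[lebesgue_cV R m]_y' h (u, y'))%E.
  apply: eq_integral => u _; rewrite -ge0_integralZr//.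
  - exact: (measurable_fun_xsection mh1 u).
  - by move=> e _; exact: (h10 (u, e)).
  - by rewrite lee_fin mulr_ge0 ?gker_ge0.
rewrite (fubini_tonelli h)//.
transitivity (\int[lebesgue_cV R m]_y' ((c' * gker (invmx S) (y' - H *m a))%:E *
   \int[lebesgue_cV R n]_w (f w * (c * gker M (w - (a + K *m (y - H *m a))))%:E)))%E.
  apply: eq_integral => y' _.
  rewrite -[LHS](ge0_integral_shift (- (K *m (y - y')))); last 2 first.
  - exact: (measurable_fun_ysection mh y').
  - by move=> u; exact: h0.
  rewrite -ge0_integralZl; [|exact: measurableT| | |]; last 3 first.
  - apply: emeasurable_funM => //; apply/measurable_EFinP; apply: measurable_funM => //.
    by apply: measurable_gker; exact: measurable_cV_sub.
  - by move=> w _; rewrite mule_ge0// lee_fin mulr_ge0 ?gker_ge0.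
  - by rewrite lee_fin mulr_ge0 ?gker_ge0.
  apply: eq_integral => w _; rewrite /h/= subrK muleCA -muleA -!EFinM; congr (_ * _%:E)%E.
  have := bayes_factor w y'; set g1 := gker P _; set g2 := gker (invmx G) _.
  set g3 := gker M _; set g4 := gker (invmx S) _ => e.
  transitivity (c' * c * (g1 * g2)); first by ring.
  by rewrite e; ring.
rewrite ge0_integralZr//.
- apply/measurable_EFinP; apply: measurable_funM => //.
  by apply: measurable_gker; exact: measurable_cV_sub.
- by move=> y' _; rewrite lee_fin mulr_ge0 ?gker_ge0.
- by apply: integral_ge0 => w _; rewrite mule_ge0// lee_fin mulr_ge0 ?gker_ge0.
Qed.

End update.

Section probabilities.
Context (R : realType).

Lemma mule_eq1 (x z : \bar R) : (0 <= x)%E -> (0 <= z)%E -> (x * z = 1)%E ->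
  exists2 r, 0 < r & x = (r^-1)%:E /\ z = r%:E.
Proof.
case: x z => [x| |] [z| |]// => [x0 z0 [xz1]|x0 _|_ z0].
- have zn : z != 0 by apply: contra_eq_neq xz1 => ->; rewrite mulr0 eq_sym oner_neq0.
  exists z; first by rewrite lt_neqAle eq_sym zn -lee_fin.
  by split => //; congr EFin; rewrite -[LHS](mulfK zn) xz1 div1r.
- move: x0; rewrite lee_fin le_eqVlt => /predU1P[<-|x0].
    by rewrite mul0e => /eqP; rewrite eq_sym onee_eq0.
  by rewrite gt0_muley.
- move: z0; rewrite lee_fin le_eqVlt => /predU1P[<-|z0].
    by rewrite mule0 => /eqP; rewrite eq_sym onee_eq0.
  by rewrite gt0_mulye.
Qed.

Lemma exists_probability d (T : measurableType d) (m : {measure set T -> \bar R}) :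
  m setT = 1%E -> exists P : probability T R, forall A, P A = m A.
Proof.
move=> m1; exists (mnormalize m (\d_(point : T))) => A.
by rewrite -[LHS]/(mnormalize m (\d_(point : T)) A) /mnormalize m1 onee_eq0/= invr1 mule1.
Qed.

Lemma integral_mkcond_indic d (T : measurableType d) (mu : {measure set T -> \bar R}) (p : T -> R) A :
  (\int[mu]_(x in A) (p x)%:E = \int[mu]_x ((\1_A x)%:E * (p x)%:E))%E.
Proof.
rewrite integral_mkcond; apply: eq_integral => x _.
by rewrite patchE indicE; case: ifPn => _; rewrite ?mul1e ?mul0e.
Qed.

Lemma law_of_integral d (T : measurableType d) (P : probability T R) n
    (X : T -> 'cV[R]_n) (p : 'cV[R]_n -> R) : measurable_fun setT X ->
  (forall f : 'cV[R]_n -> \bar R, measurable_fun setT f -> (forall x, 0 <= f x)%E ->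
     \int[P]_w f (X w) = \int[lebesgue_cV R n]_u (f u * (p u)%:E))%E ->
  forall A, measurable A -> P (X @^-1` A) = of_density p A.
Proof.
move=> mX h A mA; rewrite /of_density integral_mkcond_indic -h; last 2 first.
- by apply/measurable_EFinP; exact: measurable_indic.
- by move=> x; rewrite lee_fin.
rewrite -[LHS]/(P (X @^-1` A)) -(setIT (X @^-1` A)) -integral_indic//.
by rewrite -[X in measurable X]setTI; exact: mX.
Qed.

Definition is_noise n (S : 'M[R]_n) (N : probability 'cV[R]_n R) :=
  [/\ gaussian_law N (gauss_cst S)^-1 0 (invmx S), 0 < (gauss_cst S)^-1 &
      forall x, gauss_exp S x = gker (invmx S) x].

Lemma gker_le1 n (P : 'M[R]_n) x : psd P -> gker P x <= 1.
Proof.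
move=> [_ /(_ x) h]; rewrite /gker expR_le1 oppr_le0.
by rewrite mulr_ge0// invr_ge0.
Qed.

(** [opP] is defined through [fine]. Since the kernel is at most 1 the integral is finite, and the
    identity holds in the extended reals. *)
Lemma opP_integral n (S : 'M[R]_n) (N : probability 'cV[R]_n R) (Psi : 'cV[R]_n -> 'cV[R]_n)
    (mu : set 'cV[R]_n -> \bar R) d (T : measurableType d) (P : probability T R)
    (X : T -> 'cV[R]_n) :
  spd S -> is_noise S N -> measurable_fun setT X -> measurable_fun setT Psi ->
  (forall A, measurable A -> mu A = P (X @^-1` A)) ->
  forall u, (opP Psi S mu u)%:E =
    (\int[P]_w ((gauss_cst S)^-1 * gker (invmx S) (u - Psi (X w)))%:E)%E.
Proof.
move=> sS [gN c0 gE] mX mPsi muX u.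
have mk : measurable_fun setT (fun v => gker (invmx S) (u - Psi v)).
  by apply: measurable_gker; apply: measurable_cV_sub.
have e : (\int[mu]_v (gauss_exp S (u - Psi v))%:E)%E =
    (\int[P]_w (gker (invmx S) (u - Psi (X w)))%:E)%E.
  rewrite (@eq_integral_measurable _ _ _ mu (pushforward P X))//.
  rewrite ge0_integral_pushforward//.
  - by apply: eq_integral => w _; rewrite /= gE.
  - by apply/measurable_EFinP; under eq_fun do rewrite gE.
  - by move=> v _; rewrite lee_fin gE gker_ge0.
under eq_integral do rewrite EFinM.
rewrite ge0_integralZl//; last 3 first.
- by apply/measurable_EFinP; exact: (measurableT_comp mk mX).
- by move=> w _; rewrite lee_fin gker_ge0.
- by rewrite lee_fin ltW.
rewrite /opP EFinM; congr (_ * _)%E; rewrite /mean e fineK//.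
rewrite ge0_fin_numE; last by apply: integral_ge0 => w _; rewrite lee_fin gker_ge0.
apply: le_lt_trans (ltry 1); apply: (@le_trans _ _ (\int[P]_w (cst 1%:E w))%E).
  apply: le_integral_ge0 => w; rewrite lee_fin ?gker_ge0// gker_le1//.
  exact/spd_psd/spd_inv.
by rewrite integral_cst// [X in (_ * X)%E]probability_setT mul1e.
Qed.

Lemma opP_ge0 n (S : 'M[R]_n) (N : probability 'cV[R]_n R) (Psi : 'cV[R]_n -> 'cV[R]_n)
    (mu : set 'cV[R]_n -> \bar R) d (T : measurableType d) (P : probability T R)
    (X : T -> 'cV[R]_n) :
  spd S -> is_noise S N -> measurable_fun setT X -> measurable_fun setT Psi ->
  (forall A, measurable A -> mu A = P (X @^-1` A)) ->
  forall u, 0 <= opP Psi S mu u.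
Proof.
move=> sS nN mX mPsi muX u; rewrite -lee_fin (opP_integral sS nN mX mPsi muX).
have [_ c0 _] := nN; apply: integral_ge0 => w _.
by rewrite lee_fin mulr_ge0 ?gker_ge0// ltW.
Qed.

Lemma measurable_opP n (S : 'M[R]_n) (N : probability 'cV[R]_n R) (Psi : 'cV[R]_n -> 'cV[R]_n)
    (mu : set 'cV[R]_n -> \bar R) d (T : measurableType d) (P : probability T R)
    (X : T -> 'cV[R]_n) :
  spd S -> is_noise S N -> measurable_fun setT X -> measurable_fun setT Psi ->
  (forall A, measurable A -> mu A = P (X @^-1` A)) ->
  measurable_fun setT (opP Psi S mu).
Proof.
move=> sS nN mX mPsi muX; apply/measurable_EFinP.
rewrite (_ : EFin \o _ = fun u => (\int[P]_w ((gauss_cst S)^-1 * gker (invmx S) (u - Psi (X w)))%:E)%E);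
  last by apply/funext => u; exact: (opP_integral sS nN mX mPsi muX).
have [_ c0 _] := nN.
apply: (measurable_fun_fubini_tonelli_F (fun z : 'cV[R]_n * T =>
  ((gauss_cst S)^-1 * gker (invmx S) (z.1 - Psi (X z.2)))%:E)).
  apply/measurable_EFinP; apply: measurable_funM => //; apply: measurable_gker.
  apply: measurable_cV_sub => //; apply: (measurableT_comp mPsi).
  exact: (measurableT_comp mX).
by move=> z; rewrite lee_fin mulr_ge0 ?gker_ge0// ltW.
Qed.

Lemma opP_prediction n (S : 'M[R]_n) (N : probability 'cV[R]_n R) (Psi : 'cV[R]_n -> 'cV[R]_n)
    (mu : set 'cV[R]_n -> \bar R) d (T : measurableType d) (P : probability T R)
    (X : T -> 'cV[R]_n) (f : 'cV[R]_n -> \bar R) :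
  spd S -> is_noise S N -> measurable_fun setT X -> measurable_fun setT Psi ->
  (forall A, measurable A -> mu A = P (X @^-1` A)) ->
  measurable_fun setT f -> (forall x, 0 <= f x)%E ->
  (\int[P]_w \int[N]_x f (Psi (X w) + x)%R =
   \int[lebesgue_cV R n]_u (f u * (opP Psi S mu u)%:E))%E.
Proof.
move=> sS nN mX mPsi muX mf f0; have [gN c0 gE] := nN.
rewrite (@integral_shifted_noise _ _ _ _ _ N (fun x => (gauss_cst S)^-1 * gker (invmx S) x))//.
- by apply: eq_integral => u _; rewrite (opP_integral sS nN mX mPsi muX).
- by move=> x; rewrite mulr_ge0 ?gker_ge0// ltW.
- by apply: measurable_funM => //; exact: measurable_gker.
- move=> A mA; apply: etrans (gN.2 A mA) _.
  by apply: eq_integral => x _; rewrite subr0.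
- exact: measurableT_comp mX.
Qed.

End probabilities.

Section posterior.
Context (R : realType) (n m : nat).
Variables (P : 'M[R]_n) (G : 'M[R]_m) (H : 'M[R]_(m, n)) (a : 'cV[R]_n) (y : 'cV[R]_m).
Variables (mu : probability 'cV[R]_n R) (N : probability 'cV[R]_m R) (c : R).
Hypotheses (sP : spd P) (sG : spd G) (gmu : gaussian_law mu c a P) (nN : is_noise G N).
Let M := P + H^T *m invmx G *m H.
Let S := G + H *m invmx P *m H^T.
Let K := invmx P *m H^T *m invmx S.
Let a' := a + K *m (y - H *m a).
Let I := (\int[lebesgue_cV R n]_w (gker M (w - a'))%:E)%E.

Let mM : measurable_fun setT (fun w : 'cV[R]_n => gker M (w - a')).
Proof. by apply: measurable_gker; exact: measurable_cV_sub. Qed.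

(** Testing the update identity with the constant 1 gives [k * c * I = 1]; finiteness and positivity
    of [I] follow without computing any of the factors. *)
Let mass : exists2 k : \bar R, (0 <= k)%E &
  (k * c%:E * I = 1)%E /\
  forall f : 'cV[R]_n -> \bar R, measurable_fun setT f -> (forall x, 0 <= f x)%E ->
  (\int[mu]_u \int[N]_e f (u + K *m (y - (H *m u + e)))%R =
   k * c%:E * \int[lebesgue_cV R n]_w (f w * (gker M (w - a'))%:E))%E.
Proof.
have [gN c0 _] := nN.
exists (\int[lebesgue_cV R m]_y' ((gauss_cst G)^-1 * gker (invmx S) (y' - H *m a))%:E)%E.
  by apply: integral_ge0 => y' _; rewrite lee_fin mulr_ge0 ?gker_ge0// ltW.
have h (f : 'cV[R]_n -> \bar R) : measurable_fun setT f -> (forall x, 0 <= f x)%E ->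
  (\int[mu]_u \int[N]_e f (u + K *m (y - (H *m u + e)))%R =
   \int[lebesgue_cV R m]_y' ((gauss_cst G)^-1 * gker (invmx S) (y' - H *m a))%:E *
     c%:E * \int[lebesgue_cV R n]_w (f w * (gker M (w - a'))%:E))%E.
  move=> mf f0; rewrite (kalman_update H y sP sG gmu gN mf f0) -muleA; congr (_ * _)%E.
  rewrite -ge0_integralZl.
  - by apply: eq_integral => w _; rewrite EFinM muleCA.
  - exact: measurableT.
  - by apply: emeasurable_funM => //; exact/measurable_EFinP.
  - by move=> w _; rewrite mule_ge0// lee_fin gker_ge0.
  - by rewrite lee_fin; exact: gmu.1.
split => //.
have := h (cst 1%E) (measurable_cst _) (fun=> lee01).
under [X in _ = (_ * X)%E -> _]eq_integral do rewrite mul1e.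
move=> <-.
under eq_integral do rewrite integral_cst// [X in (_ * X)%E]probability_setT mule1.
by rewrite integral_cst// [X in (_ * X)%E]probability_setT mule1.
Qed.

Lemma posterior_mass_fin : I = (fine I)%:E /\ 0 < fine I.
Proof.
have I0 : (0 <= I)%E by apply: integral_ge0 => w _; rewrite lee_fin gker_ge0.
have [k k0 [h _]] := mass.
have kc0 : (0 <= k * c%:E)%E by rewrite mule_ge0// lee_fin; exact: gmu.1.
by have [r r0 [_ ->]] := mule_eq1 kc0 I0 h.
Qed.

Lemma kalman_update_normalized (f : 'cV[R]_n -> \bar R) :
  measurable_fun setT f -> (forall x, 0 <= f x)%E ->
  (\int[mu]_u \int[N]_e f (u + K *m (y - (H *m u + e)))%R =
   \int[lebesgue_cV R n]_w (f w * ((fine I)^-1 * gker M (w - a'))%:E))%E.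
Proof.
move=> mf f0; have [k k0 [h1 ->//]] := mass; have [IE I0] := posterior_mass_fin.
have -> : (k * c%:E = (fine I)^-1%:E)%E.
  have kc0 : (0 <= k * c%:E)%E by rewrite mule_ge0// lee_fin; exact: gmu.1.
  have IP : (0 <= I)%E by rewrite IE lee_fin ltW.
  by have [r r0 [-> ->]] := mule_eq1 kc0 IP h1.
rewrite -ge0_integralZl.
- by apply: eq_integral => w _; rewrite EFinM muleCA.
- exact: measurableT.
- by apply: emeasurable_funM => //; exact/measurable_EFinP.
- by move=> w _; rewrite mule_ge0// lee_fin gker_ge0.
- by rewrite lee_fin invr_ge0 ltW.
Qed.

(** Conditioning produces exactly the density found for the updated particle in
    [kalman_update_normalized]; this coincidence identifies the mean-field law with the true
    filter. *)
Lemma bayes_posterior (p : 'cV[R]_n -> R) (h : 'cV[R]_n -> 'cV[R]_m) :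
  (forall u, p u = c * gker P (u - a)) -> (forall u, h u = H *m u) ->
  opB y (opQ h G p) = fun w => (fine I)^-1 * gker M (w - a').
Proof.
move=> pE hE; apply/funext => w; have [IE I0] := posterior_mass_fin.
have [_ cG gE] := nN.
have c0 : 0 < c.
  rewrite lt_neqAle gmu.1 andbT eq_sym; apply/eqP => c0; have [k k0 [+ _]] := mass.
  by rewrite c0 mule0 mul0e => /eqP; rewrite eq_sym onee_eq0.
have E u : opQ h G p (u, y) =
    ((gauss_cst G)^-1 * c * gker (invmx S) (y - H *m a)) * gker M (u - a').
  rewrite /opQ/= gE pE hE; have := bayes_factor H a y sP sG u y.
  rewrite -/M -/S -/K subrr mulmx0 subr0 => e.
  transitivity ((gauss_cst G)^-1 * c * (gker P (u - a) * gker (invmx G) (y - H *m u))).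
    by ring.
  by rewrite e -/a'; ring.
rewrite /opB E /mean.
under eq_integral do rewrite E EFinM.
rewrite ge0_integralZl//; last 3 first.
- exact/measurable_EFinP.
- by move=> x _; rewrite lee_fin gker_ge0.
- by rewrite lee_fin !mulr_ge0 ?gker_ge0// ltW.
rewrite -/I fineZ; field.
by rewrite (gt_eqF I0) (gt_eqF c0) (gt_eqF (gker_gt0 _ _)) (gt_eqF (_ : 0 < gauss_cst G))// -invr_gt0.
Qed.

End posterior.

Section kalman_filter.
Context (R : realType) (n m : nat).
Variables (Sigma : 'M[R]_n) (Gamma : 'M[R]_m) (L : 'M[R]_n) (b : 'cV[R]_n)
  (H : 'M[R]_(m, n)) (y : nat -> 'cV[R]_m).

(* The law at a given time is that of [m + A z] with [z] centred Gaussian of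
   precision [P]; [A = 1] except possibly for the degenerate initial law. *)
Definition kstate := ('cV[R]_n * 'M[R]_n * 'M[R]_n)%type.

Definition kpred_mean (s : kstate) := L *m s.1.1 + b.

Definition kpred_cov (s : kstate) : 'M[R]_n :=
  Sigma + (L *m s.1.2) *m invmx s.2 *m (L *m s.1.2)^T.

Definition kgain_of (C : 'M[R]_n) : 'M[R]_(n, m) :=
  C *m H^T *m invmx (Gamma + H *m C *m H^T).

Definition kstep (yobs : 'cV[R]_m) (s : kstate) : kstate :=
  (kpred_mean s + kgain_of (kpred_cov s) *m (yobs - H *m kpred_mean s), 1%:M,
   invmx (kpred_cov s) + H^T *m invmx Gamma *m H).

Fixpoint kalman (s0 : kstate) (j : nat) : kstate :=
  if j is k.+1 then kstep (y k.+1) (kalman s0 k) else s0.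

Hypotheses (sSigma : spd Sigma) (sGamma : spd Gamma).

Lemma kpred_cov_spd (s : kstate) : spd s.2 -> spd (kpred_cov s).
Proof. by move=> s2; apply: spdD_psd => //; apply: psd_conjT; exact/spd_psd/spd_inv. Qed.

Lemma kalman_spd (s0 : kstate) j : spd s0.2 -> spd (kalman s0 j).2.
Proof.
move=> h0; elim: j => //= j ih; apply: spdD_psd; first exact/spd_inv/kpred_cov_spd.
exact/psd_conj/spd_psd/spd_inv.
Qed.

End kalman_filter.

(** * Mean-field particles and the randomness they use *)

Section sources.
Context (R : realType) (du dy N J : nat).
Context d (Omega : measurableType d) (P : probability Omega R).
Variables (mu0 : probability 'cV[R]_du R) (Sigma : 'M[R]_du) (Gamma : 'M[R]_dy).
Variables (u0 : 'I_N -> {RV P >-> 'cV[R]_du})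
  (xi : nat -> 'I_N -> {RV P >-> 'cV[R]_du})
  (eta : nat -> 'I_N -> {RV P >-> 'cV[R]_dy}).
Hypothesis inputs : enkf_inputs J mu0 Sigma Gamma u0 xi eta.

Definition src := source_var (J := J) (fun i => u0 i : Omega -> _)
  (fun j i => xi j i : Omega -> _) (fun j i => eta j i : Omega -> _).

Lemma measurable_src s : measurable_fun setT (src s).
Proof. by case: s => [[i|[j i]]|[j i]] /=; exact: measurable_funPT. Qed.

(** The sources feeding the mean-field particle [i] up to time [j]; they are disjoint for distinct
    particles, which do not interact. An observation noise indexed by [ki] belongs to time
    [ki.1 + 1], so [ki.1 < j] includes time [j]. *)
Definition past (j : nat) (i : 'I_N) : {set source N J} :=
  finset (fun s : source N J => match s with
    | inl (inl i') => i' == i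
    | inl (inr ki) => (ki.1 < j)%N && (ki.2 == i)
    | inr ki => (ki.1 < j)%N && (ki.2 == i)
    end).

Definition dep K d' (T : measurableType d') (f : Omega -> T) :=
  depends_on src K f.

Variables (L : 'M[R]_du) (b : 'cV[R]_du) (H : 'M[R]_(dy, du)) (K : nat -> 'M[R]_(du, dy))
  (y : nat -> 'cV[R]_dy).

(* The mean-field particles share the sources of randomness of the ensemble but
   are moved by the affine model and a deterministic gain. *)
Fixpoint mfp (j : nat) (i : 'I_N) (w : Omega) : 'cV[R]_du :=
  if j is k.+1 then
    let uhat := (L *m mfp k i w + b) + xi k i w in
    uhat + K k *m (y k.+1 - (H *m uhat + eta k.+1 i w))
  else u0 i w.

Definition mfp_hat j i w := (L *m mfp j i w + b) + xi j i w.

Lemma dep_xi j i (jJ : (j < J)%N) : dep [set (inl (inr (Ordinal jJ, i)) : source N J)]%SET (fun w => xi j i w : 'cV[R]_du).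
Proof.
have iK := set11 (inl (inr (Ordinal jJ, i)) : source N J).
exact: (depends_on_source (X := src) iK).
Qed.

Lemma dep_eta j i (jJ : (j < J)%N) : dep [set (inr (Ordinal jJ, i) : source N J)]%SET (fun w => eta j.+1 i w : 'cV[R]_dy).
Proof.
have iK := set11 (inr (Ordinal jJ, i) : source N J).
exact: (depends_on_source (X := src) iK).
Qed.

Lemma dep_sub (K1 K2 : {set source N J}) d' (T : measurableType d') (f : Omega -> T) :
  K1 \subset K2 -> dep K1 f -> dep K2 f.
Proof. exact: depends_on_sub. Qed.

Lemma dep_cst (K1 : {set source N J}) d' (T : measurableType d') (c : T) :
  dep K1 (cst c).
Proof. exact: measurable_cst. Qed.

Lemma dep_cV_add (K1 : {set source N J}) k (f g : Omega -> 'cV[R]_k) :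
  dep K1 f -> dep K1 g -> dep K1 (fun w => f w + g w).
Proof. exact: measurable_cV_add. Qed.

Lemma dep_cV_sub (K1 : {set source N J}) k (f g : Omega -> 'cV[R]_k) :
  dep K1 f -> dep K1 g -> dep K1 (fun w => f w - g w).
Proof. exact: measurable_cV_sub. Qed.

Lemma dep_cV_mulmx (K1 : {set source N J}) k l (A : 'M[R]_(l, k)) (f : Omega -> 'cV[R]_k) :
  dep K1 f -> dep K1 (fun w => A *m f w).
Proof. exact: measurable_cV_mulmx. Qed.

Lemma dep_mfp_hat_sub (K1 : {set source N J}) j i :
  dep K1 (mfp j i) -> dep K1 (fun w => xi j i w : 'cV[R]_du) -> dep K1 (mfp_hat j i).
Proof.
move=> h1 h2; apply: dep_cV_add => //; apply: dep_cV_add; last exact: dep_cst.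
exact: dep_cV_mulmx.
Qed.

Lemma dep_mfp_hat j i (jJ : (j < J)%N) : dep (past j i) (mfp j i) ->
  dep (inl (inr (Ordinal jJ, i)) |: past j i)%SET (mfp_hat j i).
Proof.
move=> hj; apply: dep_mfp_hat_sub.
  by apply: dep_sub hj; exact: finset.subsetUr.
by apply: dep_sub (@dep_xi j i jJ); exact: finset.subsetUl.
Qed.

Lemma dep_mfp j i : (j <= J)%N -> dep (past j i) (mfp j i).
Proof.
elim: j => [_|j ih jJ].
  have s0 : (inl (inl i) : source N J) \in past 0 i by rewrite inE.
  exact: (depends_on_source (X := src) s0).
have hh : dep (past j.+1 i) (mfp_hat j i).
  apply: dep_sub (@dep_mfp_hat j i jJ (ih (ltnW jJ))).
  apply/fintype.subsetP => s.
  rewrite !inE => /orP[/eqP -> /=|]; first by rewrite ltnSn eqxx.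
  by case: s => [[i'|[k i']]|[k i']] //= /andP[kj ->]; rewrite ltnS ltnW.
have he : dep (past j.+1 i) (fun w => eta j.+1 i w : 'cV[R]_dy).
  by apply: dep_sub (@dep_eta j i jJ); rewrite finset.sub1set inE /= ltnSn eqxx.
apply: dep_cV_add => //; apply: dep_cV_mulmx.
apply: dep_cV_sub; first exact: dep_cst.
by apply: dep_cV_add => //; exact: dep_cV_mulmx.
Qed.

Lemma measurable_dep (K1 : {set source N J}) d' (T : measurableType d') (f : Omega -> T) :
  dep K1 f -> measurable_fun setT f.
Proof. exact: (depends_on_measurable measurable_src). Qed.

Lemma mfp_hat_indep_xi j i (jJ : (j < J)%N) (h : 'cV[R]_du * 'cV[R]_du -> \bar R) :
  measurable_fun setT h -> (forall z, 0 <= h z)%E ->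
  (\int[P]_w h (mfp j i w, xi j i w) = \int[P]_w \int[P]_w' h (mfp j i w, xi j i w'))%E.
Proof.
move=> mh h0.
have KL : [disjoint past j i & [set (inl (inr (Ordinal jJ, i)) : source N J)]%SET]%B.
  by rewrite disjoint_sym disjoints1 inE /= ltnn.
exact: (independent_joint measurable_src (inputs_indep inputs) KL
  (@dep_mfp j i (ltnW jJ)) (@dep_xi j i jJ) mh h0).
Qed.

Lemma mfp_hat_indep_eta j i (jJ : (j < J)%N) (h : 'cV[R]_du * 'cV[R]_dy -> \bar R) :
  measurable_fun setT h -> (forall z, 0 <= h z)%E ->
  (\int[P]_w h (mfp_hat j i w, eta j.+1 i w) =
   \int[P]_w \int[P]_w' h (mfp_hat j i w, eta j.+1 i w'))%E.
Proof.
move=> mh h0.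
have KL : [disjoint inl (inr (Ordinal jJ, i)) |: past j i &
    [set (inr (Ordinal jJ, i) : source N J)]%SET]%B.
  by rewrite disjoint_sym disjoints1 !inE /= ltnn.
exact: (independent_joint measurable_src (inputs_indep inputs) KL
  (@dep_mfp_hat j i jJ (@dep_mfp j i (ltnW jJ))) (@dep_eta j i jJ) mh h0).
Qed.

End sources.

(** * Exactness of the Kalman filter *)

Section laws.
Context (R : realType) d (T : measurableType d) (P : probability T R).

Lemma exists_law d' (T' : measurableType d') (X : T -> T') : measurable_fun setT X ->
  exists Q : probability T' R, (forall A, Q A = P (X @^-1` A)) /\
   forall f : T' -> \bar R, measurable_fun setT f -> (forall x, 0 <= f x)%E ->
     (\int[Q]_x f x = \int[P]_w f (X w))%E.
Proof.
move=> mX.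
pose X' : {mfun T >-> T'} := HB.pack X (isMeasurableFun.Build _ _ _ _ _ mX).
exists (distribution P X'); split => // f mf f0.
by rewrite ge0_integral_distribution.
Qed.

Lemma mean_law d' (T' : measurableType d') (Q : probability T' R) (X : T -> T') :
  (forall f : T' -> \bar R, measurable_fun setT f -> (forall x, 0 <= f x)%E ->
     (\int[Q]_x f x = \int[P]_w f (X w))%E) ->
  forall g : T' -> R, measurable_fun setT g -> mean Q g = mean P (g \o X).
Proof.
move=> h g mg; rewrite /mean; congr fine.
have mg' : measurable_fun setT (EFin \o g) by exact/measurable_EFinP.
rewrite integralE [RHS]integralE.
congr (_ - _)%E.
  apply: etrans (h _ (measurable_funepos mg') _) _ => [x|]; first exact: funepos_ge0.
  by apply: eq_integral => w _; rewrite !funeposE.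
apply: etrans (h _ (measurable_funeneg mg') _) _ => [x|]; first exact: funeneg_ge0.
  by apply: eq_integral => w _; rewrite !funenegE.
Qed.

End laws.

Section kalman_exact.
Context (R : realType) (n m N J : nat).
Context d (Omega : measurableType d) (P : probability Omega R).
Variables (mu0 : probability 'cV[R]_n R) (Sigma : 'M[R]_n) (Gamma : 'M[R]_m).
Variables (u0 : 'I_N -> {RV P >-> 'cV[R]_n})
  (xi : nat -> 'I_N -> {RV P >-> 'cV[R]_n})
  (eta : nat -> 'I_N -> {RV P >-> 'cV[R]_m}).
Hypothesis inputs : enkf_inputs J mu0 Sigma Gamma u0 xi eta.
Variables (Psi0 : 'cV[R]_n -> 'cV[R]_n) (h : 'cV[R]_n -> 'cV[R]_m).
Variables (L : 'M[R]_n) (b : 'cV[R]_n) (H : 'M[R]_(m, n)) (y : nat -> 'cV[R]_m).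
Hypotheses (Psi0E : forall u, Psi0 u = L *m u + b) (hE : forall u, h u = H *m u).
Hypotheses (sSigma : spd Sigma) (sGamma : spd Gamma).
Variables (NS : probability 'cV[R]_n R) (NG : probability 'cV[R]_m R).
Hypotheses (nS : is_noise Sigma NS) (nG : is_noise Gamma NG).
Variables (m0 : 'cV[R]_n) (A0 : 'M[R]_n) (NI : probability 'cV[R]_n R) (c0 : R).
Hypotheses (gNI : gaussian_law NI c0 0 1%:M)
  (mu0E : forall A, measurable A -> mu0 A = NI ((fun z => m0 + A0 *m z) @^-1` A)).

Let s j := kalman Sigma Gamma L b H y (m0, A0, 1%:M) j.
Definition kcov j := kpred_cov Sigma L (kalman Sigma Gamma L b H y (m0, A0, 1%:M) j).
Definition kgain j := kgain_of Gamma H (kcov j).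
Let v := mfp u0 xi eta L b H kgain y.
Let vhat := mfp_hat u0 xi eta L b H kgain y.

Definition state_law (t : kstate R n) (X : Omega -> 'cV[R]_n) :=
  exists (Q : probability 'cV[R]_n R) c, gaussian_law Q c 0 t.2 /\
   forall f : 'cV[R]_n -> \bar R, measurable_fun setT f -> (forall x, 0 <= f x)%E ->
     (\int[P]_w f (X w) = \int[Q]_z f (t.1.1 + t.1.2 *m z)%R)%E.

Lemma kcov_spd j : spd (kcov j).
Proof. by apply: kpred_cov_spd => //; apply: kalman_spd => //; exact: spd1. Qed.

Let mv j i : (j <= J)%N -> measurable_fun setT (v j i).
Proof. by move=> jJ; apply: measurable_dep (dep_mfp (j := j) (i := i) _ _ _ _ _ _) . Qed.

Let mPsi0 : measurable_fun setT Psi0.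
Proof.
rewrite (_ : Psi0 = fun u => L *m u + b); last exact/funext.
by apply: measurable_cV_add => //; exact: measurable_cV_mulmx.
Qed.

Lemma xi_law j i (f : 'cV[R]_n -> \bar R) : (j < J)%N -> measurable_fun setT f ->
  (forall x, 0 <= f x)%E -> (\int[P]_w f (xi j i w) = \int[NS]_x f x)%E.
Proof.
move=> jJ mf f0; rewrite -(ge0_integral_distribution (xi j i))//.
apply: eq_integral_measurable => A mA; apply: etrans (law_xi inputs i jJ mA) _.
have [g _ gE] := nS; apply: etrans (esym (g.2 A mA)).
by apply: eq_integral => x _; rewrite gE subr0.
Qed.

Lemma eta_law j i (f : 'cV[R]_m -> \bar R) : (j < J)%N -> measurable_fun setT f ->
  (forall x, 0 <= f x)%E -> (\int[P]_w f (eta j.+1 i w) = \int[NG]_x f x)%E.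
Proof.
move=> jJ mf f0; rewrite -(ge0_integral_distribution (eta j.+1 i))//.
apply: eq_integral_measurable => A mA; apply: etrans (law_eta inputs i jJ mA) _.
have [g _ gE] := nG; apply: etrans (esym (g.2 A mA)).
by apply: eq_integral => x _; rewrite gE subr0.
Qed.

Let tf := true_filter Psi0 h Sigma Gamma y mu0.

(** After a prediction there is a density even when [mu0] is degenerate, [Sigma] being positive
    definite. One Gaussian is recorded both as the value of [opP] and as the law of the particle. *)
Definition hat_law j i := exists (q : probability 'cV[R]_n R) c,
  [/\ gaussian_law q c (kpred_mean L b (s j)) (invmx (kcov j)),
   (forall u, opP Psi0 Sigma (tf j) u = c * gker (invmx (kcov j)) (u - kpred_mean L b (s j))) &
   forall f : 'cV[R]_n -> \bar R, measurable_fun setT f -> (forall x, 0 <= f x)%E ->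
     (\int[q]_x f x = \int[P]_w f (vhat j i w))%E].

(** The particle and [opP] both convolve the law of [L v + b] with the noise, and
    [gaussian_convolution] gives the result in closed form up to its constant. *)
Let prediction j i : (j < J)%N ->
  (forall A, measurable A -> tf j A = P (v j i @^-1` A)) -> state_law (s j) (v j i) ->
  hat_law j i.
Proof.
move=> jJ vlaw [Q [c [gQ vQ]]].
have mvj := mv i (ltnW jJ); have [gS cS gE] := nS.
have mhat : measurable_fun setT (vhat j i).
  apply: measurable_cV_add; last exact: measurable_funPT.
  by apply: measurable_cV_add => //; exact: measurable_cV_mulmx.
have hatE (f : 'cV[R]_n -> \bar R) : measurable_fun setT f -> (forall x, 0 <= f x)%E ->
    (\int[P]_w f (vhat j i w) = \int[lebesgue_cV R n]_u (f u * (opP Psi0 Sigma (tf j) u)%:E))%E.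
  move=> mf f0; rewrite -(opP_prediction sSigma nS mvj mPsi0 vlaw mf f0).
  pose g (z : 'cV[R]_n * 'cV[R]_n) := f ((L *m z.1 + b) + z.2).
  have mg : measurable_fun setT g.
    apply: measurableT_comp => //; apply: measurable_cV_add => //.
    by apply: measurable_cV_add => //; exact: measurable_cV_mulmx.
  apply: etrans (mfp_hat_indep_xi inputs L b H kgain y i jJ mg (fun z => f0 _)) _.
  apply: eq_integral => w _; rewrite /g/= Psi0E.
  apply: (xi_law i jJ (f := fun x => f (L *m v j i w + b + x))) => //.
  by apply: (measurableT_comp mf); exact: measurable_cV_add.
have [q [qA qf]] := exists_law P mhat.
set a := kpred_mean L b (s j).
pose c' := (gauss_cst Sigma)^-1 * (c * fine (\int[lebesgue_cV R n]_x
  (gker ((s j).2 + (L *m (s j).1.2)^T *m invmx Sigma *m (L *m (s j).1.2)) x)%:E)).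
have opPE u : opP Psi0 Sigma (tf j) u = c' * gker (invmx (kcov j)) (u - a).
  apply: EFin_inj; rewrite (opP_integral sSigma nS mvj mPsi0 vlaw).
  have sP : spd (s j).2 by apply: kalman_spd => //; exact: spd1.
  have := gaussian_convolution (L *m (s j).1.2) sP sSigma gQ (u - a).
  set I := fine _; rewrite -/(kcov j) => e.
  have mg : measurable_fun setT (fun v => gker (invmx Sigma) (u - Psi0 v)).
    by apply: measurable_gker; exact: measurable_cV_sub.
  rewrite (vQ (fun v => ((gauss_cst Sigma)^-1 * gker (invmx Sigma) (u - Psi0 v))%:E)); last 2 first.
  - by apply/measurable_EFinP; exact: measurable_funM.
  - by move=> x; rewrite lee_fin mulr_ge0 ?gker_ge0// ltW.
  have E z : u - Psi0 ((s j).1.1 + (s j).1.2 *m z) = (u - a) - (L *m (s j).1.2) *m z.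
    by rewrite Psi0E mulmxDr mulmxA (addrAC (L *m (s j).1.1)) opprD addrA.
  under eq_integral do rewrite E EFinM.
  have mk : measurable_fun setT (fun z => gker (invmx Sigma) (u - a - (L *m (s j).1.2) *m z)).
    by apply: measurable_gker; apply: measurable_cV_sub => //; exact: measurable_cV_mulmx.
  rewrite ge0_integralZl//; last 3 first.
  - exact/measurable_EFinP.
  - by move=> z _; rewrite lee_fin gker_ge0.
  - by rewrite lee_fin ltW.
  have ik : Q.-integrable setT (EFin \o (fun z => gker (invmx Sigma) (u - a - (L *m (s j).1.2) *m z))).
    apply: Lall_integrable; apply: Lall_le (Lall_cst Q 1) _ => // z.
    by rewrite /= normr1 ger0_norm ?gker_ge0// gker_le1//; exact/spd_psd/spd_inv.
  by rewrite (EFin_mean ik) e -EFinM /c' -!mulrA.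
exists q, c'; split; [|exact: opPE|by move=> f mf f0; exact: qf].
split.
  rewrite mulr_ge0 ?(ltW cS)// mulr_ge0 ?gQ.1//; apply: fine_ge0.
  by apply: integral_ge0 => x _; rewrite lee_fin gker_ge0.
move=> A mA; rewrite qA; apply: (law_of_integral mhat) => // f mf f0.
by rewrite hatE//; apply: eq_integral => u _; rewrite opPE.
Qed.

Let update j i : (j < J)%N -> hat_law j i ->
  (forall A, measurable A -> tf j.+1 A = P (v j.+1 i @^-1` A)) /\ state_law (s j.+1) (v j.+1 i).
Proof.
move=> jJ [q [c [gq opPE qf]]]; set a := kpred_mean L b (s j) in gq opPE.
have sP : spd (invmx (kcov j)) by exact/spd_inv/kcov_spd.
have gainE : invmx (invmx (kcov j)) *m H^T *m
    invmx (Gamma + H *m invmx (invmx (kcov j)) *m H^T) = kgain j.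
  by rewrite invmxK.
pose M := invmx (kcov j) + H^T *m invmx Gamma *m H.
pose a' := a + kgain j *m (y j.+1 - H *m a).
pose k := (fine (\int[lebesgue_cV R n]_w (gker M (w - a'))%:E)%E)^-1.
have mv1 := mv i jJ.
have vE (f : 'cV[R]_n -> \bar R) : measurable_fun setT f -> (forall x, 0 <= f x)%E ->
    (\int[P]_w f (v j.+1 i w) = \int[lebesgue_cV R n]_w (f w * (k * gker M (w - a'))%:E))%E.
  move=> mf f0.
  have := kalman_update_normalized H (y j.+1) sP sGamma gq nG mf f0.
  rewrite gainE -/M -/a' -/k => <-.
  pose g (z : 'cV[R]_n * 'cV[R]_m) := f (z.1 + kgain j *m (y j.+1 - (H *m z.1 + z.2))).
  have mg : measurable_fun setT g.
    apply: measurableT_comp => //; apply: measurable_cV_add => //.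
    apply: measurable_cV_mulmx; apply: measurable_cV_sub => //.
    by apply: measurable_cV_add => //; exact: measurable_cV_mulmx.
  apply: etrans (mfp_hat_indep_eta inputs L b H kgain y i jJ mg (fun z => f0 _)) _.
  rewrite (qf (fun u => \int[NG]_e f (u + kgain j *m (y j.+1 - (H *m u + e)))%R)%E).
  - apply: eq_integral => w _; rewrite /g/=.
    apply: (eta_law i jJ (f := fun e => f (vhat j i w + kgain j *m (y j.+1 - (H *m vhat j i w + e))))) => //.
    apply: (measurableT_comp mf); apply: measurable_cV_add => //.
    apply: measurable_cV_mulmx; apply: measurable_cV_sub => //.
    by apply: measurable_cV_add => //; exact: measurable_cV_mulmx.
  - exact: (measurable_fun_fubini_tonelli_F g mg (fun z => f0 _)).
  - by move=> u; apply: integral_ge0.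
have tfE : tf j.+1 = of_density (fun w => k * gker M (w - a')).
  rewrite /tf/= -/tf; congr of_density.
  have := bayes_posterior (y j.+1) sP sGamma gq nG opPE hE.
  by rewrite gainE -/M -/a' -/k.
split; first by move=> A mA; rewrite tfE (law_of_integral mv1 vE mA).
have k0 : 0 <= k.
  by rewrite invr_ge0; apply: fine_ge0; apply: integral_ge0 => w _; rewrite lee_fin gker_ge0.
have mc : measurable_fun setT (fun w => v j.+1 i w - a') by exact: measurable_cV_sub.
have [Q [QA Qf]] := exists_law P mc.
exists Q, k; split.
  apply: conj; first exact: k0.
  move=> A mA; rewrite QA.
  have -> : (fun x => k * gker (s j.+1).2 (x - 0)) = (fun x => k * gker M x).
    by apply/funext => x; rewrite subr0.
  apply: (law_of_integral mc _ mA) => f mf f0.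
  have mfa : measurable_fun setT (fun w : 'cV[R]_n => f (w - a')).
    by apply: (measurableT_comp mf); exact: measurable_cV_sub.
  apply: etrans (vE _ mfa (fun w => f0 _)) _.
  rewrite -[RHS](ge0_integral_shift (- a')).
  - by [].
  - apply: emeasurable_funM => //; apply/measurable_EFinP; apply: measurable_funM => //.
    by apply: measurable_gker; exact: measurable_id.
  - by move=> w; rewrite mule_ge0// lee_fin mulr_ge0 ?gker_ge0.
move=> f mf f0; rewrite Qf//=.
- apply: eq_integral => w _; congr f.
  have E x : a' + 1%:M *m (x - a') = x by rewrite mul1mx addrC subrK.
  exact: esym (E _).
- apply: measurableT_comp => //; apply: measurable_cV_add => //; exact: measurable_cV_mulmx.
Qed.

(** The two conclusions are carried together: equality with the true filter identifies the next
    [opP], and the Gaussian form makes the next update exact. *)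
Lemma kalman_exact j i : (j <= J)%N ->
  (forall A, measurable A -> tf j A = P (v j i @^-1` A)) /\ state_law (s j) (v j i).
Proof.
elim: j => [_|j ih jJ].
  split => [A mA|].
    by rewrite /tf /= -(law_u0 inputs i mA).
  exists NI, c0; split => // f mf f0.
  rewrite -[LHS](ge0_integral_distribution (u0 i))//.
  have mA : measurable_fun setT (fun z : 'cV[R]_n => m0 + A0 *m z).
    by apply: measurable_cV_add => //; exact: measurable_cV_mulmx.
  transitivity (\int[pushforward NI (fun z => m0 + A0 *m z)%R]_x f x)%E; last first.
    by rewrite ge0_integral_pushforward.
  apply: eq_integral_measurable => A mAA.
  by rewrite [LHS](law_u0 inputs i mAA) mu0E.
by apply: update => //; have [h1 h2] := ih (ltnW jJ); exact: prediction.
Qed.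

Lemma kalman_exact_hat j i : (j < J)%N -> hat_law j i.
Proof. by move=> jJ; have [h1 h2] := kalman_exact i (ltnW jJ); exact: prediction. Qed.

End kalman_exact.

(** * Stability of the filter *)

Section estimates.
Context (R : realType).

Lemma norm_expR_sub1 (x : R) : `|expR x - 1| <= `|x| * expR `|x|.
Proof.
have e1 := expR_ge1Dx x; have e2 := expR_ge1Dx (- x); have e0 := expR_gt0 x.
have := expRxMexpNx_1 x => e3.
have a0 := normr_ge0 x; have e4 := expR_ge1Dx `|x|.
rewrite ler_norml; case: (lerP 0 x) => x0.
  rewrite ger0_norm//; apply/andP; split; nra.
rewrite ltr0_norm// in a0 e4 *; apply/andP; split; nra.
Qed.

Lemma sqr_enormD n (x y : 'cV[R]_n) :
  enorm (x + y) ^+ 2 <= 2 * enorm x ^+ 2 + 2 * enorm y ^+ 2.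
Proof.
rewrite !sqr_enorm !mulr_sumr -big_split/=; apply: ler_sum => i _.
by rewrite mxE; have := sqr_ge0 (x i 0 - y i 0); nra.
Qed.

Lemma enormN n (x : 'cV[R]_n) : enorm (- x) = enorm x.
Proof. by rewrite /enorm; congr Num.sqrt; apply: eq_bigr => i _; rewrite mxE sqrrN. Qed.

Lemma bilinear_le n (P : 'M[R]_n) (x y : 'cV[R]_n) :
  `|(x^T *m P *m y) 0 0| <= nrm1 P * (enorm x * enorm y).
Proof.
rewrite mxE (le_trans (ler_norm_sum _ _ _))//.
rewrite /nrm1 exchange_big/= mulr_suml; apply: ler_sum => j _.
rewrite normrM mulr_suml mxE.
rewrite (le_trans (ler_wpM2r _ (ler_norm_sum _ _ _)))// mulr_suml.
apply: ler_sum => i _; rewrite normrM !mxE -mulrA mulrCA.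
by rewrite ler_wpM2l// ler_pM// ler_enorm.
Qed.

Lemma qf_le n (P : 'M[R]_n) (x : 'cV[R]_n) : `|qf P x| <= nrm1 P * enorm x ^+ 2.
Proof. exact: bilinear_le. Qed.

Lemma ge0_mean_bound d (T : measurableType d) (mu : probability T R) (f g : T -> R) (c : R) :
  measurable_fun setT f -> (forall x, 0 <= f x) -> (forall x, f x <= g x) ->
  (\int[mu]_x (g x)%:E <= c%:E)%E ->
  mu.-integrable setT (EFin \o f) /\ 0 <= mean mu f <= c.
Proof.
move=> mf f0 fg gc.
have fc : (\int[mu]_x (f x)%:E <= c%:E)%E.
  by apply: le_trans gc; apply: le_integral_ge0 => x; rewrite lee_fin.
have fi : mu.-integrable setT (EFin \o f).
  apply/integrableP; split; first exact/measurable_EFinP.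
  apply: le_lt_trans (ltry c); apply: le_trans fc.
  by apply: le_integral_ge0 => x /=; rewrite ?abse_ge0// ger0_norm.
by split=> //; rewrite mean_ge0//= -lee_fin -EFin_mean.
Qed.

End estimates.

Section weighted.
Context (R : realType) (n : nat).

Definition weight (x : 'cV[R]_n) : R := 1 + enorm x ^+ 2.

Lemma weight_ge1 x : 1 <= weight x.
Proof. by rewrite lerDl sqr_ge0. Qed.

Lemma measurable_weight d (T : measurableType d) (f : T -> 'cV[R]_n) :
  measurable_fun setT f -> measurable_fun setT (fun t => weight (f t)).
Proof. by move=> mf; apply: measurable_funD => //; apply: measurable_funX; exact: measurable_enorm. Qed.

Lemma integral_weight_le (mu : probability 'cV[R]_n R) M : (\int[mu]_u (enorm u ^+ 2)%:E <= M%:E)%E ->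
  (\int[mu]_u (weight u)%:E <= (1 + M)%:E)%E.
Proof.
move=> h; under eq_integral do rewrite EFinD.
rewrite ge0_integralD//.
- rewrite integral_cst// [X in (_ * X + _)%E]probability_setT mule1 EFinD.
  exact: leeD.
- by move=> x _; rewrite lee_fin sqr_ge0.
- by apply/measurable_EFinP; apply: measurable_funX; exact: measurable_enorm.
Qed.

(** The factor 4 is twice the 2 of [(k (1 + |v|))^2 <= 2 k^2 (1 + |v|^2)], from [sqr_enormD]. *)
Lemma weight_growth (k : R) (Psi : 'cV[R]_n -> 'cV[R]_n) v x :
  linear_growth k Psi ->
  weight (Psi v + x) <= (1 + 4 * k ^+ 2) * weight v + 2 * enorm x ^+ 2.
Proof.
move=> /(_ v) g; have := sqr_enormD (Psi v) x; rewrite /weight.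
have := enorm_ge0 (Psi v); have := enorm_ge0 v; move: (enorm v) (enorm (Psi v)) g => a b g a0 b0 h.
have b2 : b ^+ 2 <= (k * (1 + a)) ^+ 2 by apply: lerX.
have := sqr_ge0 (k * (1 - a)); nra.
Qed.

End weighted.

(** * Sensitivity of the Gaussian kernel to a shift *)

Section noise_kernel.
Context (R : realType) (n : nat) (Sigma : 'M[R]_n) (NS : probability 'cV[R]_n R).
Hypotheses (sSigma : spd Sigma) (nS : is_noise Sigma NS).
Let P := invmx Sigma.
Let p := nrm1 P.

Lemma noise_expR_coord i a : Lall NS (fun x : 'cV[R]_n => expR (a * `|x i 0|)).
Proof.
have [gN _ _] := nS.
have mc : measurable_fun setT (fun x : 'cV[R]_n => a * (x i 0 - (0 : 'cV[R]_n) i 0)).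
  by apply: measurable_funM => //; apply: measurable_funB => //; exact: measurable_cV_coord.
have h t : (\int[NS]_x (expR (t * (a * (x i 0 - (0 : 'cV[R]_n) i 0))))%:E < +oo)%E.
  under eq_integral do rewrite mulrA.
  by rewrite (gaussian_mgf_coord gN (spd_inv sSigma)) ltry.
apply: Lall_le (Lall_mgf mc h) _ => [|x].
  apply: measurableT_comp => //; apply: measurable_funM => //.
  by apply: measurableT_comp => //; exact: measurable_cV_coord.
rewrite !(ger0_norm (expR_ge0 _)) ler_expR mxE subr0 normrM.
by rewrite ler_wpM2r// ler_norm.
Qed.

Lemma noise_Lall_enorm : Lall NS (fun x : 'cV[R]_n => enorm x).
Proof.
apply: (@Lall_le _ _ _ NS _ (fun x => \sum_(i < n) `|x i 0|)) => [|| x].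
- exact: measurable_enorm.
- apply: Lall_sum => i; apply: Lall_expR_norm.
    by apply: measurableT_comp => //; exact: measurable_cV_coord.
  apply: Lall_le (noise_expR_coord i 1) _ => [|x].
    apply: measurableT_comp => //; do 2 apply: measurableT_comp => //.
    exact: measurable_cV_coord.
  by rewrite normr_id mul1r.
- rewrite !ger0_norm ?enorm_ge0 ?sumr_ge0//.
  by rewrite -nrm1_cV enorm_le_nrm1.
Qed.

(** The norm is at most the sum of the coordinates, so a finite product of one-coordinate
    exponentials dominates; [Lall] is closed under products, whatever the correlations. *)
Lemma noise_expR_enorm a : 0 <= a -> Lall NS (fun x : 'cV[R]_n => expR (a * enorm x)).
Proof.
move=> a0; have h : Lall NS (fun x : 'cV[R]_n => \prod_(i < n) expR (a * `|x i 0|)).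
  elim: (index_enum _) => [|i s ih].
    by under eq_fun do rewrite big_nil; exact: Lall_cst.
  by under eq_fun do rewrite big_cons; apply: LallM => //; exact: noise_expR_coord.
apply: Lall_le h _ => [|x].
  apply: measurableT_comp => //; apply: measurable_funM => //; exact: measurable_enorm.
rewrite !ger0_norm ?expR_ge0//; last by apply: prodr_ge0 => i _; exact: expR_ge0.
by rewrite -expR_sum ler_expR -mulr_sumr ler_wpM2l// -nrm1_cV enorm_le_nrm1.
Qed.

(** For [|z| <= e <= 1] this dominates [weight x * |expR (theta z x) - 1| / e]: one has
    [|theta z x| <= e p (1 + |x|)] and [|expR s - 1| <= |s| expR |s|]. *)
Definition shift_weight (x : 'cV[R]_n) : R :=
  weight x * (p * (1 + enorm x) * (expR p * expR (p * enorm x))).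

Lemma Lall_shift_weight : Lall NS shift_weight.
Proof.
have e := noise_Lall_enorm.
apply: LallM; first by apply: LallD; [exact: Lall_cst|exact: LallX].
apply: LallM; first by apply: LallZ; apply: LallD => //; exact: Lall_cst.
by apply: LallZ; apply: noise_expR_enorm; exact: nrm1_ge0.
Qed.

(** The Cameron-Martin exponent: [expR (theta z)] is the density of the noise shifted by [z] with
    respect to the noise itself. *)
Let theta (z x : 'cV[R]_n) : R := (x^T *m P *m z) 0 0 - 2^-1 * qf P z.

Let mtheta z : measurable_fun setT (theta z).
Proof.
apply: measurable_funB => //; under eq_fun do rewrite mxE.
apply: measurable_sum => j; apply: measurable_funM => //.
under eq_fun do rewrite mxE; apply: measurable_sum => i.
apply: measurable_funM => //; under eq_fun do rewrite mxE; exact: measurable_cV_coord.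
Qed.

Let noise_shift (F : 'cV[R]_n -> R) z : measurable_fun setT F -> (forall x, 0 <= F x) ->
  (\int[NS]_x (F (x + z))%:E = \int[NS]_x (F x * expR (theta z x))%:E)%E.
Proof.
move=> mF F0; have [gN c0 _] := nS.
have mFz : measurable_fun setT (fun x : 'cV[R]_n => F (x + z)).
  by apply: (measurableT_comp mF); exact: measurable_cV_add.
rewrite (gaussian_integral gN (f := fun x => (F (x + z))%:E)); last 2 first.
- exact/measurable_EFinP.
- by move=> x; rewrite lee_fin.
rewrite (gaussian_integral gN (f := fun x => (F x * expR (theta z x))%:E)); last 2 first.
- by apply/measurable_EFinP; apply: measurable_funM => //; exact: measurableT_comp.
- by move=> x; rewrite lee_fin mulr_ge0// expR_ge0.
rewrite -[LHS](ge0_integral_shift (- z)); last 2 first.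
- apply: emeasurable_funM; apply/measurable_EFinP => //; apply: measurable_funM => //.
  by apply: measurable_gker; exact: measurable_cV_sub.
- by move=> x; rewrite mule_ge0// lee_fin// mulr_ge0 ?gker_ge0// ltW.
apply: eq_integral => x _; rewrite subrK !subr0 -!EFinM; congr EFin.
rewrite -mulrA; congr (_ * _); rewrite mulrCA; congr (_ * _).
rewrite /gker -expRD; congr expR.
rewrite qfD; last by have [e _] := sSigma; exact: trmx_invmx.
rewrite qfN mulmxN mxE /theta -/P; lra.
Qed.

(** The test function [F] is merely measurable, so the shift is moved onto the Gaussian density,
    which varies smoothly; the factor [e] comes from [expR (theta z x) - 1]. *)
Lemma noise_kernel_close (F : 'cV[R]_n -> R) (k e : R) (Psi : 'cV[R]_n -> 'cV[R]_n) v z :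
  measurable_fun setT F -> (forall x, 0 <= F x <= weight x) ->
  linear_growth k Psi -> enorm z <= e -> 0 <= e <= 1 ->
  `|mean NS (fun x => F (Psi v + z + x)) - mean NS (fun x => F (Psi v + x))| <=
  e * ((3 + 4 * k ^+ 2) * weight v * mean NS shift_weight).
Proof.
move=> mF F0 gk ze /andP[e0 e1].
have e2 := noise_Lall_enorm.
have mG : measurable_fun setT (fun x => F (Psi v + x)).
  by apply: (measurableT_comp mF); exact: measurable_cV_add.
(* [weight (Psi v + x)] is at most [(1 + 4 k^2) weight v + 2 |x|^2], hence at most [c * weight x],
   both weights being at least 1. *)
pose c := (3 + 4 * k ^+ 2) * weight v.
have c0 : 0 <= c by have := sqr_ge0 k; have := weight_ge1 v; rewrite /c; nra.
have Gle x : `|F (Psi v + x)| <= c * weight x.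
  have /andP[a b] := F0 (Psi v + x); rewrite ger0_norm//.
  apply: le_trans b _; apply: le_trans (weight_growth v x gk) _.
  have := weight_ge1 v; rewrite /c [weight x]/weight; have := sqr_ge0 (enorm x).
  have := sqr_ge0 k; move: (weight v) (enorm x ^+ 2) (k ^+ 2) => a1 a2 a3 h3 h2 h1.
  have h4 : 0 <= a3 * (a1 * a2) by rewrite !mulr_ge0//; lra.
  nra.
have LG : Lall NS (fun x => F (Psi v + x)).
  apply: Lall_le (LallZ c (LallD (Lall_cst NS 1) (LallX 2 e2))) _ => // x.
  exact: le_trans (Gle x) (ler_norm _).
have [th1 th2] : (forall x, `|theta z x| <= e * (p * (1 + enorm x))) /\
    forall x, `|theta z x| <= p * (1 + enorm x).
  have h x : `|theta z x| <= e * (p * (1 + enorm x)).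
    rewrite /theta (le_trans (ler_normB _ _))// normrM.
    have := bilinear_le P x z; have := qf_le P z.
    have := enorm_ge0 z; have := enorm_ge0 x; have : 0 <= p := nrm1_ge0 _.
    rewrite -/p (ger0_norm (_ : 0 <= 2^-1))//.
    move: (enorm z) ze (enorm x) `|_| `|_| => a ae b s t p0 b0 a0 h1 h2.
    have : p * (b * a) <= p * (b * e) by rewrite !ler_wpM2l.
    have : p * a ^+ 2 <= p * e by rewrite ler_wpM2l//; nra.
    nra.
  split => // x; apply: le_trans (h x) _; rewrite ler_piMl// mulr_ge0 ?nrm1_ge0//.
  by rewrite addr_ge0// enorm_ge0.
have LE : Lall NS (fun x => expR (theta z x)).
  apply: Lall_le (LallZ (expR p) (noise_expR_enorm (nrm1_ge0 P))) _ => [|x].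
    exact: measurableT_comp.
  rewrite !ger0_norm ?mulr_ge0 ?expR_ge0// -expRD ler_expR -/p.
  by rewrite -[X in X + _]mulr1 -mulrDr (le_trans _ (th2 x))// ler_norm.
have -> : mean NS (fun x => F (Psi v + z + x)) =
    mean NS (fun x => F (Psi v + x) * expR (theta z x)).
  rewrite /mean; congr fine.
  rewrite -(noise_shift z mG) => [|x]; last by have /andP[] := F0 (Psi v + x).
  by apply: eq_integral => x _; rewrite addrA addrAC.
rewrite -meanB; [|exact/Lall_integrable/LallM|exact: Lall_integrable].
rewrite mulrA -meanZ; last exact: Lall_integrable Lall_shift_weight.
apply: ler_norm_mean.
- apply: measurable_funB => //; apply: measurable_funM => //; exact: measurableT_comp.
- exact: Lall_integrable (LallZ _ Lall_shift_weight).
move=> x; rewrite -{2}[F _]mulr1 -mulrBr normrM -/c /shift_weight.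
rewrite (mulrC e) -mulrA mulrCA mulrA [leRHS](_ : _ = (c * weight x) * (e * (p * (1 + enorm x)) * (expR p * expR (p * enorm x)))); last by ring.
apply: ler_pM => //; apply: le_trans (norm_expR_sub1 _) _.
apply: ler_pM (normr_ge0 _) (expR_ge0 _) (th1 x) _.
by rewrite -expRD ler_expR -[X in X + _]mulr1 -mulrDr.
Qed.

End noise_kernel.

(** * One filtering step in weighted total variation *)

Section filter_steps.
Context (R : realType) (n m : nat) (Sigma : 'M[R]_n) (Gamma : 'M[R]_m).
Context (NS : probability 'cV[R]_n R) (NG : probability 'cV[R]_m R).
Hypotheses (sSigma : spd Sigma) (nS : is_noise Sigma NS) (sGamma : spd Gamma)
  (nG : is_noise Gamma NG).

(** The predicted law is described twice: by its density, for Bayes' rule, and as a mixture of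
    shifted noises, for moments and comparisons. *)
Lemma prediction_law (Psi : 'cV[R]_n -> 'cV[R]_n) (tf : set 'cV[R]_n -> \bar R)
    (mu : probability 'cV[R]_n R) : measurable_fun setT Psi ->
  (forall A, measurable A -> tf A = mu A) ->
  exists q : probability 'cV[R]_n R,
    [/\ measurable_fun setT (opP Psi Sigma tf), forall u, 0 <= opP Psi Sigma tf u,
      forall f : 'cV[R]_n -> \bar R, measurable_fun setT f -> (forall x, 0 <= f x)%E ->
       (\int[q]_u f u = \int[lebesgue_cV R n]_u (f u * (opP Psi Sigma tf u)%:E))%E &
      forall f : 'cV[R]_n -> \bar R, measurable_fun setT f -> (forall x, 0 <= f x)%E ->
       (\int[q]_u f u = \int[mu]_v \int[NS]_x f (Psi v + x)%R)%E].
Proof.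
move=> mPsi tfE.
have mid : measurable_fun setT (@id 'cV[R]_n) by exact: measurable_id.
have p0 := opP_ge0 sSigma nS mid mPsi tfE.
have mp := measurable_opP sSigma nS mid mPsi tfE.
have pE f := opP_prediction (f := f) sSigma nS mid mPsi tfE.
have [|q qE] := @exists_probability _ _ _ (dens (lebesgue_cV R n) p0 mp).
  transitivity (\int[lebesgue_cV R n]_u (cst 1 u * (opP Psi Sigma tf u)%:E))%E.
    by apply: eq_integral => u _; rewrite mul1e.
  rewrite -pE//.
  under eq_integral do rewrite integral_cst// [X in (_ * X)%E]probability_setT mule1.
  by rewrite integral_cst// [X in (_ * X)%E]probability_setT mule1.
have qf (f : 'cV[R]_n -> \bar R) : measurable_fun setT f -> (forall x, 0 <= f x)%E ->
    (\int[q]_u f u = \int[lebesgue_cV R n]_u (f u * (opP Psi Sigma tf u)%:E))%E.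
  move=> mf f0; apply: etrans (ge0_integral_dens (lebesgue_cV R n) p0 mp mf f0).
  by apply: eq_integral_measurable => A _; rewrite qE.
by exists q; split => // f mf f0; rewrite qf// -pE.
Qed.

(** Without the normalising constant, which cancels in Bayes' rule, the values are at most 1. *)
Definition likelihood (h : 'cV[R]_n -> 'cV[R]_m) (y : 'cV[R]_m) (u : 'cV[R]_n) : R :=
  gker (invmx Gamma) (y - h u).

Lemma measurable_likelihood h y : measurable_fun setT h ->
  measurable_fun setT (likelihood h y).
Proof. by move=> mh; apply: measurable_gker; exact: measurable_cV_sub. Qed.

Lemma likelihood_ge0 h y u : 0 <= likelihood h y u.
Proof. exact: gker_ge0. Qed.

Lemma likelihood_le1 h y u : likelihood h y u <= 1.
Proof. by apply: gker_le1; exact/spd_psd/spd_inv. Qed.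

Lemma likelihood_integrable (q : probability 'cV[R]_n R) h y : measurable_fun setT h ->
  q.-integrable setT (EFin \o likelihood h y).
Proof.
move=> mh; apply: Lall_integrable; apply: Lall_le (Lall_cst q 1) _ => [|u].
  exact: measurable_likelihood.
by rewrite /= normr1 ger0_norm ?likelihood_ge0// likelihood_le1.
Qed.

Lemma bayes_law (q : probability 'cV[R]_n R) (p : 'cV[R]_n -> R) h y :
  measurable_fun setT h -> measurable_fun setT p -> (forall u, 0 <= p u) ->
  (forall f : 'cV[R]_n -> \bar R, measurable_fun setT f -> (forall x, 0 <= f x)%E ->
     (\int[q]_u f u = \int[lebesgue_cV R n]_u (f u * (p u)%:E))%E) ->
  0 < mean q (likelihood h y) ->
  exists mu : probability 'cV[R]_n R,
    (forall A, of_density (opB y (opQ h Gamma p)) A = mu A) /\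
    forall f : 'cV[R]_n -> R, measurable_fun setT f -> (forall x, 0 <= f x) ->
      (\int[mu]_u (f u)%:E = (mean q (likelihood h y))^-1%:E *
         \int[q]_u (f u * likelihood h y u)%:E)%E.
Proof.
move=> mh mp p0 qE; set l := likelihood h y; set z := mean q l => z0.
have [_ c0 gE] := nG; set cG := (gauss_cst Gamma)^-1 in c0.
have ml : measurable_fun setT l by exact: measurable_likelihood.
have l0 u : 0 <= l u by exact: likelihood_ge0.
have zE : (\int[lebesgue_cV R n]_u (l u * p u)%:E = z%:E)%E.
  rewrite /z -(EFin_mean (likelihood_integrable q y mh)) (qE (EFin \o l))//.
  exact/measurable_EFinP.
have opBE : opB y (opQ h Gamma p) = fun u => z^-1 * (l u * p u).
  apply/funext => u; rewrite /opB /opQ /= gE -/cG -/(likelihood h y u) -/l.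
  have -> : mean (lebesgue_cV R n)
      (fun U => cG * gauss_exp Gamma (y - h U) * p U) = cG * z.
    rewrite /mean; under eq_integral do rewrite gE -mulrA EFinM.
    rewrite ge0_integralZl//; [|exact/measurable_EFinP/measurable_funM
      |by move=> U _; rewrite lee_fin mulr_ge0 ?l0|by rewrite lee_fin ltW].
    by rewrite zE -EFinM.
  by rewrite -mulrA; field; rewrite !gt_eqF.
have d0 u : 0 <= opB y (opQ h Gamma p) u by rewrite opBE !mulr_ge0// invr_ge0 ltW.
have md : measurable_fun setT (opB y (opQ h Gamma p)).
  by rewrite opBE; apply: measurable_funM => //; exact: measurable_funM.
have dE (f : 'cV[R]_n -> R) : measurable_fun setT f -> (forall x, 0 <= f x) ->
    (\int[lebesgue_cV R n]_u ((f u)%:E * (opB y (opQ h Gamma p) u)%:E) =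
     z^-1%:E * \int[q]_u (f u * l u)%:E)%E.
  move=> mf f0; rewrite (qE (fun u => (f u * l u)%:E)); last 2 first.
  - by apply/measurable_EFinP; exact: measurable_funM.
  - by move=> u; rewrite lee_fin mulr_ge0.
  rewrite -ge0_integralZl//.
  - by apply: eq_integral => u _; rewrite opBE -!EFinM; congr EFin; ring.
  - by apply: emeasurable_funM; apply/measurable_EFinP => //; exact: measurable_funM.
  - by move=> u _; rewrite mule_ge0// lee_fin// mulr_ge0.
  - by rewrite lee_fin invr_ge0 ltW.
have [|mu muE] := @exists_probability _ _ _ (dens (lebesgue_cV R n) d0 md).
  transitivity (\int[lebesgue_cV R n]_u ((cst 1 u)%:E * (opB y (opQ h Gamma p) u)%:E))%E.
    by apply: eq_integral => u _; rewrite mul1e.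
  rewrite dE//; under eq_integral do rewrite mul1r.
  rewrite (EFin_mean (likelihood_integrable q y mh)) -EFinM -/l -/z.
  by rewrite mulVf// gt_eqF.
exists mu; split=> [A|f mf f0]; first by rewrite muE.
rewrite -dE//; apply: etrans (ge0_integral_dens (lebesgue_cV R n) d0 md _ _) => //.
- by apply: eq_integral_measurable => A _; rewrite muE.
- exact/measurable_EFinP.
Qed.

(* Jensen's inequality, through the tangent of the exponential at [a]. *)
Lemma likelihood_mean_ge (q : probability 'cV[R]_n R) (h : 'cV[R]_n -> 'cV[R]_m) y ky kh M a :
  measurable_fun setT h -> linear_growth kh h -> enorm y <= ky ->
  (\int[q]_u (enorm u ^+ 2)%:E <= M%:E)%E ->
  nrm1 (invmx Gamma) * (ky ^+ 2 + 2 * kh ^+ 2 * (1 + M)) <= a ->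
  expR (- a) <= mean q (likelihood h y).
Proof.
move=> mh gh yk qM ale; set g := nrm1 (invmx Gamma) in ale *.
have g0 : 0 <= g by exact: nrm1_ge0.
have me : measurable_fun setT (fun u : 'cV[R]_n => enorm u ^+ 2).
  by apply: measurable_funX; exact: measurable_enorm.
have [ie /andP[e0 eM]] := ge0_mean_bound me (fun u => sqr_ge0 _) (fun u => lexx _) qM.
(* Write the likelihood as [expR (- x)]. The tangent at [a] gives
   [expR (- x) >= expR (- a) (1 + a - x)], and [x] is at most affine in [|u|^2]; after integration
   the choice of [a] makes the bracket at least 1. *)
have lge u : expR (- a) * (1 + a - g * (ky ^+ 2 + 2 * kh ^+ 2)) -
    expR (- a) * (g * (2 * kh ^+ 2)) * enorm u ^+ 2 <= likelihood h y u.
  set x := 2^-1 * qf (invmx Gamma) (y - h u).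
  have xle : x <= g * (ky ^+ 2 + 2 * kh ^+ 2) + g * (2 * kh ^+ 2) * enorm u ^+ 2.
    have := qf_le (invmx Gamma) (y - h u); have := sqr_enormD y (- h u).
    rewrite enormN -/g => h1 /ler_normlW h2; have hu := gh u.
    have h3 : enorm (h u) ^+ 2 <= (kh * (1 + enorm u)) ^+ 2.
      by apply: lerX => //; exact: enorm_ge0.
    have h4 : enorm y ^+ 2 <= ky ^+ 2 by apply: lerX => //; exact: enorm_ge0.
    have h5 := sqr_ge0 (kh * (1 - enorm u)).
    have h6 : enorm (y - h u) ^+ 2 <= 2 * (ky ^+ 2 + 2 * kh ^+ 2 + 2 * kh ^+ 2 * enorm u ^+ 2).
      nra.
    have h7 := ler_wpM2l g0 h6; rewrite /x; nra.
  have -> : likelihood h y u = expR (- a) * expR (a - x).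
    by rewrite -expRD /likelihood /gker -/x; congr expR; ring.
  have e1 := expR_ge0 (- a); have := expR_ge1Dx (a - x) => e2.
  have := ler_wpM2l e1 (_ : 1 + a - (g * (ky ^+ 2 + 2 * kh ^+ 2) + g * (2 * kh ^+ 2) * enorm u ^+ 2) <= expR (a - x)).
  by move=> H; apply: le_trans (H _); [rewrite le_eqVlt; apply/orP; left; apply/eqP; ring|lra].
have ic c : q.-integrable setT (EFin \o (cst c : 'cV[R]_n -> R)).
  by apply: Lall_integrable; exact: Lall_cst.
have iZ c : q.-integrable setT (EFin \o (fun u : 'cV[R]_n => c * enorm u ^+ 2)).
  by have := integrableZl measurableT c ie.
have il := likelihood_integrable q y mh.
have := @le_mean _ _ _ q _ _ _ il lge.
move=> /(_ (integrableB measurableT (ic _) (iZ _))).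
rewrite (meanB (f := cst _)) ?mean_cst ?meanZ//; apply: le_trans.
have e1 := expR_ge0 (- a).
rewrite -[leLHS]mulr1 -mulrA -mulrBr ler_wpM2l//.
have h2 : g * (2 * kh ^+ 2) * mean q (fun u => enorm u ^+ 2) <= g * (2 * kh ^+ 2) * M.
  rewrite ler_wpM2l// mulr_ge0// mulr_ge0//; exact: sqr_ge0.
nra.
Qed.

Definition transition (Psi : 'cV[R]_n -> 'cV[R]_n) (F : 'cV[R]_n -> R) (v : 'cV[R]_n) : R :=
  mean NS (fun x => F (Psi v + x)).

Let s2 := mean NS (fun x => enorm x ^+ 2).

Let noise_sq : (\int[NS]_x (enorm x ^+ 2)%:E = s2%:E)%E.
Proof.
by rewrite EFin_mean//; apply/Lall_integrable/LallX; exact: noise_Lall_enorm sSigma nS.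
Qed.

Lemma transition_bound k Psi (F : 'cV[R]_n -> R) v : linear_growth k Psi -> measurable_fun setT F ->
  (forall x, 0 <= F x <= weight x) ->
  (\int[NS]_x (F (Psi v + x))%:E = (transition Psi F v)%:E)%E /\
  0 <= transition Psi F v <= (1 + 4 * k ^+ 2 + 2 * s2) * weight v.
Proof.
move=> gk mF F0.
have mG : measurable_fun setT (fun x => F (Psi v + x)).
  by apply: (measurableT_comp mF); exact: measurable_cV_add.
have w1 := weight_ge1 v.
have [|||fi b] := @ge0_mean_bound _ _ _ NS _
    (fun x => (1 + 4 * k ^+ 2) * weight v + 2 * enorm x ^+ 2)
    ((1 + 4 * k ^+ 2) * weight v + 2 * s2) mG.
- by move=> x; have /andP[] := F0 (Psi v + x).
- by move=> x; have /andP[_ h] := F0 (Psi v + x); exact: le_trans h (weight_growth v x gk).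
- under eq_integral do rewrite EFinD EFinM.
  rewrite ge0_integralD//; last 3 first.
  + by move=> x _; rewrite -EFinM lee_fin; have := sqr_ge0 k; nra.
  + by move=> x _; rewrite lee_fin mulr_ge0// sqr_ge0.
  + apply/measurable_EFinP; apply: measurable_funM => //; apply: measurable_funX.
    exact: measurable_enorm.
  rewrite integral_cst// [X in (_ * X + _)%E]probability_setT mule1.
  under [X in (_ + X)%E]eq_integral do rewrite EFinM.
  rewrite ge0_integralZl//; last 2 first.
  + by apply/measurable_EFinP; apply: measurable_funX; exact: measurable_enorm.
  + by move=> x _; rewrite lee_fin sqr_ge0.
  by rewrite noise_sq -!EFinM -EFinD.
split; first by rewrite (EFin_mean fi).
move: b => /andP[b1 b2]; rewrite /transition b1/= (le_trans b2)//.
have : 0 <= s2 by apply: mean_ge0 => x; exact: sqr_ge0.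
nra.
Qed.

Lemma measurable_transition k Psi (F : 'cV[R]_n -> R) : linear_growth k Psi -> measurable_fun setT Psi ->
  measurable_fun setT F ->
  (forall x, 0 <= F x <= weight x) -> measurable_fun setT (transition Psi F).
Proof.
move=> gk mPsi mF F0; apply/measurable_EFinP.
rewrite (_ : EFin \o _ = fun v => (\int[NS]_x (F (Psi v + x))%:E)%E); last first.
  by apply/funext => v; have [-> _] := transition_bound v gk mF F0.
apply: (measurable_fun_fubini_tonelli_F (fun z : 'cV[R]_n * 'cV[R]_n => (F (Psi z.1 + z.2))%:E)).
  apply/measurable_EFinP; apply: (measurableT_comp mF); apply: measurable_cV_add => //.
  exact: (measurableT_comp mPsi).
by move=> z; rewrite lee_fin; have /andP[] := F0 (Psi z.1 + z.2).
Qed.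

Definition pred_moment k M := (1 + 4 * k ^+ 2 + 2 * s2) * (1 + M).

Definition evidence_cst k kh ky M :=
  nrm1 (invmx Gamma) * (ky ^+ 2 + 2 * kh ^+ 2 * (1 + pred_moment k M)).

(** Conditioning multiplies by a likelihood at most 1 and divides by an evidence at least
    [expR (- evidence_cst k kh ky M)]. *)
Definition post_moment k kh ky M := expR (evidence_cst k kh ky M) * pred_moment k M.

(** The posterior mean is rewritten as a ratio of integrals against the previous law, so that two
    filters can be compared through [transition] alone, without their densities. *)
Lemma filter_step (Psi : 'cV[R]_n -> 'cV[R]_n) (h : 'cV[R]_n -> 'cV[R]_m) y
    (tf : set 'cV[R]_n -> \bar R) (mu : probability 'cV[R]_n R) k kh ky M :
  measurable_fun setT Psi -> linear_growth k Psi ->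
  measurable_fun setT h -> linear_growth kh h -> enorm y <= ky ->
  (forall A, measurable A -> tf A = mu A) ->
  (\int[mu]_u (enorm u ^+ 2)%:E <= M%:E)%E ->
  let l := likelihood h y in
  let z := mean mu (transition Psi l) in
  exists mu' : probability 'cV[R]_n R,
  [/\ forall A, of_density (opB y (opQ h Gamma (opP Psi Sigma tf))) A = mu' A,
      (\int[mu']_u (enorm u ^+ 2)%:E <= (post_moment k kh ky M)%:E)%E,
      expR (- evidence_cst k kh ky M) <= z &
      forall f : 'cV[R]_n -> R, measurable_fun setT f -> (forall x, 0 <= f x <= weight x) ->
        mean mu' f = z^-1 * mean mu (transition Psi (fun x => f x * l x))].
Proof.
move=> mPsi gPsi mh gh yk tfE muM l z.
have [q [mp p0 qL qE]] := prediction_law mPsi tfE.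
have l0 u : 0 <= l u by exact: likelihood_ge0.
have l1 u : l u <= 1 by exact: likelihood_le1.
have ml : measurable_fun setT l by exact: measurable_likelihood.
have tE (F : 'cV[R]_n -> R) : measurable_fun setT F -> (forall x, 0 <= F x <= weight x) ->
    (\int[q]_u (F u)%:E = \int[mu]_v (transition Psi F v)%:E)%E.
  move=> mF F0; rewrite (qE (EFin \o F)); last 2 first.
  - exact/measurable_EFinP.
  - by move=> u; rewrite /= lee_fin; have /andP[] := F0 u.
  by apply: eq_integral => v _; have [] := transition_bound v gPsi mF F0.
have wl x : 0 <= weight (x : 'cV[R]_n) <= weight x.
  by rewrite lexx (le_trans _ (weight_ge1 x)).
have mw : measurable_fun setT (@weight R n) by exact: measurable_weight.
have ll x : 0 <= l x <= weight x by rewrite l0 (le_trans (l1 x))// weight_ge1.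
have c0 : 0 <= 1 + 4 * k ^+ 2 + 2 * s2.
  have : 0 <= s2 by apply: mean_ge0 => x; exact: sqr_ge0.
  by have := sqr_ge0 k; lra.
have qw : (\int[q]_u (weight u)%:E <= (pred_moment k M)%:E)%E.
  rewrite (tE _ mw wl); apply: (@le_trans _ _ (\int[mu]_v ((1 + 4 * k ^+ 2 + 2 * s2)%:E * (weight v)%:E))%E).
    apply: le_integral_ge0 => v; have [_ /andP[a b]] := transition_bound v gPsi mw wl.
      by rewrite lee_fin.
    by rewrite -EFinM lee_fin.
  rewrite ge0_integralZl//; last 2 first.
  - exact/measurable_EFinP.
  - by move=> x _; rewrite lee_fin; have /andP[] := wl x.
  rewrite /pred_moment EFinM; apply: lee_wpmul2l; first by rewrite lee_fin.
  exact: integral_weight_le.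
have q2 : (\int[q]_u (enorm u ^+ 2)%:E <= (pred_moment k M)%:E)%E.
  apply: le_trans qw; apply: le_integral_ge0 => u; rewrite lee_fin ?sqr_ge0//.
  by rewrite /weight lerDr.
have zE : z = mean q l by rewrite /z /mean (tE _ ml ll).
have zge : expR (- evidence_cst k kh ky M) <= z.
  by rewrite zE; exact: (likelihood_mean_ge _ _ _ q2 (lexx _)).
have z0 : 0 < z := lt_le_trans (expR_gt0 _) zge.
have [|mu' [mu'E mu'f]] := bayes_law (y := y) mh mp p0 qL; first by rewrite -zE.
have zi : z^-1 <= expR (evidence_cst k kh ky M).
  by rewrite -[leRHS]invrK -expRN lef_pV2// posrE ?expR_gt0.
exists mu'; split => //.
- rewrite mu'f; [|by apply: measurable_funX; exact: measurable_enorm|by move=> x; exact: sqr_ge0].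
  rewrite -zE /post_moment EFinM; apply: lee_pmul.
  + by rewrite lee_fin invr_ge0 ltW.
  + by apply: integral_ge0 => u _; rewrite lee_fin mulr_ge0 ?sqr_ge0.
  + by rewrite lee_fin.
  apply: le_trans q2; apply: le_integral_ge0 => u; rewrite lee_fin.
    exact: mulr_ge0 (sqr_ge0 _) (l0 u).
  by rewrite ler_piMr// sqr_ge0.
- move=> f mf f0.
  rewrite /mean mu'f => [||x]; [|by []|by have /andP[] := f0 x].
  rewrite -zE fineZ tE//; first exact: measurable_funM.
  move=> x; have /andP[a b] := f0 x; rewrite mulr_ge0//=.
  by rewrite (le_trans _ b)// ler_piMr.
Qed.

(** Weighted total variation up to a factor at most 2: signed test functions are recovered from
    positive and negative parts. With nonnegative tests all integrals stay in the nonnegative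
    theory. *)
Definition weakly_close (mu nu : probability 'cV[R]_n R) (c : R) :=
  forall f : 'cV[R]_n -> R, measurable_fun setT f -> (forall x, 0 <= f x <= weight x) ->
    `|mean mu f - mean nu f| <= c.

Definition transition_cst k M D :=
  (1 + 4 * k ^+ 2 + 2 * s2) * D +
  (3 + 4 * k ^+ 2) * mean NS (shift_weight Sigma) * (1 + M).

(** Triangle inequality through [mean nu (transition Psi F)]: the first term of [transition_cst]
    transports the distance between the laws, the second is created by the change of model. *)
Lemma transition_close (Psi Psi0 : 'cV[R]_n -> 'cV[R]_n) (mu nu : probability 'cV[R]_n R)
    (F : 'cV[R]_n -> R) k M D e :
  measurable_fun setT Psi -> measurable_fun setT Psi0 ->
  linear_growth k Psi -> linear_growth k Psi0 ->
  0 <= e <= 1 -> (forall u, enorm (Psi u - Psi0 u) <= e) ->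
  (\int[mu]_u (enorm u ^+ 2)%:E <= M%:E)%E -> (\int[nu]_u (enorm u ^+ 2)%:E <= M%:E)%E ->
  weakly_close mu nu (e * D) ->
  measurable_fun setT F -> (forall x, 0 <= F x <= weight x) ->
  `|mean mu (transition Psi F) - mean nu (transition Psi0 F)| <= e * transition_cst k M D.
Proof.
move=> mPsi mPsi0 gP gP0 e01 PP muM nuM mn mF F0; have /andP[e0 e1] := e01.
set c1 := 1 + 4 * k ^+ 2 + 2 * s2.
have c1pos : 0 < c1.
  have : 0 <= s2 by apply: mean_ge0 => x; exact: sqr_ge0.
  by rewrite /c1; have := sqr_ge0 k; lra.
have t1 v : 0 <= transition Psi F v <= c1 * weight v by have [] := transition_bound v gP mF F0.
have t0 v : 0 <= transition Psi0 F v <= c1 * weight v by have [] := transition_bound v gP0 mF F0.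
have mt1 := measurable_transition gP mPsi mF F0.
have mt0 := measurable_transition gP0 mPsi0 mF F0.
(* The division by [c1] makes the transition of [F] an admissible test function for
   [weakly_close]. *)
pose G v := c1^-1 * transition Psi F v.
have G01 v : 0 <= G v <= weight v.
  have /andP[a b] := t1 v; rewrite /G mulr_ge0 ?invr_ge0 ?(ltW c1pos)//=.
  by rewrite mulrC ler_pdivrMr// mulrC.
have mG : measurable_fun setT G by exact: measurable_funM.
have tG v : transition Psi F v = c1 * G v by rewrite /G mulVKf// gt_eqF.
have iw (q : probability 'cV[R]_n R) (f : 'cV[R]_n -> R) : (\int[q]_u (enorm u ^+ 2)%:E <= M%:E)%E ->
    measurable_fun setT f -> (forall v, 0 <= f v <= weight v) ->
    q.-integrable setT (EFin \o f) /\ 0 <= mean q f <= 1 + M.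
  move=> qM mf f0; apply: (ge0_mean_bound mf (g := @weight R n)).
  - by move=> x; have /andP[] := f0 x.
  - by move=> x; have /andP[] := f0 x.
  - exact: integral_weight_le.
have mw : measurable_fun setT (@weight R n) by exact: measurable_weight.
have wl x : 0 <= weight (x : 'cV[R]_n) <= weight x.
  by rewrite lexx (le_trans _ (weight_ge1 x)).
have [iGmu _] := iw _ _ muM mG G01; have [iGnu _] := iw _ _ nuM mG G01.
have [iwnu /andP[w0 wM]] := iw _ _ nuM mw wl.
have it0 : nu.-integrable setT (EFin \o transition Psi0 F).
  have [|||i1 i2] := @ge0_mean_bound _ _ _ nu _ (fun v => c1 * weight v) (c1 * (1 + M)) mt0.
  - by move=> v; have /andP[] := t0 v.
  - by move=> v; have /andP[] := t0 v.
  under eq_integral do rewrite EFinM.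
  rewrite ge0_integralZl//; last 3 first.
  - exact/measurable_EFinP.
  - by move=> x _; rewrite lee_fin; have /andP[] := wl x.
  - by rewrite lee_fin ltW.
    by rewrite EFinM; apply: lee_wpmul2l; [rewrite lee_fin ltW|exact: integral_weight_le].
  exact: i1.
have h1 : `|mean mu (transition Psi F) - mean nu (transition Psi F)| <= c1 * (e * D).
  have E1 : mean mu (transition Psi F) = c1 * mean mu G by rewrite -meanZ//; exact: eq_mean.
  have E2 : mean nu (transition Psi F) = c1 * mean nu G by rewrite -meanZ//; exact: eq_mean.
  rewrite E1 E2 -mulrBr normrM (gtr0_norm c1pos).
  by rewrite ler_wpM2l ?(ltW c1pos)//; exact: mn.
have h2 : `|mean nu (transition Psi F) - mean nu (transition Psi0 F)| <=
    e * ((3 + 4 * k ^+ 2) * mean NS (shift_weight Sigma)) * (1 + M).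
  rewrite (eq_mean _ tG) -meanB//; last by have := integrableZl measurableT c1 iGnu.
  set c2 := e * _.
  have c20 : 0 <= c2.
    have : 0 <= mean NS (shift_weight Sigma).
      apply: mean_ge0 => x; rewrite /shift_weight mulr_ge0//.
        by rewrite (le_trans _ (weight_ge1 x)).
      by rewrite !mulr_ge0 ?expR_ge0 ?nrm1_ge0// addr_ge0// enorm_ge0.
    by move=> h; rewrite /c2 !mulr_ge0// addr_ge0// mulr_ge0// sqr_ge0.
  apply: (@le_trans _ _ (c2 * mean nu (@weight R n))); last by rewrite ler_wpM2l.
  rewrite -meanZ//; apply: ler_norm_mean.
  - by apply: measurable_funB => //; exact: measurable_funM.
  - by have := integrableZl measurableT c2 iwnu.
  move=> v; rewrite -tG /transition.
  have := noise_kernel_close sSigma nS v mF F0 gP0 (PP v) e01.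
  rewrite addrCA subrr addr0 => h; apply: le_trans h _.
  by rewrite /c2 le_eqVlt; apply/orP; left; apply/eqP; ring.
have -> : mean mu (transition Psi F) - mean nu (transition Psi0 F) =
  (mean mu (transition Psi F) - mean nu (transition Psi F)) +
  (mean nu (transition Psi F) - mean nu (transition Psi0 F)) by ring.
rewrite (le_trans (ler_normD _ _))// (le_trans (lerD h1 h2))//.
by rewrite /transition_cst -/c1 le_eqVlt; apply/orP; left; apply/eqP; ring.
Qed.

(** The pair [MD] holds a second moment bound and the slope in [e]; the moment bound must be
    propagated along, since the evidence bound and the kernel estimate of the next step depend on
    it. *)
Lemma filter_stability (k kh ky M0 : R) (J : nat) : exists2 MD : R * R, 0 <= MD.2 &
  forall (Psi Psi0 : 'cV[R]_n -> 'cV[R]_n) (h : 'cV[R]_n -> 'cV[R]_m) (y : nat -> 'cV[R]_m)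
    (mu0 : probability 'cV[R]_n R) (e : R),
  measurable_fun setT Psi -> measurable_fun setT Psi0 ->
  linear_growth k Psi -> linear_growth k Psi0 ->
  measurable_fun setT h -> linear_growth kh h ->
  (forall j, (1 <= j <= J)%N -> enorm (y j) <= ky) ->
  0 <= e <= 1 -> (forall u, enorm (Psi u - Psi0 u) <= e) ->
  (\int[mu0]_u (enorm u ^+ 2)%:E <= M0%:E)%E ->
  exists mu nu : probability 'cV[R]_n R,
  [/\ forall A, measurable A -> true_filter Psi h Sigma Gamma y mu0 J A = mu A,
      forall A, measurable A -> true_filter Psi0 h Sigma Gamma y mu0 J A = nu A,
      (\int[mu]_u (enorm u ^+ 2)%:E <= MD.1%:E)%E,
      (\int[nu]_u (enorm u ^+ 2)%:E <= MD.1%:E)%E &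
      weakly_close mu nu (e * MD.2)].
Proof.
elim: J => [|J [[M D] /= D0 ih]].
  exists (M0, 0) => //= Psi Psi0 h y mu0 e _ _ _ _ _ _ _ _ _ mM.
  by exists mu0, mu0; split => // f mf f0; rewrite subrr normr0 mulr0.
set M' := post_moment k kh ky M.
set a := evidence_cst k kh ky M; set D1 := transition_cst k M D.
(* The maximum secures [0 <= MD.2], as [k], [ky] and [M0] range over all reals. *)
exists (M', Num.max 0 (expR a * (D1 * (2 + M')))) => /=; first by rewrite le_max lexx.
move=> Psi Psi0 h y mu0 e mP mP0 gP gP0 mh gh yk e01 PP muM0.
have [|mu [nu [muE nuE muM nuM mn]]] := ih Psi Psi0 h y mu0 e mP mP0 gP gP0 mh gh _ e01 PP muM0.
  by move=> j /andP[j1 jJ]; apply: yk; rewrite j1 (leq_trans jJ).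
have yJ : enorm (y J.+1) <= ky by apply: yk; rewrite leqnn.
have [mu' [mu'E mu'M zge mu'f]] := filter_step mP gP mh gh yJ muE muM.
have [nu' [nu'E nu'M z0ge nu'f]] := filter_step mP0 gP0 mh gh yJ nuE nuM.
set l := likelihood h (y J.+1) in zge mu'f z0ge nu'f.
exists mu', nu'; split; [by move=> A _; exact: mu'E|by move=> A _; exact: nu'E|exact: mu'M|exact: nu'M|].
move=> f mf f0.
have l0 u : 0 <= l u by exact: likelihood_ge0.
have l1 u : l u <= 1 by exact: likelihood_le1.
have ml : measurable_fun setT l by exact: measurable_likelihood.
have ll x : 0 <= l x <= weight x by rewrite l0 (le_trans (l1 x))// weight_ge1.
have fl x : 0 <= f x * l x <= weight x.
  have /andP[u v] := f0 x; rewrite mulr_ge0//= (le_trans _ v)// ler_piMr//.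
have mfl : measurable_fun setT (fun x => f x * l x) by exact: measurable_funM.
have := transition_close mP mP0 gP gP0 e01 PP muM nuM mn ml ll.
have := transition_close mP mP0 gP gP0 e01 PP muM nuM mn mfl fl.
have : 0 <= mean nu' f <= 1 + M'.
  have [|||i1 i2] := @ge0_mean_bound _ _ _ nu' f (@weight R n) (1 + M') mf.
  - by move=> x; have /andP[] := f0 x.
  - by move=> x; have /andP[] := f0 x.
    exact: integral_weight_le.
  exact: i2.
rewrite nu'f// mu'f// -/D1.
move: zge z0ge; rewrite -/a.
move: (mean mu _) (mean mu _) (mean nu _) (mean nu _) => A z B z0 zge z0ge.
have zp : 0 < z := lt_le_trans (expR_gt0 _) zge.
have z0p : 0 < z0 := lt_le_trans (expR_gt0 _) z0ge.
set b := z0^-1 * B => /andP[b0 bM] hA hz.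
have /andP[e0 e1] := e01.
(* In this form the only division is by [z]; the factor [b] is a posterior mean, at most
   [1 + M']. *)
have -> : z^-1 * A - b = z^-1 * ((A - B) + b * (z0 - z)).
  by rewrite /b; field; rewrite !gt_eqF.
have zi : z^-1 <= expR a by rewrite -[leRHS]invrK -expRN lef_pV2// posrE ?expR_gt0.
apply: (@le_trans _ _ (expR a * (e * D1 + (1 + M') * (e * D1)))).
  rewrite normrM; apply: ler_pM => //.
    by rewrite gtr0_norm// invr_gt0.
  rewrite (le_trans (ler_normD _ _))// lerD// normrM (ger0_norm b0).
  by apply: ler_pM => //; rewrite distrC.
apply: (@le_trans _ _ (e * (expR a * (D1 * (2 + M'))))).
  by rewrite le_eqVlt; apply/orP; left; apply/eqP; ring.
by rewrite ler_wpM2l// le_max lexx orbT.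
Qed.

End filter_steps.

(** * Empirical means and covariances *)

Section empirical_means.
Context (R : realType) d (T : measurableType d) (N : nat) (x : 'I_N -> T).

Definition avg (f : 'I_N -> R) : R := N%:R^-1 * \sum_i f i.

(** [empirical] is a bare set function; a measure with the same values is needed to integrate, the
    zero measure when [N = 0]. *)
Let empirical_measure : exists M : {measure set T -> \bar R},
  (forall A, empirical R x A = M A) /\
  forall f : T -> \bar R, measurable_fun setT f -> (forall t, 0 <= f t)%E ->
    (\int[M]_t f t = (N%:R^-1)%:E * \sum_(i < N) f (x i))%E.
Proof.
case: N x => [|k] z.
  exists mzero; split => [A|f _ _]; first by rewrite /empirical big_ord0 mule0.
  by rewrite big_ord0 mule0 integral_measure_zero.
have c0 : 0 <= k.+1%:R^-1 :> R by rewrite invr_ge0.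
pose D (i : nat) : {measure set T -> \bar R} := \d_(z (inord i)).
exists (mscale (NngNum c0) (msum D k.+1)); split => [A|f mf f0].
  rewrite /empirical /mscale /msum/=.
  by congr (_ * _)%E; apply: eq_bigr => i _; rewrite /D inord_val.
rewrite ge0_integral_mscale//= ge0_integral_measure_sum//.
congr (_ * _)%E; apply: eq_bigr => i _.
by rewrite /D inord_val integral_dirac// diracT mul1e.
Qed.

Lemma mean_empirical (f : T -> R) : measurable_fun setT f ->
  mean (empirical R x) f = avg (fun i => f (x i)).
Proof.
move=> mf; have mf' : measurable_fun setT (EFin \o f) by exact/measurable_EFinP.
have [M [ME Mf]] := empirical_measure.
rewrite /mean (@eq_integral_measurable _ _ _ _ M) => [|A _]; last exact: ME.
rewrite integralE (Mf _ (measurable_funepos mf') (fun t => funepos_ge0 _ _)).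
rewrite (Mf _ (measurable_funeneg mf') (fun t => funeneg_ge0 _ _)).
have -> : (\sum_(i < N) (EFin \o f)^\+ (x i) = (\sum_i Num.max (f (x i)) 0)%:E)%E.
  by rewrite -sumEFin; apply: eq_bigr => i _; rewrite funeposE /= EFin_max.
have -> : (\sum_(i < N) (EFin \o f)^\- (x i) = (\sum_i Num.max (- f (x i)) 0)%:E)%E.
  by rewrite -sumEFin; apply: eq_bigr => i _; rewrite funenegE /= EFin_max.
rewrite -!EFinM -EFinB /= -mulrBr -sumrB; congr (_ * _); apply: eq_bigr => i _.
by rewrite /Num.max; case: ifPn => a; case: ifPn => b; lra.
Qed.

End empirical_means.

Section averages.
Context (R : realType) (N : nat).
Implicit Types f g : 'I_N -> R.

Lemma avgD f g : avg (fun l => f l + g l) = avg f + avg g.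
Proof. by rewrite /avg big_split mulrDr. Qed.

Lemma avgZ c f : avg (fun l => c * f l) = c * avg f.
Proof. by rewrite /avg -mulr_sumr mulrCA. Qed.

Lemma avg_cst (c : R) : (0 < N)%N -> avg (fun _ : 'I_N => c) = c.
Proof.
move=> N0; rewrite /avg sumr_const card_ord -(mulr_natl c) mulKf//.
by rewrite pnatr_eq0 -lt0n.
Qed.

Lemma eq_avg f g : f =1 g -> avg f = avg g.
Proof. by move=> fg; congr (_ * _); apply: eq_bigr => l _. Qed.

End averages.

Section empirical_covariance.
Context (R : realType) (N : nat).

Definition vavg n (x : 'I_N -> 'cV[R]_n) : 'cV[R]_n := N%:R^-1 *: \sum_l x l.

Definition ecov m n (x : 'I_N -> 'cV[R]_m) (z : 'I_N -> 'cV[R]_n) : 'M[R]_(m, n) :=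
  N%:R^-1 *: \sum_l (x l - vavg x) *m (z l - vavg z)^T.

Lemma vavgE n (x : 'I_N -> 'cV[R]_n) i : vavg x i 0 = avg (fun l => x l i 0).
Proof. by rewrite /vavg mxE summxE. Qed.

Lemma ecovE m n (x : 'I_N -> 'cV[R]_m) (z : 'I_N -> 'cV[R]_n) i k : ecov x z i k =
  avg (fun l => (x l i 0 - vavg x i 0) * (z l k 0 - vavg z k 0)).
Proof.
rewrite /ecov mxE summxE; congr (_ * _); apply: eq_bigr => l _.
by rewrite mxE big_ord1 !mxE.
Qed.

Lemma vavg_mulmx m n (H : 'M[R]_(m, n)) (x : 'I_N -> 'cV[R]_n) :
  vavg (fun l => H *m x l) = H *m vavg x.
Proof. by rewrite /vavg -scalemxAr mulmx_sumr. Qed.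

Lemma ecov_mulmxr m n p (H : 'M[R]_(p, n)) (x : 'I_N -> 'cV[R]_m) (z : 'I_N -> 'cV[R]_n) :
  ecov x (fun l => H *m z l) = ecov x z *m H^T.
Proof.
rewrite /ecov vavg_mulmx -scalemxAl mulmx_suml; congr (_ *: _).
by apply: eq_bigr => l _; rewrite -mulmxBr trmx_mul mulmxA.
Qed.

Lemma ecov_mulmxl m n p (H : 'M[R]_(p, m)) (x : 'I_N -> 'cV[R]_m) (z : 'I_N -> 'cV[R]_n) :
  ecov (fun l => H *m x l) z = H *m ecov x z.
Proof.
rewrite /ecov vavg_mulmx -[RHS]scalemxAr mulmx_sumr; congr (_ *: _).
by apply: eq_bigr => l _; rewrite -mulmxBr mulmxA.
Qed.

Lemma ecov_psd n (x : 'I_N -> 'cV[R]_n) : psd (ecov x x).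
Proof.
split.
  rewrite /ecov linearZ /= linear_sum; congr (_ *: _); apply: eq_bigr => l _.
  by apply: etrans (trmx_mul _ _) _; rewrite trmxK.
move=> v; rewrite /ecov -scalemxAr -scalemxAl mxE mulr_ge0 ?invr_ge0//.
rewrite mulmx_sumr mulmx_suml summxE; apply: sumr_ge0 => l _.
set b := x l - _; have -> : v^T *m (b *m b^T) *m v = (b^T *m v)^T *m (b^T *m v).
  by rewrite trmx_mul trmxK !mulmxA.
by rewrite mxE big_ord1 mxE -expr2 sqr_ge0.
Qed.

(** The covariance may be centred at any point. With [a] the deterministic mean of the mean-field
    law, independent averages appear, at the price of a product of two averages that are themselves
    small. *)
Lemma ecov_entry n (x : 'I_N -> 'cV[R]_n) (a : 'cV[R]_n) i k : (0 < N)%N ->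
  ecov x x i k = avg (fun l => (x l - a) i 0 * (x l - a) k 0) -
    avg (fun l => (x l - a) i 0) * avg (fun l => (x l - a) k 0).
Proof.
move=> N0; rewrite ecovE.
have e j : vavg x j 0 = a j 0 + avg (fun l => (x l - a) j 0).
  rewrite vavgE -[X in X + _](avg_cst _ N0) -avgD; apply: eq_avg => l.
  by rewrite !mxE; ring.
rewrite !e; set p := avg (fun l => (x l - a) i 0); set q := avg (fun l => (x l - a) k 0).
transitivity (avg (fun l => (x l - a) i 0 * (x l - a) k 0 +
    (- q * (x l - a) i 0 + (- p * (x l - a) k 0 + p * q)))).
  by apply: eq_avg => l; rewrite !mxE; ring.
pose f1 l := (x l - a) i 0 * (x l - a) k 0.
pose f2 l := (x l - a) i 0; pose f3 l := (x l - a) k 0.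
have := avgD f1 (fun l => - q * f2 l + (- p * f3 l + p * q)) => ->.
have := avgD (fun l => - q * f2 l) (fun l => - p * f3 l + p * q) => ->.
have := avgD (fun l => - p * f3 l) (fun=> p * q) => ->.
have := avgZ (- q) f2 => ->; have := avgZ (- p) f3 => ->; have := avg_cst (p * q) N0 => ->.
have -> : avg f2 = p by [].
have -> : avg f3 = q by [].
rewrite -/(avg f1); ring.
Qed.

End empirical_covariance.

Section enkf_gain.
Context (R : realType) (n m N : nat) (H : 'M[R]_(m, n)) (h : 'cV[R]_n -> 'cV[R]_m).
Hypothesis hE : forall u, h u = H *m u.
Variables (x : 'I_N -> 'cV[R]_n) (z : 'I_N -> 'cV[R]_m).
Let rho := empirical R (fun i => (x i, z i)).

Let covE p q (f : 'cV[R]_n -> 'cV[R]_p) (g : 'cV[R]_n -> 'cV[R]_q) :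
  measurable_fun setT f -> measurable_fun setT g ->
  covmx (pushforward rho fst) f g = ecov (fun l => f (x l)) (fun l => g (x l)).
Proof.
move=> mf mg.
have rE : pushforward rho fst = empirical R x by [].
have mcf i : measurable_fun setT (fun u => f u i 0) by exact: measurable_cV_coord.
have mcg i : measurable_fun setT (fun u => g u i 0) by exact: measurable_cV_coord.
apply/matrixP => i k; rewrite mxE rE ecovE !vavgE.
rewrite (mean_empirical x (mcf i)) (mean_empirical x (mcg k)) mean_empirical//.
by apply: measurable_funM; apply: measurable_funB.
Qed.

Let mh : measurable_fun setT h.
Proof. by rewrite (_ : h = fun u => H *m u); [exact: measurable_cV_mulmx|exact/funext]. Qed.

Lemma cov_uhE : cov_uh h rho = ecov x x *m H^T.
Proof.
rewrite /cov_uh covE//; under [X in ecov _ X]eq_fun do rewrite hE.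
exact: ecov_mulmxr.
Qed.

Lemma cov_hhE : cov_hh h rho = H *m ecov x x *m H^T.
Proof.
rewrite /cov_hh covE//; have -> : (fun l => h (x l)) = (fun l => H *m x l) by exact/funext.
by rewrite ecov_mulmxl ecov_mulmxr mulmxA.
Qed.

End enkf_gain.

(** * Families of ensembles *)

(** Size and probability space are packed so that both may vary with an index, after the constants
    have been chosen. *)
Record ensemble (R : realType) := Ensemble {
  ens_size : nat ;
  ens_pos : (0 < ens_size)%N ;
  ens_disp : measure_display ;
  ens_space : measurableType ens_disp ;
  ens_prob : probability ens_space R }.

Section uniform_tameness.
Context (R : realType) (T : Type) (E : T -> ensemble R).
Let N t := ens_size (E t).
Let Omega t := ens_space (E t).
Let P t := ens_prob (E t).
Implicit Types X Y : forall t, 'I_(N t) -> Omega t -> R.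

(* One and the same constant for all the particles of all the ensembles of the
   family, so that the constants produced are uniform in everything that
   varies with the index [t : T]. *)
Definition utame X := exists C, forall t i, tame (P t) C (X t i).

Lemma utame_le X Y : utame Y -> (forall t i w, `|X t i w| <= Y t i w) -> utame X.
Proof.
move=> [C h] XY; exists C => t i; apply: tame_le (h t i) _ => w.
exact: le_trans (XY t i w) (ler_norm _).
Qed.

Lemma utame_norm X : utame X -> utame (fun t i w => `|X t i w|).
Proof. by move=> [C h]; exists C => t i; exact: tame_norm. Qed.

Lemma utame_cst (c : T -> R) b : (forall t, `|c t| <= b) -> utame (fun t _ _ => c t).
Proof. by move=> cb; exists (fun k => b ^+ k) => t i; exact: tame_cst. Qed.

Lemma utameD X Y : utame X -> utame Y -> utame (fun t i w => X t i w + Y t i w).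
Proof. by move=> [C h] [C' h']; exists (tameD_cst C C') => t i; exact: tameD. Qed.

Lemma utameM X Y : utame X -> utame Y -> utame (fun t i w => X t i w * Y t i w).
Proof. by move=> [C h] [C' h']; exists (tameM_cst C C') => t i; exact: tameM. Qed.

Lemma utameZ (c : T -> R) b X : (forall t, `|c t| <= b) -> utame X ->
  utame (fun t i w => c t * X t i w).
Proof. by move=> cb h; apply: utameM => //; exact: utame_cst cb. Qed.

Lemma utameN X : utame X -> utame (fun t i w => - X t i w).
Proof.
by move=> h; apply: utame_le (utame_norm h) _ => t i w; rewrite normrN.
Qed.

Lemma utame_avg X : utame X -> utame (fun t _ w => avg (fun l => X t l w)).
Proof.
by move=> [C h]; exists C => t i; apply: tame_avg; [exact: ens_pos|exact: h].
Qed.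

Lemma utame_sum n (X : 'I_n -> forall t, 'I_(N t) -> Omega t -> R) :
  (forall k, utame (X k)) -> utame (fun t i w => \sum_k X k t i w).
Proof.
move=> h; elim: (index_enum _) => [|k s ih].
  apply: utame_le (@utame_cst (fun=> 0) 0 _) _ => [t|t i w]; first by rewrite normr0.
  by rewrite big_nil normr0.
apply: utame_le (utame_norm (utameD (h k) ih)) _ => t i w.
by rewrite big_cons.
Qed.

Lemma utame_nrm1 m n (A : forall t, 'I_(N t) -> Omega t -> 'M[R]_(m, n)) :
  (forall i k, utame (fun t l w => A t l w i k)) -> utame (fun t l w => nrm1 (A t l w)).
Proof. by move=> h; do 2 apply: utame_sum => ?; exact: utame_norm. Qed.

Lemma utame_entry m n (A : forall t, 'I_(N t) -> Omega t -> 'M[R]_(m, n)) i k :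
  utame (fun t l w => nrm1 (A t l w)) -> utame (fun t l w => A t l w i k).
Proof. by move=> h; apply: utame_le h _ => t l w; exact: ler_nrm1. Qed.

Lemma utame_mean X : (forall t i, measurable_fun setT (X t i)) -> utame X ->
  utame (fun t i _ => mean (P t) (X t i)).
Proof.
move=> mX [C h]; exists (fun k => C 1%N ^+ k) => t i; apply: tame_cst.
exact: tame_mean_le 1 (mX t i) (h t i).
Qed.

Section small.
Variable dl : T -> R.
Hypotheses (dl_ge : forall t, (Num.sqrt (N t)%:R)^-1 <= dl t) (dl_le : forall t, dl t <= 2).

(** This reads [X = O(dl)] in all moments, uniformly over the family. The lower bound on [dl] admits
    Monte Carlo errors; the upper bound makes small variables tame. *)
Definition usmall X := utame (fun t i w => (dl t)^-1 * X t i w).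

Let dl_gt0 t : 0 < dl t.
Proof. by apply: lt_le_trans (dl_ge t); rewrite invr_gt0 sqrtr_gt0 ltr0n ens_pos. Qed.

Lemma usmall_utame X : usmall X -> utame X.
Proof.
move=> h; have d2 t : `|dl t| <= 2 by rewrite gtr0_norm.
apply: utame_le (utame_norm (utameZ d2 h)) _ => t i w.
by rewrite mulVKf// gt_eqF.
Qed.

Lemma usmall_le X Y : usmall Y -> (forall t i w, `|X t i w| <= Y t i w) -> usmall X.
Proof.
move=> h XY; apply: utame_le h _ => t i w.
by rewrite normrM gtr0_norm ?invr_gt0// ler_wpM2l// invr_ge0 ltW.
Qed.

Lemma usmall_norm X : usmall X -> usmall (fun t i w => `|X t i w|).
Proof.
move=> h; apply: utame_le (utame_norm h) _ => t i w.
by rewrite !normrM normr_id.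
Qed.

Lemma usmallD X Y : usmall X -> usmall Y -> usmall (fun t i w => X t i w + Y t i w).
Proof.
move=> h1 h2; apply: utame_le (utame_norm (utameD h1 h2)) _ => t i w.
by rewrite mulrDr.
Qed.

Lemma usmallM X Y : usmall X -> utame Y -> usmall (fun t i w => X t i w * Y t i w).
Proof.
move=> h1 h2; apply: utame_le (utame_norm (utameM h1 h2)) _ => t i w.
by rewrite mulrA.
Qed.

Lemma usmallMl X Y : utame X -> usmall Y -> usmall (fun t i w => X t i w * Y t i w).
Proof.
move=> h1 h2; apply: utame_le (utame_norm (utameM h1 h2)) _ => t i w.
by rewrite mulrCA.
Qed.

Lemma usmall_avg X : usmall X -> usmall (fun t _ w => avg (fun l => X t l w)).
Proof.
move=> h; apply: utame_le (utame_norm (utame_avg h)) _ => t i w.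
by rewrite /= avgZ.
Qed.

Lemma usmall_sum n (X : 'I_n -> forall t, 'I_(N t) -> Omega t -> R) :
  (forall k, usmall (X k)) -> usmall (fun t i w => \sum_k X k t i w).
Proof.
move=> h; apply: utame_le (utame_norm (utame_sum h)) _ => t i w.
by rewrite mulr_sumr.
Qed.

Lemma usmall_nrm1 m n (A : forall t, 'I_(N t) -> Omega t -> 'M[R]_(m, n)) :
  (forall i k, usmall (fun t l w => A t l w i k)) -> usmall (fun t l w => nrm1 (A t l w)).
Proof. by move=> h; do 2 apply: usmall_sum => ?; exact: usmall_norm. Qed.

Lemma usmall_cst (c : T -> R) : (forall t, `|c t| <= dl t) -> usmall (fun t _ _ => c t).
Proof.
move=> cb; apply: (@utame_cst _ 1) => t.
by rewrite normrM gtr0_norm ?invr_gt0// mulrC ler_pdivrMr// mul1r.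
Qed.

Lemma usmall_monte_carlo X : utame X ->
  (forall t i, measurable_fun setT (X t i)) -> (forall t i, mean (P t) (X t i) = 0) ->
  (forall t (n : 'I_(N t)) a b,
    mean (P t) (fun w => (\sum_(l < N t | (l < n)%N) X t l w) ^+ a * X t n w ^+ b) =
    mean (P t) (fun w => (\sum_(l < N t | (l < n)%N) X t l w) ^+ a) *
    mean (P t) (fun w => X t n w ^+ b)) ->
  usmall (fun t _ w => avg (fun l => X t l w)).
Proof.
move=> [C h] mX X0 Xind; have [C' hC'] := tame_monte_carlo C.
(* The Monte Carlo bound is about sequences; indices beyond the ensemble are sent to particle 0 and
   never enter the sums. *)
pose Xn t (k : nat) w := X t (insubd (Ordinal (ens_pos (E t))) k) w.
have XnE t (l : 'I_(N t)) : Xn t l = X t l by apply/funext => w; rewrite /Xn valKd.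
have sumE t (n : nat) w : (n <= N t)%N ->
    \sum_(l < n) Xn t l w = \sum_(l < N t | (l < n)%N) X t l w.
  move=> nN; rewrite (big_ord_widen _ (fun k => Xn t k w) nN).
  by apply: eq_bigr => l _; rewrite XnE.
have mc : utame (fun t _ w => Num.sqrt (N t)%:R * avg (fun l => X t l w)).
  exists C' => t i.
  have := hC' _ (Omega t) (P t) (N t) (Xn t) (ens_pos (E t)).
  have -> : (fun w => Num.sqrt (N t)%:R * ((N t)%:R^-1 * \sum_(l < N t) Xn t l w)) =
      (fun w => Num.sqrt (N t)%:R * avg (fun l => X t l w)).
    by apply/funext => w; rewrite /avg; congr (_ * (_ * _)); apply: eq_bigr => l _; rewrite XnE.
  apply => [k|k|k kN|n a b nN]; [exact: mX|exact: h|exact: X0|].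
  have -> : (fun w => (\sum_(l < n) Xn t l w) ^+ a * Xn t n w ^+ b) =
      (fun w => (\sum_(l < N t | (l < Ordinal nN)%N) X t l w) ^+ a * X t (Ordinal nN) w ^+ b).
    by apply/funext => w; rewrite sumE ?(ltnW nN)//= -(XnE t (Ordinal nN)).
  rewrite Xind; congr (_ * _); congr mean; apply/funext => w.
    by rewrite sumE// ltnW.
  by rewrite -(XnE t (Ordinal nN)).
have c1 t : `|(dl t)^-1 * (Num.sqrt (N t)%:R)^-1| <= 1.
  have s0 : 0 < Num.sqrt (N t)%:R :> R by rewrite sqrtr_gt0 ltr0n ens_pos.
  rewrite ger0_norm ?mulr_ge0 ?invr_ge0 ?(ltW s0) ?(ltW (dl_gt0 t))//.
  by rewrite mulrC ler_pdivrMr ?dl_gt0// mul1r dl_ge.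
apply: utame_le (utame_norm (utameZ c1 mc)) _ => t i w.
have s0 : 0 < Num.sqrt (N t)%:R :> R by rewrite sqrtr_gt0 ltr0n ens_pos.
by rewrite -mulrA mulKf// gt_eqF.
Qed.

End small.

End uniform_tameness.

Section independent_particles.
Context (R : realType) (du dy N J : nat).
Context d (Omega : measurableType d) (P : probability Omega R).
Variables (mu0 : probability 'cV[R]_du R) (Sigma : 'M[R]_du) (Gamma : 'M[R]_dy).
Variables (u0 : 'I_N -> {RV P >-> 'cV[R]_du})
  (xi : nat -> 'I_N -> {RV P >-> 'cV[R]_du})
  (eta : nat -> 'I_N -> {RV P >-> 'cV[R]_dy}).
Hypothesis inputs : enkf_inputs J mu0 Sigma Gamma u0 xi eta.

(** Particles with index below [n] only use sources disjoint from those of particle [n]. This is the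
    factorisation required by the Monte Carlo bound. *)
Lemma particles_factor (X : 'I_N -> Omega -> R) :
  (forall i, dep u0 xi eta (past J J i) (X i)) -> (forall i, Lall P (X i)) ->
  forall (n : 'I_N) a b,
    mean P (fun w => (\sum_(l < N | (l < n)%N) X l w) ^+ a * X n w ^+ b) =
    mean P (fun w => (\sum_(l < N | (l < n)%N) X l w) ^+ a) * mean P (fun w => X n w ^+ b).
Proof.
move=> dX LX n a b.
pose K : {set source N J} := finset (fun s : source N J => match s with
    | inl (inl i) => (i < n)%N | inl (inr ki) => (ki.2 < n)%N | inr ki => (ki.2 < n)%N end).
have KL : [disjoint K & past J J n]%B.
  apply/pred0P => s /=; rewrite !inE.
  by case: s => [[i|[k i]]|[k i]] /=; case: eqP => [->|_]; rewrite ?ltnn ?andbF.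
have dS : dep u0 xi eta K (fun w => \sum_(l < N | (l < n)%N) X l w).
  under eq_fun do rewrite big_mkcond/=.
  have h (l : 'I_N) : dep u0 xi eta K (fun w => if (l < n)%N then X l w else 0); last exact: measurable_sum h.
  case: (boolP (l < n)%N) => ln; last exact: measurable_cst.
  apply: dep_sub (dX l); apply/fintype.subsetP => s; rewrite !inE.
  by case: s => [[i|[k i]]|[k i]] /=; rewrite ?ltn_ord/= => /eqP ->.
apply: (independent_meanM (measurable_src u0 xi eta) (inputs_indep inputs) KL).
- exact: measurable_funX.
- exact: measurable_funX (dX n).
- apply: LallX; under eq_fun do rewrite big_mkcond/=.
  by apply: Lall_sum => l; case: (boolP (l < n)%N) => _ //; exact: Lall_cst.
- exact: LallX.
Qed.

End independent_particles.

(** * Coupling with the mean-field particles *)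

Section gains.
Context (R : realType) (n m : nat) (Gamma : 'M[R]_m) (g : R) (H : 'M[R]_(m, n)).
Hypotheses (g0 : 0 < g) (gP : psd_le g%:M Gamma).
Let r := m%:R ^+ 2 / g.

(** [H C H^T] is positive semidefinite, so [g] stays a lower bound of the quadratic form and
    [inv_entry_bound] gives the same [r] for every [C]. *)
Let innov_inv (C : 'M[R]_n) : psd C ->
  Gamma + H *m C *m H^T \in unitmx /\ nrm1 (invmx (Gamma + H *m C *m H^T)) <= r.
Proof.
move=> pC; have [tG qG] := gP; have [tC qC] := psd_conjT H pC.
have lo (x : 'cV[R]_m) : g * enorm x ^+ 2 <= qf (Gamma + H *m C *m H^T) x.
  rewrite qfDm -qf_scalar; have := qC x; have := qG x.
  rewrite -!/(qf _ _) qfDm (_ : - g%:M = (- g)%:M); last by rewrite raddfN.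
  by rewrite !qf_scalar; lra.
have u : Gamma + H *m C *m H^T \in unitmx.
  apply: spd_unit; split.
    rewrite linearD/= tC; congr (_ + _).
    by have := congr1 (fun A => A + g%:M) tG; rewrite linearB/= tr_scalar_mx !subrK.
  move=> x x0; apply: lt_le_trans (lo x).
  rewrite mulr_gt0// exprn_gt0// lt_neqAle enorm_ge0 andbT eq_sym.
  apply: contra x0 => /eqP e; apply/eqP/colP => i; rewrite mxE.
  by apply/eqP; rewrite -normr_eq0 eq_le normr_ge0 andbT -e ler_enorm.
by split => //; exact: inv_entry_bound.
Qed.

Lemma gain_le (C : 'M[R]_n) : psd C -> nrm1 (kgain_of Gamma H C) <= nrm1 C * nrm1 H * r.
Proof.
move=> pC; have [_ b] := innov_inv pC; rewrite /kgain_of.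
apply: le_trans (nrm1M _ _) _; apply: ler_pM; rewrite ?nrm1_ge0//.
by apply: le_trans (nrm1M _ _) _; rewrite nrm1_tr.
Qed.

(** By the resolvent identity the difference of the inverses is linear in [C' - C]. As [r] bounds
    both inverses, the factor involves [C] only: the random empirical covariance, taken as [C'],
    enters through the difference alone. *)
Lemma gain_close (C C' : 'M[R]_n) : psd C -> psd C' ->
  nrm1 (kgain_of Gamma H C' - kgain_of Gamma H C) <=
  nrm1 (C' - C) * (nrm1 H * r + nrm1 C * nrm1 H * (r * (nrm1 H * nrm1 H) * r)).
Proof.
move=> pC pC'; have [u b] := innov_inv pC; have [u' b'] := innov_inv pC'.
rewrite /kgain_of; set S := Gamma + _ in u b *; set S' := Gamma + _ in u' b' *.
have e : invmx S' - invmx S = invmx S' *m (H *m (C - C') *m H^T) *m invmx S.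
  have -> : H *m (C - C') *m H^T = S - S'.
    by rewrite mulmxBr mulmxBl /S /S' opprD addrACA subrr add0r.
  by rewrite mulmxBr mulmxBl mulVmx// mul1mx -mulmxA mulmxV// mulmx1.
have -> : C' *m H^T *m invmx S' - C *m H^T *m invmx S =
    (C' - C) *m H^T *m invmx S' + C *m H^T *m (invmx S' - invmx S).
  by rewrite mulmxBr !mulmxBl addrA subrK.
have dC : nrm1 (C - C') = nrm1 (C' - C) by rewrite -nrm1N opprB.
apply: le_trans (nrm1D _ _) _; rewrite mulrDr; apply: lerD.
  rewrite mulrA; apply: le_trans (nrm1M _ _) _; apply: ler_pM; rewrite ?nrm1_ge0//.
  by apply: le_trans (nrm1M _ _) _; rewrite nrm1_tr.
apply: le_trans (nrm1M _ _) _.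
rewrite mulrCA; apply: ler_pM; rewrite ?nrm1_ge0//.
  by apply: le_trans (nrm1M _ _) _; rewrite nrm1_tr.
rewrite e -dC.
apply: (@le_trans _ _ (r * (nrm1 H * nrm1 (C - C') * nrm1 H) * r)); last first.
  by rewrite le_eqVlt; apply/orP; left; apply/eqP; ring.
apply: le_trans (nrm1M _ _) _; apply: ler_pM; rewrite ?nrm1_ge0//.
apply: le_trans (nrm1M _ _) _; apply: ler_pM; rewrite ?nrm1_ge0//.
apply: le_trans (nrm1M _ _) _; rewrite nrm1_tr ler_wpM2r ?nrm1_ge0//.
exact: nrm1M.
Qed.

End gains.

Section coupling.
Context (R : realType) (n m : nat) (Sigma : 'M[R]_n) (Gamma : 'M[R]_m).
Context (NS : probability 'cV[R]_n R) (NG : probability 'cV[R]_m R).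
Context (J : nat) (ky kh kP lP g Lp Rp : R) (C0 : nat -> R).

(* All the data that the constant of the theorem may not depend on. *)
Record setting := Setting {
  st_ens :> ensemble R ;
  st_mu0 : probability 'cV[R]_n R ;
  st_u0 : 'I_(ens_size st_ens) -> {RV (ens_prob st_ens) >-> 'cV[R]_n} ;
  st_xi : nat -> 'I_(ens_size st_ens) -> {RV (ens_prob st_ens) >-> 'cV[R]_n} ;
  st_eta : nat -> 'I_(ens_size st_ens) -> {RV (ens_prob st_ens) >-> 'cV[R]_m} ;
  st_inputs : enkf_inputs J st_mu0 Sigma Gamma st_u0 st_xi st_eta ;
  st_u0_tame : forall i, tame (ens_prob st_ens) C0 (fun w => nrm1 (st_u0 i w)) ;
  st_y : nat -> 'cV[R]_m ;
  st_y_le : forall j, (1 <= j <= J)%N -> enorm (st_y j) <= ky ;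
  st_h : 'cV[R]_n -> 'cV[R]_m ;
  st_H : 'M[R]_(m, n) ;
  st_hE : forall u, st_h u = st_H *m u ;
  st_h_growth : linear_growth kh st_h ;
  st_Psi0 : 'cV[R]_n -> 'cV[R]_n ;
  st_L : 'M[R]_n ;
  st_b : 'cV[R]_n ;
  st_Psi0E : forall u, st_Psi0 u = st_L *m u + st_b ;
  st_Psi0_growth : linear_growth kP st_Psi0 ;
  st_Psi : 'cV[R]_n -> 'cV[R]_n ;
  st_lip : lipschitz_with lP st_Psi ;
  st_eps : R ;
  st_eps01 : 0 <= st_eps <= 1 ;
  st_close : forall u, enorm (st_Psi u - st_Psi0 u) <= st_eps ;
  st_m0 : 'cV[R]_n ;
  st_A0 : 'M[R]_n ;
  st_NI : probability 'cV[R]_n R ;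
  st_c0 : R ;
  st_gNI : gaussian_law st_NI st_c0 0 1%:M ;
  st_mu0E : forall A, measurable A ->
    st_mu0 A = st_NI ((fun z => st_m0 + st_A0 *m z) @^-1` A) ;
  st_phi : 'cV[R]_n -> R ;
  st_phi_lip : forall x z,
    `|st_phi x - st_phi z| <= Lp * enorm (x - z) * (1 + enorm x + enorm z) ;
  st_phi_growth : forall x, `|st_phi x| <= Rp * (1 + enorm x ^+ 2) }.

Hypotheses (sSigma : spd Sigma) (sGamma : spd Gamma)
  (nS : is_noise Sigma NS) (nG : is_noise Gamma NG) (g0 : 0 < g)
  (gP : psd_le g%:M Gamma) (kP0 : 0 <= kP) (lP0 : 0 <= lP)
  (Lp0 : 0 <= Lp) (Rp0 : 0 < Rp).

Let E (t : setting) : ensemble R := st_ens t.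
Let N t := ens_size (E t).
Let Om t := ens_space (E t).
Let P t := ens_prob (E t).
Let gain t := kgain Sigma Gamma (st_L t) (st_b t) (st_H t) (st_y t) (st_m0 t) (st_A0 t).
Let C t := kcov Sigma Gamma (st_L t) (st_b t) (st_H t) (st_y t) (st_m0 t) (st_A0 t).
Let a t j := kpred_mean (st_L t) (st_b t)
  (kalman Sigma Gamma (st_L t) (st_b t) (st_H t) (st_y t) (st_m0 t, st_A0 t, 1%:M) j).

Definition st_mf (t : setting) j (i : 'I_(N t)) : Om t -> 'cV[R]_n :=
  mfp (st_u0 (s := t)) (st_xi (s := t)) (st_eta (s := t)) (st_L t) (st_b t) (st_H t) (gain t) (st_y t) j i.
Definition st_mf_hat (t : setting) j (i : 'I_(N t)) : Om t -> 'cV[R]_n :=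
  mfp_hat (st_u0 (s := t)) (st_xi (s := t)) (st_eta (s := t)) (st_L t) (st_b t) (st_H t) (gain t) (st_y t) j i.
Definition st_enkf (t : setting) j (i : 'I_(N t)) (w : Om t) : 'cV[R]_n :=
  enkf (st_Psi t) (st_h t) Gamma (st_y t) (fun i => st_u0 i w)
    (fun j i => st_xi j i w) (fun j i => st_eta j i w) j i.
Definition st_enkf_hat (t : setting) j (i : 'I_(N t)) (w : Om t) : 'cV[R]_n :=
  st_Psi t (st_enkf j i w) + st_xi j i w.

Definition st_dl (t : setting) : R := (Num.sqrt (N t)%:R)^-1 + st_eps t.

Let v := st_mf.
Let vh := st_mf_hat.
Let u := st_enkf.
Let uh := st_enkf_hat.

Lemma st_dl_ge t : (Num.sqrt (N t)%:R)^-1 <= st_dl t.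
Proof. by rewrite lerDl; have /andP[] := st_eps01 t. Qed.

Lemma st_dl_le t : st_dl t <= 2.
Proof.
have /andP[_ e] := st_eps01 t; rewrite /st_dl (_ : 2 = 1 + 1)//; apply: lerD => //.
rewrite invf_le1 ?sqrtr_gt0 ?ltr0n ?ens_pos// -[leLHS]sqrtr1 ler_sqrt ?ler0n//.
by rewrite (ler_nat R 1) ens_pos.
Qed.

Let ut := @utame R setting E.
Let us := @usmall R setting E st_dl.

Let const_tame (c : setting -> R) b' : (forall t, `|c t| <= b') -> ut (fun t _ _ => c t).
Proof. exact: utame_cst. Qed.

Let eps_small : us (fun t _ _ => st_eps t).
Proof.
apply: usmall_cst; first exact: st_dl_ge.
move=> t; have /andP[e0 _] := st_eps01 t; rewrite ger0_norm// lerDr.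
by rewrite invr_ge0 sqrtr_ge0.
Qed.

Let noise_tame p (S : 'M[R]_p) (Q : probability 'cV[R]_p R) : spd S -> is_noise S Q ->
  exists K : nat -> R, forall d (T : measurableType d) (P' : probability T R) (X : {RV P' >-> 'cV[R]_p}),
   (forall f : 'cV[R]_p -> \bar R, measurable_fun setT f -> (forall x, 0 <= f x)%E ->
      (\int[P']_w f (X w) = \int[Q]_x f x)%E) -> tame P' K (fun w => nrm1 (X w)).
Proof.
move=> sS nQ.
have L1 : Lall Q (fun x => nrm1 x).
  apply: Lall_le (LallZ p%:R (noise_Lall_enorm sS nQ)) _ => [|x].
    exact: measurable_nrm1.
  by rewrite !ger0_norm ?nrm1_ge0 ?mulr_ge0 ?enorm_ge0// nrm1_le_enorm.
exists (fun k => mean Q (fun x => nrm1 x ^+ k)) => d T P' X XE.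
exists (fun w => nrm1 (X w)); split=> [|w|k].
- by apply: measurable_nrm1; exact: measurable_funPT.
- by rewrite ger0_norm// nrm1_ge0.
rewrite (XE (fun x => (nrm1 x ^+ k)%:E)); last 2 first.
- by apply/measurable_EFinP; apply: measurable_funX; exact: measurable_nrm1.
- by move=> x; rewrite lee_fin exprn_ge0// nrm1_ge0.
by rewrite (EFin_mean (Lall_integrable (LallX k L1))).
Qed.

Let xi_tame j : (j < J)%N -> ut (fun t i w => nrm1 (st_xi (s := t) j i w)).
Proof.
move=> jJ; have [K hK] := noise_tame sSigma nS; exists K => t i.
by apply: hK => f mf f0; exact: xi_law (st_inputs t) NS nS _ _ _ jJ mf f0.
Qed.

Let eta_tame j : (j < J)%N -> ut (fun t i w => nrm1 (st_eta (s := t) j.+1 i w)).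
Proof.
move=> jJ; have [K hK] := noise_tame sGamma nG; exists K => t i.
by apply: hK => f mf f0; exact: eta_law (st_inputs t) NG nG _ _ _ jJ mf f0.
Qed.

Let H_tame : ut (fun t _ _ => nrm1 (st_H t)).
Proof.
apply: (@utame_cst _ _ _ _ (\sum_(i < m) \sum_(k < n) (kh * 2))) => t.
rewrite ger0_norm ?nrm1_ge0//; apply: ler_sum => i _; apply: ler_sum => k _.
(* A column of [st_H t] is the image of a unit vector, of norm at most [kh * (1 + 1)]. *)
have := st_h_growth t (delta_mx k 0); rewrite st_hE -colE.
have -> : enorm (delta_mx k 0 : 'cV[R]_n) = 1.
  rewrite /enorm (bigD1 k)//= mxE !eqxx expr1n big1 ?addr0 ?sqrtr1// => l lk.
  by rewrite mxE (negbTE lk) expr0n.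
by apply: le_trans; have := ler_enorm (col k (st_H t)) i; rewrite mxE.
Qed.

Let y_tame j : (1 <= j <= J)%N -> ut (fun t _ _ => nrm1 (st_y t j)).
Proof.
move=> jJ; apply: (@utame_cst _ _ _ _ (m%:R * ky)) => t.
rewrite ger0_norm ?nrm1_ge0// (le_trans (nrm1_le_enorm _))// ler_wpM2l//.
exact: st_y_le.
Qed.

Let dep_v j t i : (j <= J)%N -> dep (st_u0 (s := t)) (st_xi (s := t)) (st_eta (s := t)) (past J j i) (v j i).
Proof. by move=> jJ; exact: dep_mfp. Qed.

Let past_sub j k t (i : 'I_(N t)) : (j <= k)%N -> past J j i \subset past J k i.
Proof.
move=> jk; apply/fintype.subsetP => s; rewrite !inE.
by case: s => [[i'|[l i']]|[l i']] //= /andP[lj ->]; rewrite (leq_trans lj).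
Qed.

Let dep_vh j t i : (j < J)%N -> dep (st_u0 (s := t)) (st_xi (s := t)) (st_eta (s := t)) (past J J i) (vh j i).
Proof.
move=> jJ; apply: dep_sub (dep_mfp_hat (jJ := jJ) (@dep_v j t i (ltnW jJ))).
apply/fintype.subsetP => s; rewrite in_setU1 => /orP[/eqP ->|].
  by rewrite inE /= jJ eqxx.
by apply/fintype.subsetP/past_sub/ltnW.
Qed.

Let mv j t i : (j <= J)%N -> measurable_fun setT (v (t := t) j i).
Proof. by move=> jJ; exact: measurable_dep (@dep_v j t i jJ). Qed.

Let mvh j t i : (j < J)%N -> measurable_fun setT (vh (t := t) j i).
Proof. by move=> jJ; exact: measurable_dep (@dep_vh j t i jJ). Qed.

Lemma particle_monte_carlo (V : forall t, 'I_(N t) -> Om t -> 'cV[R]_n)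
    (f : setting -> 'cV[R]_n -> R) :
  (forall t i, dep (st_u0 (s := t)) (st_xi (s := t)) (st_eta (s := t)) (past J J i) (V t i)) ->
  (forall t, measurable_fun setT (f t)) ->
  ut (fun t i w => f t (V t i w)) -> (forall t i, mean (P t) (fun w => f t (V t i w)) = 0) ->
  us (fun t _ w => avg (fun l => f t (V t l w))).
Proof.
move=> dV mf h f0.
have mfV t i : measurable_fun setT (fun w => f t (V t i w)).
  by apply: (measurableT_comp (mf t)); exact: measurable_dep (dV t i).
apply: (usmall_monte_carlo (X := fun t i w => f t (V t i w)) st_dl_ge) => //.
move=> t l p q; apply: (particles_factor (st_inputs t)) => i.
  exact: (measurableT_comp (mf t) (dV t i)).
by have [K hK] := h; exact: tame_Lall (mfV t i) (hK t i).
Qed.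

Section step.
Variables (j : nat) (jJ : (j < J)%N).
Hypotheses (v_tame : ut (fun t i w => nrm1 (v (t := t) j i w)))
  (D_small : us (fun t i w => nrm1 (u (t := t) j i w - v j i w))).

Let Psi0_le t x : nrm1 (st_Psi0 t x) <= n%:R * (kP * (1 + nrm1 x)).
Proof.
apply: le_trans (nrm1_le_enorm _) _; rewrite ler_wpM2l//.
by apply: le_trans (st_Psi0_growth t x) _; rewrite ler_wpM2l// lerD2l enorm_le_nrm1.
Qed.

Let vhE t i w : vh (t := t) j i w = st_Psi0 t (v j i w) + st_xi j i w.
Proof. by rewrite st_Psi0E. Qed.

Let vh_tame : ut (fun t i w => nrm1 (vh (t := t) j i w)).
Proof.
have c1 : forall t : setting, `|n%:R * kP| <= n%:R * kP by move=> t; rewrite ger0_norm// mulr_ge0.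
have h1 := utameZ c1 (utameD (const_tame (c := fun=> 1) (fun t => lexx _)) v_tame).
apply: utame_le (utameD h1 (xi_tame jJ)) _ => t i w.
rewrite ger0_norm ?nrm1_ge0// vhE (le_trans (nrm1D _ _))// lerD2r -mulrA.
exact: Psi0_le.
Qed.

Let Dh t i w := uh (t := t) j i w - vh j i w.

Let Dh_small : us (fun t i w => nrm1 (Dh (t := t) i w)).
Proof.
have c1 : forall t : setting, `|n%:R * lP| <= n%:R * lP by move=> t; rewrite ger0_norm// mulr_ge0.
have c2 : forall t : setting, `|n%:R : R| <= n%:R by move=> t; rewrite ger0_norm.
have h1 := usmallMl (const_tame c1) D_small.
have h2 := usmallMl (const_tame c2) eps_small.
apply: (usmall_le st_dl_ge) (usmallD h1 h2) _ => t i w.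
rewrite ger0_norm ?nrm1_ge0// /Dh vhE /uh /st_enkf_hat opprD addrACA subrr addr0.
(* The Lipschitz bound of [st_Psi] absorbs the distance of the particles, and the two models are
   compared at the mean-field particle only. *)
have -> : st_Psi t (st_enkf j i w) - st_Psi0 t (v j i w) =
  (st_Psi t (u j i w) - st_Psi t (v j i w)) + (st_Psi t (v j i w) - st_Psi0 t (v j i w)).
  by rewrite addrA subrK.
rewrite (le_trans (nrm1D _ _))//; apply: lerD; apply: le_trans (nrm1_le_enorm _) _.
  rewrite -mulrA ler_wpM2l// (le_trans (st_lip t _ _))// ler_wpM2l//.
  exact: enorm_le_nrm1.
by rewrite ler_wpM2l// st_close.
Qed.

Let hat_law_facts t (i : 'I_(N t)) :
  (forall k, mean (P t) (fun w => (vh j i w - a t j) k 0) = 0) /\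
  (forall k l, mean (P t) (fun w => (vh j i w - a t j) k 0 * (vh j i w - a t j) l 0) = C t j k l).
Proof.
have [q [c [gq _ qE]]] := kalman_exact_hat (st_inputs t) (st_y t) (st_Psi0E t)
  (st_hE t) sSigma sGamma nS nG (st_gNI t) (@st_mu0E t) i jJ.
have sC : spd (invmx (C t j)) by apply: spd_inv; exact: kcov_spd.
have mc k : measurable_fun setT (fun x : 'cV[R]_n => (x - a t j) k 0).
  by apply: measurable_cV_coord; exact: measurable_cV_sub.
have qE' := mean_law qE; split=> [k|k l].
  rewrite -(qE' (fun x => (x - a t j) k 0) (mc k)) -[RHS](gaussian_mean gq sC k).
  by apply: eq_mean => x; rewrite !mxE.
have mkl : measurable_fun setT (fun x : 'cV[R]_n => (x - a t j) k 0 * (x - a t j) l 0).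
  exact: measurable_funM.
have := gaussian_cov gq sC k l; rewrite invmxK => <-.
rewrite -[LHS](qE' _ mkl).
by apply: eq_mean => x; rewrite !mxE.
Qed.

Let mvh_coord t i k : measurable_fun setT (fun w => vh (t := t) j i w k 0).
Proof. by apply: measurable_cV_coord; exact: mvh. Qed.

(** [a t j] is deterministic but depends on everything in [t]. As the mean of a tame variable it is
    bounded uniformly, without following the Kalman recursion; [C_tame] uses the same device. *)
Let a_tame : ut (fun t _ _ => nrm1 (a t j)).
Proof.
apply: utame_nrm1 => k l; rewrite (ord1 l).
have h := utame_mean (fun t i => @mvh_coord t i k) (utame_entry (A := fun t i w => vh (t := t) j i w) k 0 vh_tame).
apply: utame_le (utame_norm h) _ => t i w.
have [/(_ k) + _] := hat_law_facts i.
have iv : (P t).-integrable setT (EFin \o (fun w => vh j i w k 0)).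
  have [K hK] := utame_entry (A := fun t i w => vh (t := t) j i w) k 0 vh_tame.
  exact: Lall_integrable (tame_Lall (mvh_coord i k) (hK t i)).
have ic : (P t).-integrable setT (EFin \o cst (a t j k 0)).
  by apply: Lall_integrable; exact: Lall_cst.
have -> : mean (P t) (fun w0 => (vh j i w0 - a t j) k 0) =
    mean (P t) (fun w0 => vh j i w0 k 0 - cst (a t j k 0) w0).
  by apply: eq_mean => w'; rewrite !mxE.
by rewrite meanB// mean_cst => /eqP; rewrite subr_eq0 => /eqP ->.
Qed.

Let z t i w := vh (t := t) j i w - a t j.

Let z_tame : ut (fun t i w => nrm1 (z i w)).
Proof.
apply: utame_le (utameD vh_tame a_tame) _ => t i w.
by rewrite ger0_norm ?nrm1_ge0// nrm1B.
Qed.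

Let zk_tame k : ut (fun t i w => z (t := t) i w k 0).
Proof. exact: (utame_entry (A := fun t i w => z (t := t) i w) k 0 z_tame). Qed.

Let mz k : measurable_fun setT (fun x : 'cV[R]_n => x k 0).
Proof. exact: measurable_cV_coord. Qed.

Let C_tame : ut (fun t _ _ => nrm1 (C t j)).
Proof.
apply: utame_nrm1 => k l.
have mzz t i : measurable_fun setT (fun w => z (t := t) i w k 0 * z i w l 0).
  by apply: measurable_funM; apply: measurable_cV_coord; apply: measurable_cV_sub => //; exact: mvh.
have h := utame_mean mzz (utameM (zk_tame k) (zk_tame l)).
apply: utame_le (utame_norm h) _ => t i w.
by have [_ /(_ k l) <-] := hat_law_facts i.
Qed.

Let z_avg k : us (fun t _ w => avg (fun l => z (t := t) l w k 0)).
Proof.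
apply: (@particle_monte_carlo (fun t i w => vh (t := t) j i w) (fun t x => (x - a t j) k 0)).
- by move=> t i; exact: dep_vh.
- by move=> t; apply: measurable_cV_coord; exact: measurable_cV_sub.
- exact: zk_tame.
- by move=> t i; have [] := hat_law_facts i.
Qed.

Let zz_avg k l : us (fun t _ w => avg (fun p => z (t := t) p w k 0 * z p w l 0 - C t j k l)).
Proof.
have Ckl_tame : ut (fun t _ _ => C t j k l) by exact: (utame_entry (A := fun t _ _ => C t j) k l C_tame).
have zz_tame := utameD (utameM (zk_tame k) (zk_tame l)) (utameN Ckl_tame).
apply: (@particle_monte_carlo (fun t i w => vh (t := t) j i w)
  (fun t x => (x - a t j) k 0 * (x - a t j) l 0 - C t j k l)) => //.
- by move=> t i; exact: dep_vh.
- move=> t; apply: measurable_funB => //.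
  by apply: measurable_funM; apply: measurable_cV_coord; exact: measurable_cV_sub.
move=> t i; have [_ /(_ k l) h] := hat_law_facts i.
have mzk p : measurable_fun setT (fun w => (vh j i w - a t j) p 0).
  by apply: measurable_cV_coord; apply: measurable_cV_sub => //; exact: mvh.
have izz : (P t).-integrable setT (EFin \o (fun w => (vh j i w - a t j) k 0 * (vh j i w - a t j) l 0)).
  have [K1 h1] := zk_tame k; have [K2 h2] := zk_tame l.
  apply: Lall_integrable; apply: LallM; first exact: tame_Lall (mzk k) (h1 t i).
  exact: tame_Lall (mzk l) (h2 t i).
have ic : (P t).-integrable setT (EFin \o cst (C t j k l)).
  by apply: Lall_integrable; exact: Lall_cst.
by rewrite (meanB (g := cst (C t j k l)))// mean_cst h subrr.
Qed.

Let CN t w := ecov (fun i => uh (t := t) j i w) (fun i => uh j i w).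

(** Centred at [a t j], each particle is [z + Dh]. The average of [z z^T - C] is a Monte Carlo
    error, the cross terms contain the small [Dh], and the centring correction is a product of two
    small averages. *)
Let cov_small : us (fun t _ w => nrm1 (CN (t := t) w - C t j)).
Proof.
apply: usmall_nrm1 => k l.
have Dk p : us (fun t i w => Dh (t := t) i w p 0).
  by apply: (usmall_le st_dl_ge) Dh_small _ => t i w; exact: ler_nrm1.
have cross : us (fun t i w => z i w k 0 * Dh (t := t) i w l 0 +
    (Dh i w k 0 * z i w l 0 + Dh i w k 0 * Dh i w l 0)).
  apply: usmallD; first exact: usmallMl (zk_tame k) (Dk l).
  apply: usmallD; first exact: usmallM (Dk k) (zk_tame l).
  exact: usmallM (Dk k) (usmall_utame st_dl_ge st_dl_le (Dk l)).
have x_avg p : us (fun t _ w => avg (fun i => z (t := t) i w p 0) + avg (fun i => Dh (t := t) i w p 0)).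
  exact: usmallD (z_avg p) (usmall_avg (Dk p)).
have h := usmallD (usmallD (zz_avg k l) (usmall_avg cross))
  (usmallM (x_avg k) (usmall_utame st_dl_ge st_dl_le
     (usmallMl (const_tame (c := fun=> -1) (fun t => lexx _)) (x_avg l)))).
have h' := usmall_norm h.
apply: (usmall_le st_dl_ge h') => t i w.
rewrite le_eqVlt; apply/orP; left; apply/eqP; congr `| _ |.
have BE (A B : 'M[R]_n) : (A - B) k l = A k l - B k l by rewrite !mxE.
rewrite BE; have N0 : (0 < N t)%N := ens_pos (E t).
have e := ecov_entry (fun i => uh (t := t) j i w) (a t j) k l N0.
rewrite -[ecov _ _ k l]/(CN w k l) in e; rewrite e.
have xE p q : (uh j p w - a t j) q 0 = z p w q 0 + Dh p w q 0 by rewrite !mxE; ring.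
have e1 q : avg (fun p => (uh j p w - a t j) q 0) = avg (fun p => z p w q 0) + avg (fun p => Dh p w q 0).
  by rewrite -avgD; apply: eq_avg => p.
have e2 : avg (fun p => (uh j p w - a t j) k 0 * (uh j p w - a t j) l 0) - C t j k l =
   avg (fun p => z p w k 0 * z p w l 0 - C t j k l) +
   avg (fun p => z p w k 0 * Dh p w l 0 + (Dh p w k 0 * z p w l 0 + Dh p w k 0 * Dh p w l 0)).
  have eC : - C t j k l = avg (fun _ : 'I_(N t) => - C t j k l) by rewrite avg_cst.
  rewrite [X in _ + X = _]eC -!avgD.
  by apply: eq_avg => p; rewrite !xE; ring.
rewrite addrAC e2 !e1; ring.
Qed.

Let r := m%:R ^+ 2 / g.

Let r_tame : ut (fun _ _ _ => r).
Proof. exact: (const_tame (c := fun=> r) (fun=> lexx _)). Qed.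

Let KN t w := kgain_of Gamma (st_H t) (CN (t := t) w).

Let gain_tame : ut (fun t _ _ => nrm1 (gain t j)).
Proof.
apply: utame_le (utameM (utameM C_tame H_tame) r_tame) _ => t i w.
rewrite ger0_norm ?nrm1_ge0//; apply: gain_le => //.
exact/spd_psd/kcov_spd.
Qed.

Let gain_small : us (fun t _ w => nrm1 (KN (t := t) w - gain t j)).
Proof.
have h := usmallM cov_small (utameD (utameM H_tame r_tame)
  (utameM (utameM C_tame H_tame) (utameM (utameM r_tame (utameM H_tame H_tame)) r_tame))).
apply: (usmall_le st_dl_ge h) => t i w.
rewrite ger0_norm ?nrm1_ge0//; apply: gain_close => //.
  exact/spd_psd/kcov_spd.
exact: ecov_psd.
Qed.

Let yj : (1 <= j.+1 <= J)%N. Proof. by []. Qed.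

Lemma mf_step_tame : ut (fun t i w => nrm1 (v (t := t) j.+1 i w)).
Proof.
have h := utameD vh_tame (utameM gain_tame (utameD (y_tame yj)
  (utameD (utameM H_tame vh_tame) (eta_tame jJ)))).
apply: utame_le h _ => t i w; rewrite ger0_norm ?nrm1_ge0//.
rewrite (le_trans (nrm1D _ _))// lerD2l (le_trans (nrm1M _ _))// ler_wpM2l ?nrm1_ge0//.
rewrite (le_trans (nrm1B _ _))// lerD2l (le_trans (nrm1D _ _))// lerD2r.
exact: nrm1M.
Qed.

Let enkf_stepE t i w : u (t := t) j.+1 i w =
  uh j i w + KN w *m (st_y t j.+1 - (st_H t *m uh j i w + st_eta j.+1 i w)).
Proof.
rewrite /u /st_enkf /= /enkf_step (cov_uhE (st_hE t)) (cov_hhE (st_hE t)) st_hE.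
by rewrite [_ + Gamma]addrC.
Qed.

Lemma enkf_step_small : us (fun t i w => nrm1 (u (t := t) j.+1 i w - v j.+1 i w)).
Proof.
have innov_tame := utameD (y_tame yj) (utameD (utameM H_tame vh_tame) (eta_tame jJ)).
have h := usmallD Dh_small (usmallD (usmallM gain_small innov_tame)
  (usmallMl (utameD gain_tame (usmall_utame st_dl_ge st_dl_le gain_small))
     (usmallMl H_tame Dh_small))).
apply: (usmall_le st_dl_ge h) => t i w.
rewrite ger0_norm ?nrm1_ge0// enkf_stepE.
set I := st_y t j.+1 - (st_H t *m vh j i w + st_eta j.+1 i w).
have -> : st_y t j.+1 - (st_H t *m uh j i w + st_eta j.+1 i w) = I - st_H t *m Dh i w.
  by rewrite /I /Dh mulmxBr !opprD opprK; apply/colP => k; rewrite !mxE; ring.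
(* The gain error multiplies the mean-field innovation [I], which is tame, while the random gain
   multiplies only the small [st_H t *m Dh i w]. *)
have -> : uh j i w + KN w *m (I - st_H t *m Dh i w) - v j.+1 i w =
    Dh i w + ((KN w - gain t j) *m I - KN w *m (st_H t *m Dh i w)).
  have -> : v j.+1 i w = vh j i w + gain t j *m I by [].
  by rewrite mulmxBl mulmxBr /Dh; apply/colP => k; rewrite !mxE; ring.
rewrite (le_trans (nrm1D _ _))// lerD2l (le_trans (nrm1B _ _))//; apply: lerD.
  rewrite (le_trans (nrm1M _ _))// ler_wpM2l ?nrm1_ge0//.
  rewrite (le_trans (nrm1B _ _))// lerD2l (le_trans (nrm1D _ _))// lerD2r.
  exact: nrm1M.
rewrite (le_trans (nrm1M _ _))//; apply: ler_pM; rewrite ?nrm1_ge0//; last exact: nrm1M.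
by rewrite -[X in nrm1 X](subrK (gain t j)) addrC nrm1D.
Qed.

End step.

Lemma enkf_coupling j : (j <= J)%N ->
  ut (fun t i w => nrm1 (v (t := t) j i w)) /\
  us (fun t i w => nrm1 (u (t := t) j i w - v j i w)).
Proof.
elim: j => [_|j ih jJ]; last first.
  have [h1 h2] := ih (ltnW jJ); split; first exact: mf_step_tame.
  exact: enkf_step_small.
split; first by exists C0 => t i; exact: st_u0_tame.
have h : us (fun _ _ _ => 0).
  apply: (usmall_cst st_dl_ge (c := fun=> 0)) => t.
  by rewrite normr0 (le_trans _ (st_dl_ge t))// invr_ge0 sqrtr_ge0.
apply: (usmall_le st_dl_ge h) => t i w.
have -> : u (t := t) 0 i w = v 0 i w by [].
by rewrite subrr /nrm1 big1 ?normr0// => k _; rewrite big1// => l _; rewrite mxE normr0.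
Qed.

Let mphi t : measurable_fun setT (st_phi t).
Proof. by apply: (@measurable_local_lipschitz _ _ _ Lp) => x z; exact: st_phi_lip. Qed.

Let mh t : measurable_fun setT (st_h t).
Proof.
rewrite (_ : st_h t = fun x => st_H t *m x); first exact: measurable_cV_mulmx.
by apply/funext => x; exact: st_hE.
Qed.

Let mPsi t : measurable_fun setT (st_Psi t).
Proof. exact: measurable_lipschitz (st_lip t). Qed.

Let mPsi0 t : measurable_fun setT (st_Psi0 t).
Proof.
rewrite (_ : st_Psi0 t = fun x => st_L t *m x + st_b t).
  by apply: measurable_cV_add => //; exact: measurable_cV_mulmx.
by apply/funext => x; exact: st_Psi0E.
Qed.

(** A growth constant common to [Psi0] and to every model within distance 1 of it, so that one
    stability constant serves for both filters. *)
Let kk := n%:R * (kP + 1).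

Let growth_of t (F : 'cV[R]_n -> 'cV[R]_n) :
  (forall x, enorm (F x - st_Psi0 t x) <= 1) -> linear_growth kk F.
Proof.
move=> F1 x; apply: le_trans (enorm_le_nrm1 _) _.
rewrite -[F x](subrK (st_Psi0 t x)) (le_trans (nrm1D _ _))//.
have h1 := le_trans (nrm1_le_enorm (F x - st_Psi0 t x)) (ler_wpM2l (ler0n R n) (F1 x)).
have h2 := le_trans (nrm1_le_enorm (st_Psi0 t x)) (ler_wpM2l (ler0n R n) (st_Psi0_growth t x)).
apply: le_trans (lerD h1 h2) _; rewrite /kk -mulrDr -mulrA ler_wpM2l//.
by have := enorm_ge0 x; nra.
Qed.

Definition st_filter (t : setting) := true_filter (st_Psi t) (st_h t) Sigma Gamma (st_y t) (st_mu0 t) J.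
Let filter0 (t : setting) := true_filter (st_Psi0 t) (st_h t) Sigma Gamma (st_y t) (st_mu0 t) J.

Let mu0_moment t : (\int[st_mu0 t]_x (enorm x ^+ 2)%:E <= (C0 2)%:E)%E.
Proof.
pose i : 'I_(N t) := Ordinal (ens_pos (E t)).
have me : measurable_fun setT (fun x : 'cV[R]_n => (enorm x ^+ 2)%:E).
  by apply/measurable_EFinP; apply: measurable_funX; exact: measurable_enorm.
have -> : (\int[st_mu0 t]_x (enorm x ^+ 2)%:E = \int[P t]_w (enorm (st_u0 i w : 'cV[R]_n) ^+ 2)%:E)%E.
  rewrite -(ge0_integral_distribution (st_u0 i) (f := fun x => (enorm x ^+ 2)%:E))//.
    by apply: eq_integral_measurable => A mA; rewrite (law_u0 (st_inputs t) i mA).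
  by move=> x; rewrite lee_fin sqr_ge0.
have [Y [mY uY Y2]] := st_u0_tame i; apply: le_trans (Y2 2).
apply: le_integral_ge0 => w; rewrite lee_fin ?sqr_ge0//.
apply: lerX; first exact: enorm_ge0.
apply: le_trans (enorm_le_nrm1 _) _; apply: le_trans (uY w); exact: ler_norm.
Qed.

Let phi_v_tame : ut (fun t i w => st_phi t (v (t := t) J i w)).
Proof.
have [h _] := enkf_coupling (leqnn J).
have h1 := utameM (const_tame (c := fun=> Rp) (fun=> lexx _))
  (utameD (const_tame (c := fun=> 1) (fun=> lexx _)) (utameM h h)).
apply: utame_le h1 _ => t i w; apply: le_trans (st_phi_growth t _) _.
by rewrite ler_wpM2l ?(ltW Rp0)// lerD2l -expr2 lerX ?enorm_ge0 ?enorm_le_nrm1.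
Qed.

Let mphi_v t i : measurable_fun setT (fun w => st_phi t (v (t := t) J i w)).
Proof. by apply: (measurableT_comp (mphi t)); exact: mv. Qed.

Let mean_filter0 t (i : 'I_(N t)) :
  mean (filter0 t) (st_phi t) = mean (P t) (fun w => st_phi t (v J i w)).
Proof.
have [h _] := kalman_exact (st_inputs t) (st_y t) (st_Psi0E t)
  (st_hE t) sSigma sGamma nS nG (st_gNI t) (@st_mu0E t) i (leqnn J).
have [Q [QA Qf]] := exists_law (P t) (@mv J t i (leqnn J)).
rewrite -(mean_law Qf (mphi t)) /mean; congr fine.
apply: eq_integral_measurable => A mA; rewrite QA; exact: h.
Qed.

Let sampling_small : us (fun t _ w => avg (fun l => st_phi t (v (t := t) J l w) - mean (filter0 t) (st_phi t))).
Proof.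
have mean_tame : ut (fun t _ _ => mean (filter0 t) (st_phi t)).
  have h := utame_mean mphi_v phi_v_tame.
  by apply: utame_le (utame_norm h) _ => t i w; rewrite (mean_filter0 i).
have h := utameD phi_v_tame (utameN mean_tame).
apply: (@particle_monte_carlo (fun t i w => v (t := t) J i w)
  (fun t x => st_phi t x - mean (filter0 t) (st_phi t))) => //.
- by move=> t i; exact: dep_v.
- by move=> t; exact: measurable_funB.
move=> t i; have [K hK] := phi_v_tame.
have i1 : (P t).-integrable setT (EFin \o (fun w => st_phi t (v J i w))).
  exact: Lall_integrable (tame_Lall (mphi_v i) (hK t i)).
have ic : (P t).-integrable setT (EFin \o cst (mean (filter0 t) (st_phi t))).
  by apply: Lall_integrable; exact: Lall_cst.
by rewrite (meanB (g := cst _))// mean_cst -mean_filter0 subrr.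
Qed.

Let coupling_small : us (fun t _ w =>
  avg (fun l => st_phi t (u (t := t) J l w) - st_phi t (v (t := t) J l w))).
Proof.
have [h1 h2] := enkf_coupling (leqnn J); apply: usmall_avg.
have one := const_tame (c := fun=> 1) (fun=> lexx _).
have hL := const_tame (c := fun=> Lp) (fun=> lexx _).
have h := usmallM (usmallMl hL h2)
  (utameD (utameD one (utameD h1 (usmall_utame st_dl_ge st_dl_le h2))) h1).
apply: (usmall_le st_dl_ge h) => t i w.
apply: le_trans (st_phi_lip t _ _) _; apply: ler_pM.
- by rewrite mulr_ge0 ?enorm_ge0.
- by rewrite !addr_ge0 ?enorm_ge0.
- by rewrite ler_wpM2l// enorm_le_nrm1.
apply: lerD; last exact: enorm_le_nrm1.
rewrite lerD2l (le_trans (enorm_le_nrm1 _))//.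
by rewrite -[X in nrm1 X](subrK (v J i w)) addrC nrm1D.
Qed.

(** The positive and negative parts of [phi / Rp] lie between 0 and [weight], hence are admissible
    in [weakly_close]. *)
Let integrable_phi t (mu : probability 'cV[R]_n R) M : (\int[mu]_x (enorm x ^+ 2)%:E <= M%:E)%E ->
  mean mu (st_phi t) = Rp * (mean mu (fun x => Num.max (Rp^-1 * st_phi t x) 0) -
    mean mu (fun x => Num.max (- (Rp^-1 * st_phi t x)) 0)) /\
  (forall x, 0 <= Num.max (Rp^-1 * st_phi t x) 0 <= weight x) /\
  (forall x, 0 <= Num.max (- (Rp^-1 * st_phi t x)) 0 <= weight x).
Proof.
move=> hM.
have b x : `|Rp^-1 * st_phi t x| <= weight x.
  rewrite normrM gtr0_norm ?invr_gt0// mulrC ler_pdivrMr// mulrC.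
  exact: st_phi_growth.
have [b1 b2] : (forall x, 0 <= Num.max (Rp^-1 * st_phi t x) 0 <= weight x) /\
  (forall x, 0 <= Num.max (- (Rp^-1 * st_phi t x)) 0 <= weight x).
  split=> x; rewrite le_max lexx orbT/= ge_max (le_trans ler01 (weight_ge1 x)) andbT.
    exact: le_trans (ler_norm _) (b x).
  by apply: le_trans (b x); rewrite -normrN ler_norm.
have mw := integral_weight_le hM.
have mR : measurable_fun setT (fun x => Rp^-1 * st_phi t x) by exact: measurable_funM.
have m1 : measurable_fun setT (fun x => Num.max (Rp^-1 * st_phi t x) 0).
  exact: measurable_maxr.
have m2 : measurable_fun setT (fun x => Num.max (- (Rp^-1 * st_phi t x)) 0).
  by apply: measurable_maxr => //; exact: measurableT_comp.
have [i1 _] := ge0_mean_bound m1 (fun x => proj1 (andP (b1 x))) (fun x => proj2 (andP (b1 x))) mw.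
have [i2 _] := ge0_mean_bound m2 (fun x => proj1 (andP (b2 x))) (fun x => proj2 (andP (b2 x))) mw.
split => //; rewrite -meanB// -meanZ; last by have := integrableB measurableT i1 i2.
apply: eq_mean => x; rewrite -[LHS](mulVKf (lt0r_neq0 Rp0)); congr (_ * _).
by rewrite /Num.max; case: ifPn => c; case: ifPn => c'; lra.
Qed.

Let stability_small : us (fun t _ _ => mean (filter0 t) (st_phi t) - mean (st_filter t) (st_phi t)).
Proof.
have [[M D] /= D0 stab] := filter_stability sSigma nS sGamma nG kk kh ky (C0 2) J.
(* The 2 counts the positive and the negative part of [phi / Rp]. *)
have h := usmallMl (const_tame (c := fun=> Rp * (2 * D)) (fun=> lexx _)) eps_small.
apply: (usmall_le st_dl_ge h) => t _ _.
have /andP[e0 e1] := st_eps01 t.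
have [||mu [nu [muE nuE muM nuM mn]]] := stab (st_Psi t) (st_Psi0 t) (st_h t) (st_y t) (st_mu0 t)
  (st_eps t) (mPsi t) (mPsi0 t) _ _ (mh t) (st_h_growth t) (@st_y_le t) (st_eps01 t)
  (@st_close t) (mu0_moment t).
- by apply: (@growth_of t) => x; exact: le_trans (st_close t x) e1.
- by apply: (@growth_of t) => x; rewrite subrr /enorm big1 ?sqrtr0// => k _; rewrite mxE expr0n.
have -> : mean (st_filter t) (st_phi t) = mean mu (st_phi t).
  by rewrite /mean; congr fine; apply: eq_integral_measurable => A mA; exact: muE.
have -> : mean (filter0 t) (st_phi t) = mean nu (st_phi t).
  by rewrite /mean; congr fine; apply: eq_integral_measurable => A mA; exact: nuE.
have [-> [b1 b2]] := integrable_phi t muM; have [-> _] := integrable_phi t nuM.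
have mR : measurable_fun setT (fun x => Rp^-1 * st_phi t x) by exact: measurable_funM.
have m1 : measurable_fun setT (fun x => Num.max (Rp^-1 * st_phi t x) 0) by exact: measurable_maxr.
have h1 := mn _ m1 b1.
have mN : measurable_fun setT (fun x => - (Rp^-1 * st_phi t x)) by exact: measurableT_comp.
have m2 : measurable_fun setT (fun x => Num.max (- (Rp^-1 * st_phi t x)) 0) by exact: measurable_maxr.
have h2 := mn _ m2 b2.
rewrite -mulrBr normrM gtr0_norm// -mulrA ler_wpM2l ?(ltW Rp0)//.
move: h1 h2; rewrite !ler_norml => /andP[a1 a2] /andP[c1 c2].
apply/andP; split; lra.
Qed.

Lemma enkf_error_small : us (fun t _ w =>
  avg (fun l => st_phi t (u (t := t) J l w)) - mean (st_filter t) (st_phi t)).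
Proof.
have h := usmall_norm (usmallD coupling_small (usmallD sampling_small stability_small)).
apply: (usmall_le st_dl_ge h) => t i w.
rewrite le_eqVlt; apply/orP; left; apply/eqP; congr `| _ |.
have N0 : (0 < N t)%N := ens_pos (E t).
set m0 := mean (filter0 t) _.
have eC : m0 = avg (fun _ : 'I_(N t) => m0) by rewrite avg_cst.
have e1 : avg (fun l => st_phi t (u J l w) - st_phi t (v J l w)) +
    avg (fun l => st_phi t (v J l w) - m0) = avg (fun l => st_phi t (u J l w)) - m0.
  rewrite [in RHS]eC -[X in _ - X]mul1r -mulNr -avgZ -!avgD.
  by apply: eq_avg => l; ring.
by rewrite addrA e1 addrA subrK.
Qed.

(** Only the second moment is read off at the end; the higher ones were spent on the products along
    the recursion. The integral is taken of the dominating variable [Y], which is measurable. *)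
Lemma enkf_error_bound : exists2 K : R, 0 <= K & forall t : setting,
  (\int[P t]_w (`|mean (empirical R (fun i => u (t := t) J i w)) (st_phi t) -
     mean (st_filter t) (st_phi t)| ^+ 2)%:E <= (K * st_dl t ^+ 2)%:E)%E.
Proof.
have [K hK] := enkf_error_small; exists `|K 2| => // t.
pose i : 'I_(N t) := Ordinal (ens_pos (E t)).
have [Y [mY XY Y2]] := hK t i.
have dl0 : 0 < st_dl t.
  by apply: lt_le_trans (st_dl_ge t); rewrite invr_gt0 sqrtr_gt0 ltr0n ens_pos.
apply: (@le_trans _ _ (\int[P t]_w ((st_dl t ^+ 2)%:E * (Y w ^+ 2)%:E))%E).
  apply: le_integral_ge0 => w; first by rewrite lee_fin sqr_ge0.
  rewrite -EFinM lee_fin -exprMn; apply: lerX => //.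
  rewrite (mean_empirical _ (mphi t)).
  have := XY w; rewrite normrM gtr0_norm ?invr_gt0// mulrC ler_pdivrMr// mulrC.
  exact.
rewrite ge0_integralZl//; last 3 first.
- by apply/measurable_EFinP; exact: measurable_funX.
- by move=> w _; rewrite lee_fin sqr_ge0.
- by rewrite lee_fin sqr_ge0.
have -> : ((`|K 2| * st_dl t ^+ 2)%:E = (st_dl t ^+ 2)%:E * `|K 2|%:E)%E by rewrite -EFinM mulrC.
apply: lee_wpmul2l; first by rewrite lee_fin sqr_ge0.
by apply: le_trans (Y2 2) _; rewrite lee_fin ler_norm.
Qed.

End coupling.

(** * Gaussian initial laws *)

Section initial_law.
Context (R : realType).

Lemma normal0_probability n (S : 'M[R]_n) : normal0 S setT = 1%E ->
  exists Q : probability 'cV[R]_n R, forall A, Q A = normal0 S A.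
Proof.
move=> S1.
have p0 x : 0 <= (gauss_cst S)^-1 * gauss_exp S x.
  by rewrite mulr_ge0 ?invr_ge0 ?sqrtr_ge0 ?expR_ge0.
have mp : measurable_fun setT (fun x : 'cV[R]_n => (gauss_cst S)^-1 * gauss_exp S x).
  apply: measurable_funM => //; apply: measurableT_comp => //.
  apply: measurableT_comp => //; apply: measurable_funM => //; apply: measurable_funX.
  by apply: measurable_enorm; exact: measurable_cV_mulmx.
exact: (@exists_probability _ _ _ (dens (lebesgue_cV R n) p0 mp) S1).
Qed.

Definition is_standard n (Q : probability 'cV[R]_n R) :=
  (exists c, gaussian_law Q c 0 1%:M) /\ forall B, measurable B -> Q B = normal0 1%:M B.

(** The standard Gaussian has mass 1 because [mu], a probability, is an affine image of it. *)
Lemma exists_standard n (mu : probability 'cV[R]_n.+1 R) : is_gaussian mu ->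
  exists Q : probability 'cV[R]_n.+1 R, is_standard Q.
Proof.
move=> [m [A muE]]; have [|Q QE] := @normal0_probability n.+1 1%:M.
  by rewrite -[RHS](@probability_setT _ _ _ mu) muE.
exists Q; split => //; exists (gauss_cst (1%:M : 'M[R]_n.+1))^-1.
by have [+ _ _] := normal0_gaussian (spd1 R n.+1) (fun B _ => QE B); rewrite invmx1.
Qed.

Lemma gaussian_standard n (mu Q : probability 'cV[R]_n R) : is_gaussian mu -> is_standard Q ->
  exists m A, forall B, measurable B -> mu B = Q ((fun z => m + A *m z) @^-1` B).
Proof.
move=> [m [A muE]] [_ QE]; exists m, A => B mB; rewrite muE// QE//.
rewrite -[X in measurable X]setTI.
by apply: measurable_cV_add => //; exact: measurable_cV_mulmx.
Qed.

Lemma integral_affine n (mu Q : probability 'cV[R]_n R) m A (f : 'cV[R]_n -> \bar R) :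
  (forall B, measurable B -> mu B = Q ((fun z => m + A *m z) @^-1` B)) ->
  measurable_fun setT f -> (forall x, 0 <= f x)%E ->
  (\int[mu]_x f x = \int[Q]_z f (m + A *m z)%R)%E.
Proof.
move=> muE mf f0; transitivity (\int[pushforward Q (fun z => m + A *m z)%R]_x f x)%E.
  by apply: eq_integral_measurable => B mB; rewrite muE.
rewrite ge0_integral_pushforward//.
by apply: measurable_cV_add => //; exact: measurable_cV_mulmx.
Qed.

Section standard.
Variables (n : nat) (Q : probability 'cV[R]_n R) (c : R).
Hypothesis gQ : gaussian_law Q c 0 1%:M.

Lemma standard_Lall_coord i : Lall Q (fun x : 'cV[R]_n => x i 0).
Proof.
have mi : measurable_fun setT (fun x : 'cV[R]_n => x i 0) by exact: measurable_cV_coord.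
apply: Lall_expR_norm => //; apply: Lall_le (gaussian_Lall_coord gQ (spd1 R n) i) _ => [|x].
  by do 2 apply: measurableT_comp => //.
by rewrite mxE subr0.
Qed.

Lemma standard_Lall_nrm1 : Lall Q (fun x : 'cV[R]_n => nrm1 x).
Proof.
under eq_fun do rewrite nrm1_cV.
by apply: Lall_sum => i; apply: Lall_norm; exact: standard_Lall_coord.
Qed.

(** As [z] is centred with identity covariance, the second moment of coordinate [i] is
    [m_i^2 + |row i A|^2]. *)
Lemma standard_affine_bound (m : 'cV[R]_n) (A : 'M[R]_n) (M : R) :
  (\int[Q]_z (enorm (m + A *m z) ^+ 2)%:E <= M%:E)%E ->
  forall i k, m i 0 ^+ 2 <= M /\ A i k ^+ 2 <= M.
Proof.
move=> hM i k.
pose s (z : 'cV[R]_n) := (((row i A)^T)^T *m (z - 0)) 0 0.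
have sE z : (A *m z) i 0 = s z.
  by rewrite /s trmxK subr0 -row_mul [RHS]mxE.
have [s1 s2] := gaussian_lin gQ (spd1 R n) (row i A)^T.
rewrite invmx1 qf_scalar mul1r in s2.
have Ls : Lall Q s.
  have -> : s = fun z => \sum_l A i l * z l 0.
    by apply/funext => z; rewrite -sE mxE.
  by apply: Lall_sum => l; apply: LallZ; exact: standard_Lall_coord.
have Lsq : Lall Q (fun z => (m i 0 + s z) ^+ 2).
  by apply: LallX; apply: LallD => //; exact: Lall_cst.
have h : mean Q (fun z => (m i 0 + s z) ^+ 2) <= M.
  rewrite -lee_fin -(EFin_mean (Lall_integrable Lsq)); apply: le_trans hM.
  apply: le_integral_ge0 => z; rewrite lee_fin ?sqr_ge0//.
  have -> : m i 0 + s z = (m + A *m z) i 0 by rewrite [RHS]mxE sE.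
  rewrite sqr_enorm (bigD1 i)//= lerDl.
  by apply: sumr_ge0 => l _; exact: sqr_ge0.
have e : mean Q (fun z => (m i 0 + s z) ^+ 2) = m i 0 ^+ 2 + enorm (row i A)^T ^+ 2.
  rewrite (eq_mean Q (g := fun z => cst (m i 0 ^+ 2) z + (2 * m i 0 * s z + s z ^+ 2))); last first.
    by move=> z /=; ring.
  have i1 := Lall_integrable (LallZ (2 * m i 0) Ls).
  have i2 := Lall_integrable (LallX 2 Ls).
  rewrite meanD; [|exact: Lall_integrable (Lall_cst Q _)|].
    rewrite mean_cst meanD// meanZ ?s2; last exact: Lall_integrable.
    by rewrite s1 mulr0 add0r.
  exact: Lall_integrable (LallD (LallZ _ Ls) (LallX 2 Ls)).
rewrite e in h; have e0 := sqr_ge0 (m i 0); have e1 := sqr_ge0 (enorm (row i A)^T).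
split; first by apply: le_trans h; rewrite lerDl.
apply: le_trans h; apply: le_trans (_ : enorm (row i A)^T ^+ 2 <= _); last by rewrite lerDr.
rewrite sqr_enorm (bigD1 k)//= !mxE lerDl.
by apply: sumr_ge0 => l _; exact: sqr_ge0.
Qed.

Lemma gaussian_tame (M : R) : exists C : nat -> R,
  forall (m : 'cV[R]_n) (A : 'M[R]_n) (mu : probability 'cV[R]_n R),
  (forall B, measurable B -> mu B = Q ((fun z => m + A *m z) @^-1` B)) ->
  (\int[mu]_x (enorm x ^+ 2)%:E <= M%:E)%E ->
  forall d (T : measurableType d) (P : probability T R) (X : {RV P >-> 'cV[R]_n}),
  (forall B, measurable B -> distribution P X B = mu B) ->
  tame P C (fun w => nrm1 (X w)).
Proof.
(* [x^2 <= M] implies [|x| <= 1 + M], so [a] and [b] bound the norms of [m] and [A]. The majorant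
   [F] then depends on [M] alone, and its moments under [Q] serve for all these Gaussians. *)
pose a := \sum_(i < n) \sum_(k < 1) (1 + M).
pose b := \sum_(i < n) \sum_(k < n) (1 + M).
pose F z := a + b * nrm1 (z : 'cV[R]_n).
have LF : Lall Q F by apply: LallD; [exact: Lall_cst|apply: LallZ; exact: standard_Lall_nrm1].
exists (fun k => mean Q (fun z => F z ^+ k)) => m A mu muE hM d T P X XE.
have intE f := integral_affine (f := f) muE.
have me : measurable_fun setT (fun x : 'cV[R]_n => (enorm x ^+ 2)%:E).
  by apply/measurable_EFinP; apply: measurable_funX; exact: measurable_enorm.
rewrite intE// in hM; last by move=> x; rewrite lee_fin sqr_ge0.
have bd := standard_affine_bound hM.
have sq (x : R) : x ^+ 2 <= M -> `|x| <= 1 + M.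
  by move=> h; rewrite ler_norml; apply/andP; split; nra.
have ma : nrm1 m <= a.
  by apply: ler_sum => i _; apply: ler_sum => k _; rewrite (ord1 k) sq//; have [] := bd i i.
have Ab : nrm1 A <= b.
  by apply: ler_sum => i _; apply: ler_sum => k _; rewrite sq//; have [] := bd i k.
exists (fun w => nrm1 (X w)); split=> [|w|k].
- by apply: measurable_nrm1; exact: measurable_funPT.
- by rewrite ger0_norm// nrm1_ge0.
have mn : measurable_fun setT (fun x : 'cV[R]_n => (nrm1 x ^+ k)%:E).
  by apply/measurable_EFinP; apply: measurable_funX; exact: measurable_nrm1.
have n0 (x : 'cV[R]_n) : (0 <= (nrm1 x ^+ k)%:E)%E by rewrite lee_fin exprn_ge0// nrm1_ge0.
have -> : (\int[P]_w (nrm1 (X w : 'cV[R]_n) ^+ k)%:E = \int[mu]_x (nrm1 x ^+ k)%:E)%E.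
  rewrite -(ge0_integral_distribution X (f := fun x => (nrm1 x ^+ k)%:E))//.
  exact: eq_integral_measurable.
rewrite intE// -(EFin_mean (Lall_integrable (LallX k LF))).
apply: le_integral_ge0 => z; first by [].
rewrite lee_fin; apply: lerX; first exact: nrm1_ge0.
rewrite (le_trans (nrm1D _ _))//; apply: lerD => //.
by rewrite (le_trans (nrm1M _ _))// ler_wpM2r// nrm1_ge0.
Qed.

Lemma gaussian_second_moment (m : 'cV[R]_n) (A : 'M[R]_n) (mu : probability 'cV[R]_n R) q :
  (forall B, measurable B -> mu B = Q ((fun z => m + A *m z) @^-1` B)) -> (2 <= q)%N ->
  (\int[mu]_x (enorm x ^+ 2)%:E <= (1 + moment q mu)%:E)%E.
Proof.
move=> muE q2.
have intE f := integral_affine (f := f) muE.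
have mq k : measurable_fun setT (fun x : 'cV[R]_n => enorm x ^+ k).
  by apply: measurable_funX; exact: measurable_enorm.
have e0 k (x : 'cV[R]_n) : 0 <= enorm x ^+ k by rewrite exprn_ge0// enorm_ge0.
have LA : Lall Q (fun z : 'cV[R]_n => enorm (m + A *m z)).
  apply: Lall_le (LallD (Lall_cst Q (nrm1 m)) (LallZ (nrm1 A) standard_Lall_nrm1)) _ => [|z].
    apply: measurable_enorm; apply: measurable_cV_add => //.
    exact: measurable_cV_mulmx.
  rewrite ger0_norm ?enorm_ge0// ger0_norm; last by rewrite addr_ge0 ?mulr_ge0 ?nrm1_ge0.
  rewrite (le_trans (enorm_le_nrm1 _))// (le_trans (nrm1D _ _))// lerD2l.
  exact: nrm1M.
(* [moment] goes through [fine], so it controls the integral only once finiteness is known; the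
   affine image of [Q] provides it. *)
have fin : (\int[mu]_x (enorm x ^+ q)%:E = (moment q mu)%:E)%E.
  rewrite /moment /mean fineK// intE; [|exact/measurable_EFinP|by move=> x; rewrite lee_fin].
  by rewrite (EFin_mean (Lall_integrable (LallX q LA))).
apply: (@le_trans _ _ (\int[mu]_x (cst 1%:E x + (enorm x ^+ q)%:E))%E).
  apply: le_integral_ge0 => x; first by rewrite lee_fin.
  rewrite -EFinD lee_fin; have := enorm_ge0 x; move: (enorm x) => r r0.
  case: (lerP r 1) => r1.
    by rewrite (le_trans (exprn_ile1 2 r0 r1))// lerDl exprn_ge0.
  by rewrite (le_trans (ler_weXn2l (ltW r1) q2))// lerDr.
rewrite ge0_integralD//; last 2 first.
- by move=> x _; rewrite lee_fin.
- exact/measurable_EFinP.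
by rewrite integral_cst// [X in (_ * X + _)%E]probability_setT mule1 fin -EFinD.
Qed.

End standard.

End initial_law.

Lemma linear_cV (R : realType) n m (L : {linear 'cV[R]_n -> 'cV[R]_m}) :
  exists A : 'M[R]_(m, n), forall u, L u = A *m u.
Proof.
exists (\matrix_(i, j) L (delta_mx j 0) i 0) => u.
have {1}-> : u = \sum_j u j 0 *: (delta_mx j 0 : 'cV[R]_n).
  by rewrite {1}[u]matrix_sum_delta; apply: eq_bigr => j _; rewrite big_ord1.
rewrite linear_sum; apply/colP => i; rewrite summxE mxE; apply: eq_bigr => j _.
by rewrite linearZ !mxE mulrC.
Qed.

(** * Choice of the constant *)

Section constant.
Context (R : realType) (n m : nat).

Definition noise_data (Rp Lp kP lP : R) (Sigma : 'M[R]_n.+1) (Gamma : 'M[R]_m.+1)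
    (NS : probability 'cV[R]_n.+1 R) (NG : probability 'cV[R]_m.+1 R)
    (NI : probability 'cV[R]_n.+1 R) (g : R) : Prop :=
  [/\ spd Sigma /\ spd Gamma, is_noise Sigma NS /\ is_noise Gamma NG, is_standard NI,
      0 < g /\ psd_le g%:M Gamma & [/\ 0 <= kP, 0 <= lP, 0 <= Lp & 0 < Rp]].

(** The constant is fixed before any sample is given, yet the noise laws are known to be
    probabilities only through such samples. Hence a case distinction: either suitable laws exist
    and the constant is built from some choice of them, or none exist and the hypotheses can never
    be met. The bound [g] is chosen there too, as [gamma] is not an argument of the constant. *)
Lemma exists_constant (mq Rp Lp ky kP kh lP : R) (Sigma : 'M[R]_n.+1) (Gamma : 'M[R]_m.+1)
    (J : nat) : exists K : R,
  forall (y : nat -> 'cV[R]_m.+1) (sigma gamma : R)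
    (h : {linear 'cV[R]_n.+1 -> 'cV[R]_m.+1}) (l_h : R)
    (Psi0 : 'cV[R]_n.+1 -> 'cV[R]_n.+1)
    (mu0 : probability 'cV[R]_n.+1 R),
  spd Sigma -> spd Gamma -> (1 <= J)%N ->
  0 < ky -> 0 < sigma -> 0 < gamma ->
  (forall j, (1 <= j <= J)%N -> enorm (y j) <= ky) ->
  psd_le (sigma%:M) Sigma -> psd_le (gamma%:M) Gamma ->
  0 < kh -> 0 < l_h -> linear_growth kh h -> lipschitz_with l_h h ->
  0 < kP -> 0 < lP -> affine Psi0 -> linear_growth kP Psi0 ->
  is_gaussian mu0 -> forall q, (2 <= q)%N -> moment q mu0 = mq ->
  forall (eps : R) (Psi : 'cV[R]_n.+1 -> 'cV[R]_n.+1),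
  0 <= eps <= 1 ->
  (supnorm (fun u => Psi u - Psi0 u)%R <= eps%:E)%E -> lipschitz_with lP Psi ->
  forall (N : nat), (0 < N)%N ->
  forall (d : measure_display) (Omega : measurableType d)
    (P : probability Omega R)
    (u0 : 'I_N -> {RV P >-> 'cV[R]_n.+1})
    (xi : nat -> 'I_N -> {RV P >-> 'cV[R]_n.+1})
    (eta : nat -> 'I_N -> {RV P >-> 'cV[R]_m.+1}),
  enkf_inputs J mu0 Sigma Gamma u0 xi eta ->
  forall (phi : 'cV[R]_n.+1 -> R),
  0 < Lp ->
  (forall u v, `|phi u - phi v| <= Lp * enorm (u - v) * (1 + enorm u + enorm v)) ->
  0 < Rp ->
  (forall u, `|phi u| <= Rp * (1 + enorm u ^+ 2)) ->
  let mu_EK := fun w => empirical R (enkf Psi h Gamma y (fun i => u0 i w)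
    (fun j i => xi j i w) (fun j i => eta j i w) J) in
  let mu_J := true_filter Psi h Sigma Gamma y mu0 J in
  ('E_P[(fun w => `|mean (mu_EK w) phi - mean mu_J phi| ^+ 2)%R] `^ 2^-1 <=
   (K * ((Num.sqrt N%:R)^-1 + eps))%:E)%E.
Proof.
have [[NS [NG [NI [g [[sS sG] [nS nG] sNI [g0 gP] [kP0 lP0 Lp0 Rp0]]]]]]|no] := pselect
  (exists NS NG NI g, noise_data Rp Lp kP lP Sigma Gamma NS NG NI g); last first.
  exists 0 => y sigma gamma h l_h Psi0 mu0 sS sG J1 _ _ g0 _ _ gP _ _ _ _ kP0 lP0 _ _ gmu q _ _.
  move=> eps Psi _ _ _ N N0 d Omega P u0 xi eta inp phi Lp0 _ Rp0 _; exfalso; apply: no.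
  pose i0 : 'I_N := Ordinal N0.
  have [NI sNI] := exists_standard gmu.
  (* As [J] and [N] are positive, particle 0 has a first model noise and a first observation noise,
     whose laws are the witnesses. *)
  exists (distribution P (xi 0 i0)), (distribution P (eta 1 i0)), NI, gamma.
  split; [by []|split|exact: sNI|by []|by split => //; exact: ltW].
  - by apply: (normal0_gaussian sS) => A mA; have := law_xi inp i0 J1 mA.
  - by apply: (normal0_gaussian sG) => A mA; have := law_eta inp i0 J1 mA.
have [[c0 gNI] NIE] := sNI.
have [C0 hC0] := gaussian_tame gNI (1 + mq).
have [K K0 hK] := enkf_error_bound J ky kh C0 sS sG nS nG g0 gP kP0 lP0 Lp0 Rp0.
(* [K] bounds the mean square error in units of [st_dl t ^+ 2]; the claim is about its square
   root. *)
exists (Num.sqrt K) => y sigma gamma h l_h Psi0 mu0 _ _ J1 _ _ _ yk _ _ _ _ gh _ _ _ [L' [b Psi0E]] gPsi0.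
move=> gmu q q2 mqE eps Psi e01 sup lPsi N N0 d Omega P u0 xi eta inp phi _ phiL _ phiR.
cbv zeta; set mu_J := true_filter _ _ _ _ _ _ _.
set ms := (fun w => _).
have [L LE] := linear_cV L'; have [H HE] := linear_cV h.
have {LE}Psi0E' u : Psi0 u = L *m u + b by rewrite Psi0E LE.
have [m0 [A0 mu0E]] := gaussian_standard gmu sNI.
have m2 := gaussian_second_moment gNI mu0E q2; rewrite mqE in m2.
have tm i := hC0 _ _ _ mu0E m2 _ _ _ (u0 i) (fun B mB => law_u0 inp i mB).
have close u : enorm (Psi u - Psi0 u) <= eps.
  by rewrite -lee_fin; apply: le_trans sup; apply: ereal_sup_ubound; exists u.
pose E := Ensemble N0 P.
pose t := @Setting R n.+1 m.+1 Sigma Gamma J ky kh kP lP Lp Rp C0 E mu0 u0 xi eta inp tm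
  y yk h H HE gh Psi0 L b Psi0E' gPsi0 Psi lPsi eps e01 close m0 A0 NI c0 gNI mu0E phi phiL phiR.
have := hK t; rewrite -[st_filter t]/mu_J.
have -> : (\int[ens_prob t]_w (`|mean (empirical R (fun i => st_enkf (t := t) J i w)) (st_phi t) - mean mu_J (st_phi t)| ^+ 2)%:E)%E =
    ('E_P[ms])%E.
  by rewrite unlock.
have : (0 <= 'E_P[ms])%E.
  by rewrite unlock; apply: integral_ge0 => w _; rewrite lee_fin sqr_ge0.
case: ('E_P[_])%E => [e| |]//; rewrite !lee_fin => e0 eK.
have d0 : 0 <= st_dl t.
  by rewrite /st_dl addr_ge0 ?invr_ge0 ?sqrtr_ge0//; have /andP[] := e01.
rewrite powR12_sqrt//.
apply: le_trans (ler_wsqrtr eK) _.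
by rewrite sqrtrM// sqrtr_sqr ger0_norm.
Qed.

End constant.

Theorem theorem2p4 (R : realType) (du dy : nat) (hdu : (0 < du)%N)
    (hdy : (0 < dy)%N) :
  exists C : R -> R -> R -> R -> R -> R -> R -> R -> 'M[R]_du -> 'M[R]_dy ->
             nat -> R,
  forall (Sigma : 'M[R]_du) (Gamma : 'M[R]_dy) (J : nat)
    (y : nat -> 'cV[R]_dy) (kappa_y sigma gamma : R)
    (h : {linear 'cV[R]_du -> 'cV[R]_dy}) (kappa_h l_h : R)
    (Psi0 : 'cV[R]_du -> 'cV[R]_du) (kappa_Psi l_Psi : R)
    (mu0 : probability 'cV[R]_du R),
  spd Sigma -> spd Gamma -> (1 <= J)%N ->
  0 < kappa_y -> 0 < sigma -> 0 < gamma ->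
  (forall j, (1 <= j <= J)%N -> enorm (y j) <= kappa_y) ->
  psd_le (sigma%:M) Sigma -> psd_le (gamma%:M) Gamma ->
  0 < kappa_h -> 0 < l_h -> linear_growth kappa_h h -> lipschitz_with l_h h ->
  0 < kappa_Psi -> 0 < l_Psi -> affine Psi0 -> linear_growth kappa_Psi Psi0 ->
  is_gaussian mu0 ->
  let q := (2 * maxn (3 + du) (maxn (4 + dy) (2 * 4 ^ J)))%N in
  forall (eps : R) (Psi : 'cV[R]_du -> 'cV[R]_du),
  0 <= eps <= 1 ->
  (supnorm (fun u => Psi u - Psi0 u)%R <= eps%:E)%E -> lipschitz_with l_Psi Psi ->
  forall (N : nat), (0 < N)%N ->
  forall (d : measure_display) (Omega : measurableType d)
    (P : probability Omega R)
    (u0 : 'I_N -> {RV P >-> 'cV[R]_du})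
    (xi : nat -> 'I_N -> {RV P >-> 'cV[R]_du})
    (eta : nat -> 'I_N -> {RV P >-> 'cV[R]_dy}),
  enkf_inputs J mu0 Sigma Gamma u0 xi eta ->
  forall (phi : 'cV[R]_du -> R) (L_phi R_phi : R),
  0 < L_phi ->
  (forall u v, `|phi u - phi v| <= L_phi * enorm (u - v) * (1 + enorm u + enorm v)) ->
  0 < R_phi ->
  (forall u, `|phi u| <= R_phi * (1 + enorm u ^+ 2)) ->
  let mu_EK := fun w => empirical R (enkf Psi h Gamma y (fun i => u0 i w)
    (fun j i => xi j i w) (fun j i => eta j i w) J) in
  let mu_J := true_filter Psi h Sigma Gamma y mu0 J in
  ('E_P[(fun w => `|mean (mu_EK w) phi - mean mu_J phi| ^+ 2)%R] `^ 2^-1 <=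
   (C (moment q mu0) R_phi L_phi kappa_y kappa_Psi kappa_h l_h l_Psi Sigma Gamma J
    * ((Num.sqrt N%:R)^-1 + eps))%:E)%E.
Proof.
(* Positive dimension makes the total Lebesgue mass infinite, which is what excludes the default
   square root of a covariance. *)
case: du hdu => // n _; case: dy hdy => // m _.
exists (fun mq Rp Lp ky kP kh lh lP Sigma Gamma J =>
  projT1 (cid (exists_constant mq Rp Lp ky kP kh lP Sigma Gamma J))).
move=> Sigma Gamma J y ky sigma gamma h kh l_h Psi0 kP lP mu0 sS sG J1 ky0 s0 g0 yk sP gP
  kh0 lh0 gh lh kP0 lP0 aff gPsi0 gmu q eps Psi e01 sup lPsi N N0 d Omega P u0 xi eta inp
  phi Lp Rp Lp0 phiL Rp0 phiR.
case: (cid _) => K /= hK.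
(* This turns the moment in the constant into a second moment bound, hence into bounds on all
   moments of the Gaussian. *)
have q2 : (2 <= q)%N by rewrite leq_pmulr// leq_max.
exact: (hK y sigma gamma h l_h Psi0 mu0 sS sG J1 ky0 s0 g0 yk sP gP kh0 lh0 gh lh kP0 lP0
  aff gPsi0 gmu q q2 erefl eps Psi e01 sup lPsi N N0 d Omega P u0 xi eta inp phi Lp0 phiL Rp0 phiR).
Qed.
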